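(* Let $\{w_i\}_{i=1}^n$ be a basis of $\mathbb{R}^n$ and let $S\subseteq[n]$ have cardinality $|S|=d$. Let $(S_1,\dots,S_m)$ form a uniform cover of $S$ with equal weights $(\frac{p}{m},\dots,\frac{p}{m})$. Let $H=\mathrm{span}\{w_k : k\in S\}$, $H_j=\mathrm{span}\{w_k : k\in S_j\}$, $\widetilde{H}_j=\mathrm{span}\{w_k : k\in S\setminus S_j\}$, $d_j=\dim H_j=|S_j|$ and $\widetilde{d}_j=d-d_j=\dim\widetilde{H}_j$. Then for every convex body $K\subseteq\mathbb{R}^n$ such that $\max_{x\in H}|K\cap(x+H^\perp)|=|K\cap H^\perp|$ the following inequalities hold: $$|K\cap H^\perp|^{p-1}|K|\geqslant\frac{|\wedge_{i\in S}w_i|^{p-1}\prod_{j=1}^m(d_j!)^{\frac{p}{m}}}{\Gamma\left(1+\frac{dm}{p}\right)^{\frac{p}{m}}\prod_{j=1}^m|\wedge_{k\in S\setminus S_j}w_k|^{\frac{p}{m}}}\prod_{j=1}^m|K\cap\widetilde{H}_j^\perp|^{\frac{p}{m}},$$ $$|K\cap H^\perp||K|^{p-1}\geqslant\frac{|\wedge_{i\in S}w_i|\prod_{j=1}^m(\widetilde{d}_j!)^{\frac{p}{m}}}{\Gamma\left(1+\frac{dm(p-1)}{p}\right)^{\frac{p}{m}}\prod_{j=1}^m|\wedge_{k\in S_j}w_k|^{\frac{p}{m}}}\prod_{j=1}^m|K\cap H_j^\perp|^{\frac{p}{m}},$$ $$|K\cap H^\perp|^{p-1}|K|\geqslant\frac{|\wedge_{i\in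 S}w_i|\prod_{j=1}^m(d_j!)^{\frac{p}{m}}}{\Gamma\left(1+\frac{dm}{p}\right)^{\frac{p}{m}}\prod_{j=1}^m|\wedge_{k\in S_j}w_k|^{\frac{p}{m}}}\prod_{j=1}^m|K\cap(H_j\oplus H^\perp)|^{\frac{p}{m}},$$ $$|K\cap H^\perp||K|^{p-1}\geqslant\frac{|\wedge_{i\in S}w_i|^{p-1}\prod_{j=1}^m(\widetilde{d}_j!)^{\frac{p}{m}}}{\Gamma\left(1+\frac{dm(p-1)}{p}\right)^{\frac{p}{m}}\prod_{j=1}^m|\wedge_{k\in S\setminus S_j}w_k|^{\frac{p}{m}}}\prod_{j=1}^m|K\cap(\widetilde{H}_j\oplus H^\perp)|^{\frac{p}{m}}.$$
   Context: $[n]=\{1,\dots,n\}$. For $m\geqslant1$, subsets $S_1,\dots,S_m\subseteq S$ (not necessarily distinct) form a uniform cover of $S\subseteq[n]$ with weights $(p_1,\dots,p_m)$, $p_j>0$ for all $j$, if $\sum_{j=1}^m p_j\chi_{S_j}(i)=1$ for every $i\in S$. Here all weights equal $p/m$, so $p>0$ is the sum of the weights. For vectors $u_1,\dots,u_k$, $|\wedge_{i=1}^k u_i|$ is the $k$-dimensional volume of the parallelepiped they span (equal to $1$ for the empty family). A convex body is a compact convex set with non-empty interior. $F^\perp$ is the orthogonal complement in $\mathbb{R}^n$ of the linear subspace $F$, and $|\cdot|$ of a set denotes Lebesgue measure in the corresponding (affine) subspace (unit point mass on a point). $\Gamma$ is the Gamma function. *)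

(* Defs.v *)
From HB Require Import structures.
From mathcomp Require Import all_boot all_order all_algebra.
From mathcomp Require Import all_classical all_reals all_analysis.

Set Implicit Arguments.
Unset Strict Implicit.
Unset Printing Implicit Defensive.

Import Order.TTheory GRing.Theory Num.Theory numFieldNormedType.Exports.

Local Open Scope classical_set_scope.
Local Open Scope ring_scope.

(* Euclidean space R^n is 'rV[R]_n.  A linear subspace of R^n is given by a
   matrix with n columns and is the row space of that matrix, as in mxalgebra. *)

Definition tcons (T : Type) (k : nat) (z : T * k.-tuple T) : k.+1.-tuple T :=
  [tuple of z.1 :: z.2].

(* Lebesgue measure on R^k, as the k-fold product of the Lebesgue measure on R;
   R^0 is a point of mass 1. *)
Fixpoint lebesgue_tuple (R : realType) (k : nat) : set (k.-tuple R) -> \bar R :=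
  match k with
  | 0 => \d_([tuple] : 0.-tuple R)
  | k'.+1 => pushforward (lebesgue_measure \x @lebesgue_tuple R k')%E (@tcons R k')
  end.

Section lebesgue_tuple_measure.
Context (R : realType).

Let measurable_tcons k : measurable_fun setT (@tcons R k).
Proof. by apply: measurable_cons. Qed.

Let tsplit k (t : k.+1.-tuple R) : R * k.-tuple R := (thead t, [tuple of behead t]).

Let measurable_tsplit k : measurable_fun setT (@tsplit k).
Proof.
by apply: measurable_fun_pair; [exact: measurable_tnth|exact: measurable_behead].
Qed.

Let lebesgue_tuple_spec k (mu := @lebesgue_tuple R k) :
  [/\ mu set0 = 0%E, forall A, (0 <= mu A)%E, semi_sigma_additive mu &
      sigma_finite setT mu].
Proof.
rewrite {}/mu; elim: k => [|k [mu0 mu_ge0 mu_add mu_fin]] /=.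
  split; [exact: measure0 | by move=> A | exact: measure_semi_sigma_additive |].
  exact: (sigma_finiteT (dirac ([tuple] : 0.-tuple R))).
pose m1 := isMeasure.Build _ _ _ (@lebesgue_tuple R k) mu0 mu_ge0 mu_add.
pose mu' : {measure set (k.-tuple R) -> \bar R} := HB.pack (@lebesgue_tuple R k) m1.
pose m2 := Measure_isSigmaFinite.Build _ _ _ mu' mu_fin.
pose mu : {sigma_finite_measure set (k.-tuple R) -> \bar R} :=
  HB.pack (@lebesgue_tuple R k) m1 m2.
pose nu : {measure set _ -> \bar R} := (lebesgue_measure \x mu)%E.
pose f := @tcons R k.
have mf : measurable_fun setT f by exact: measurable_tcons.
split.
- exact: (@measure0 _ _ _ (pushforward nu f)).
- by move=> A; exact: (@measure_ge0 _ _ _ (pushforward nu f)).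
- exact: (@measure_semi_sigma_additive _ _ _ (pushforward nu f)).
have /sigma_finiteP[F [TF ndF Foo]] := sigma_finiteT (@lebesgue_measure R).
have /sigma_finiteP[G [TG ndG Goo]] := sigma_finiteT mu.
exists (fun i => @tsplit k @^-1` (F i `*` G i)).
  rewrite -preimage_bigcup (_ : \bigcup_i _ = setT) ?preimage_setT//.
  rewrite -setXTT TF TG predeqE => -[x y]; split.
    by move=> [n _ []/= ? ?]; split; exists n.
  move=> [/= [n _ Fnx] [m _ Gmy]]; exists (maxn n m) => //; split.
  - by move: x Fnx; exact/subsetPset/ndF/leq_maxl.
  - by move: y Gmy; exact/subsetPset/ndG/leq_maxr.
move=> i; have [mFi Fioo] := Foo i; have [mGi Gioo] := Goo i; split.
  rewrite -[X in measurable X]setTI; apply: measurable_tsplit => //.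
  exact: measurableX.
suff -> : pushforward nu f (@tsplit k @^-1` (F i `*` G i)) = nu (F i `*` G i).
  have -> : nu (F i `*` G i) = (lebesgue_measure (F i) * mu (G i))%E.
    exact: product_measure1E.
  by rewrite lte_mul_pinfty// ge0_fin_numE.
rewrite /pushforward -comp_preimage; congr (nu _).
rewrite (_ : @tsplit k \o f = id)// funeqE => -[x t] /=.
by rewrite /tsplit /f /tcons theadE; congr (_, _); exact: val_inj.
Qed.

Let lebesgue_tuple0 k : @lebesgue_tuple R k set0 = 0%E.
Proof. by have [] := lebesgue_tuple_spec k. Qed.

Let lebesgue_tuple_ge0 k (A : set (k.-tuple R)) : (0 <= lebesgue_tuple A)%E.
Proof. by have [] := lebesgue_tuple_spec k. Qed.

Let lebesgue_tuple_semi_sigma_additive k :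
  semi_sigma_additive (@lebesgue_tuple R k).
Proof. by have [] := lebesgue_tuple_spec k. Qed.

Let lebesgue_tuple_sigma_finite k : sigma_finite setT (@lebesgue_tuple R k).
Proof. by have [] := lebesgue_tuple_spec k. Qed.

HB.instance Definition _ k := isMeasure.Build _ _ _ (@lebesgue_tuple R k)
  (@lebesgue_tuple0 k) (@lebesgue_tuple_ge0 k)
  (@lebesgue_tuple_semi_sigma_additive k).

HB.instance Definition _ k := Measure_isSigmaFinite.Build _ _ _
  (@lebesgue_tuple R k) (@lebesgue_tuple_sigma_finite k).

End lebesgue_tuple_measure.

Definition row_of_tuple (R : realType) (k : nat) (t : k.-tuple R) : 'rV[R]_k :=
  \row_i tnth t i.

(* Only applied to bounded sets, where [fine] loses nothing. *)
Definition volume (R : realType) (n : nat) (A : set 'rV[R]_n) : R :=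
  fine (lebesgue_tuple [set t | A (row_of_tuple t)]).

Definition orthonormal_basis_of (R : realType) (m n : nat) (F : 'M[R]_(m, n))
    (B : 'M[R]_(\rank F, n)) : Prop :=
  B *m B^T = 1%:M /\ (B == F)%MS.

(* The default value is never used: see orthonormal_basisP. *)
Definition orthonormal_basis (R : realType) (m n : nat) (F : 'M[R]_(m, n)) :
    'M[R]_(\rank F, n) :=
  xget (row_base F) [set B | orthonormal_basis_of B].

Lemma orthonormal_exists (R : realType) (k n : nat) (A : 'M[R]_(k, n)) :
  row_free A -> exists2 B : 'M[R]_(k, n), B *m B^T = 1%:M & (B == A)%MS.
Proof.
elim: k A => [|k IHk] A freeA.
  by exists A; rewrite ?submx_refl//; apply/matrixP => -[].
suff [B BB BA] : exists2 B : 'M[R]_(1 + k, n), B *m B^T = 1%:M & (B <= A)%MS.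
  exists B => //; have freeB : row_free B.
    by apply/row_freeP; exists B^T.
  by rewrite -(geq_leqif (mxrank_leqif_eq BA)) (eqP freeA) (eqP freeB).
move: A freeA; rewrite -[k.+1]/(1 + k)%N => A.
rewrite -[A]vsubmxK; move: (usubmx A) (dsubmx A) => a D freeA.
have freeD : row_free D.
  move: freeA; rewrite -!kermx_eq0 => /rowV0P kA; apply/rowV0P => v /sub_kermxP vD.
  have /kA/(congr1 rsubmx) : (row_mx 0 v <= kermx (col_mx a D))%MS.
    by apply/sub_kermxP; rewrite mul_row_col mul0mx add0r.
  by rewrite row_mxKr linear0.
have [B BB /andP[BD DB]] := IHk D freeD.
pose u := a - a *m B^T *m B.
have uB : u *m B^T = 0 by rewrite mulmxBl -(mulmxA _ B) BB mulmx1 subrr.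
have u0 : u != 0.
  apply: contraTneq freeA => /subr0_eq aE; rewrite /row_free neq_ltn.
  have : (col_mx a D <= D)%MS.
    by rewrite col_mx_sub submx_refl andbT aE (submx_trans _ BD)// submxMl.
  by move=> /mxrankS; rewrite (eqP freeD) => rk; rewrite ltnS rk.
have uA : (u <= col_mx a D)%MS.
  rewrite addmx_sub ?eqmx_opp//; first by rewrite -addsmxE addsmxSl.
  by rewrite (submx_trans (submxMl _ _))// (submx_trans BD)// -addsmxE addsmxSr.
clearbody u.
pose s := (u *m u^T) 0 0.
have sE : u *m u^T = s%:M by rewrite [LHS]mx11_scalar.
have s0 : 0 < s.
  have [j uj] : exists j, u 0 j != 0.
    apply/existsP; rewrite -negb_forall; apply: contra u0 => /forallP u0.
    by apply/eqP/rowP => j; rewrite [RHS]mxE; exact/eqP.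
  rewrite /s mxE (bigD1 j)//= mxE -expr2 ltr_wpDr ?exprn_even_gt0//.
  by apply: sumr_ge0 => i _; rewrite mxE -expr2 sqr_ge0.
exists (col_mx ((Num.sqrt s)^-1 *: u) B).
  rewrite tr_col_mx mul_col_row BB linearZ/= -!scalemxAl -scalemxAr uB scaler0 sE.
  rewrite -[B *m _]trmxK trmx_mul !linearZ/= trmxK.
  rewrite -scalemxAl uB scaler0 trmx0 !scale_scalar_mx mulrA -invfM -expr2.
  by rewrite sqr_sqrtr ?ltW// mulVf ?gt_eqF// -scalar_mx_block.
by rewrite col_mx_sub scalemx_sub//= (submx_trans BD)// -addsmxE addsmxSr.
Qed.

Lemma orthonormal_basisP (R : realType) (m n : nat) (F : 'M[R]_(m, n)) :
  orthonormal_basis_of (orthonormal_basis F).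
Proof.
apply: (@xgetPex _ (row_base F) [set B | orthonormal_basis_of B]).
have [B BB /eqmxP BF] := orthonormal_exists (row_base_free F).
exists B; split=> //.
by apply/eqmxP/(eqmx_trans BF)/eq_row_base.
Qed.

(* (dim F)-dimensional Lebesgue measure of A `&` (x + F), where the affine
   subspace x + F is identified with R^(dim F) by an orthonormal basis of F. *)
Definition section_volume (R : realType) (m n : nat) (A : set 'rV[R]_n)
    (x : 'rV[R]_n) (F : 'M[R]_(m, n)) : R :=
  volume [set c : 'rV[R]_(\rank F) | A (x + c *m orthonormal_basis F)].

Definition orthocompl (R : realType) (m n : nat) (F : 'M[R]_(m, n)) : 'M[R]_n :=
  kermx F^T.

Lemma orthocomplP (R : realType) (m n : nat) (F : 'M[R]_(m, n)) (v : 'rV[R]_n) :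
  reflect (forall u : 'rV[R]_n, (u <= F)%MS -> v *m u^T = 0)
          (v <= orthocompl F)%MS.
Proof.
apply: (iffP sub_kermxP) => [vF u /submxP[c ->]|vF].
  by rewrite trmx_mul mulmxA vF mul0mx.
apply/matrixP => i j; have /matrixP/(_ i 0) := vF _ (row_sub j F).
rewrite !mxE (ord1 i) => vFj; rewrite -[RHS]vFj.
by apply: eq_bigr => l _; rewrite !mxE.
Qed.

Definition family_mx (R : realType) (n : nat) (w : 'I_n -> 'rV[R]_n)
    (A : {set 'I_n}) : 'M[R]_(#|A|, n) :=
  \matrix_(i < #|A|) w (enum_val i).

Definition parallelepiped (R : realType) (k n : nat) (U : 'M[R]_(k, n)) :
    set 'rV[R]_n :=
  [set c *m U | c in [set c : 'rV[R]_k | forall i, 0 <= c 0 i <= 1]].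

(* k-dimensional volume of the parallelepiped spanned by the k rows of U; when
   the rows are dependent the parallelepiped has dimension less than k. *)
Definition wedge_norm (R : realType) (k n : nat) (U : 'M[R]_(k, n)) : R :=
  if row_free U then section_volume (parallelepiped U) 0 U else 0.

Definition uniform_cover (R : realType) (n m : nat) (S : {set 'I_n})
    (C : 'I_m -> {set 'I_n}) (q : 'I_m -> R) : Prop :=
  [/\ (0 < m)%N, forall j, C j \subset S, forall j, 0 < q j &
      forall i, i \in S -> \sum_(j < m) q j * (i \in C j)%:R = 1].

Definition convex_body (R : realType) (n : nat) (K : set 'rV[R]_n) : Prop :=
  [/\ compact K, convex_set K & K° !=set0].

Definition Gamma (R : realType) (x : R) : R :=
  (\int[lebesgue_measure]_(t in `]0, +oo[) (t `^ (x - 1) * expR (- t)))%R.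

(* Main.v *)
Require Import Defs.
From mathcomp Require Import all_boot all_order all_algebra fingroup perm.
From mathcomp Require Import all_classical all_reals all_analysis.
From mathcomp Require Import measurable_realfun.
From mathcomp Require Import ring lra zify.

(** Let [H] be the span of [w] on [S] and [f x] the volume of the section of [K] by
    [x + H^perp].  By Prekopa's theorem [f] is log-concave, and by hypothesis its
    maximum [M] is attained at the origin.  In coordinates [y] with respect to a
    basis of [H] and an orthonormal basis [Q] of [H^perp], every section in the
    statement is the integral [I_j] of [f] over a coordinate subspace, times the
    volume of the parallelepiped spanned by the basis vectors involved.  With the
    basis [w] these are the sections by [H_j + H^perp]; with the basis of [H] dual
    to [w] they are the sections by the orthogonal complements of the spans of [w]
    on [S - S_j], and the volumes of the parallelepipeds of the dual basis are
    quotients of those of [w] by Jacobi's identity ([biorthogonal_gram_det]).  So all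
    four inequalities are instances of one inequality in coordinates,
    [uniform_cover_powers], for the cover or for its complementary cover.

    As the weights are all equal, each index lies in the same number [k = m / p] of
    sets, and the inequality becomes
      [prod_j (d_j! I_j) * M ^ k <= (k d)! I ^ k M ^ m]
    ([log_concave_uniform_cover]).  Write [f] as [M] times the expectation, for an
    exponential random variable [s], of the indicator of the convex level set
    [L_s] where [f >= M exp (- s)]; then [I] and [I_j] are [M] times the expectations
    of the volume of [L_s] and of its coordinate sections.  All these volumes
    increase with [s], so Chebyshev's inequality ([chebyshev_Eexp_prod]) bounds the
    product of the expectations of the sections by the expectation of their product.
    For a fixed [s], Liakopoulos' dual Loomis-Whitney inequality
    ([dual_loomis_whitney]) bounds that product by [(d! |L_s|) ^ k].  Finally
    log-concavity makes [|L_s| / s ^ d] nonincreasing, and Berwald's inequality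
    ([berwald_Eexp]) bounds the [k]-th moment of [|L_s|] by a power of its mean.

    The dual Loomis-Whitney inequality follows from Barthe's inequality for
    coordinate subspaces ([dominates_products_iint]), applied to the exponential of
    minus the gauge of [L_s].  Barthe's inequality and Prekopa's theorem are both
    obtained by integrating out one direction at a time with the one-dimensional
    Prekopa-Leindler inequality ([prekopa_leindler_line]), which only involves
    functions whose superlevel sets are intervals. *)

Set Implicit Arguments.
Unset Strict Implicit.
Unset Printing Implicit Defensive.

Import Order.TTheory GRing.Theory Num.Theory numFieldNormedType.Exports.

Local Open Scope classical_set_scope.
Local Open Scope ring_scope.

(** * Integrals on the line under translations and dilations *)

Section line_integral.
Context (R : realType).
Local Open Scope ereal_scope.
Notation leb := (@lebesgue_measure R).

Lemma ge0_integral_shift (F : R -> \bar R) (c : R) :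
  measurable_fun [set: R] F -> (forall x, 0 <= F x) ->
  \int[leb]_x F (x + c)%R = \int[leb]_x F x.
Proof.
move=> mF F0.
pose s : measurableTypeR R -> measurableTypeR R := fun x => (x + c)%R.
have ms : measurable_fun setT s by apply: measurable_funD.
transitivity (\int[pushforward leb s]_x F x).
  by rewrite ge0_integral_pushforward.
apply: eq_measure_integral => //= A mA _; apply/esym/lebesgue_measure_unique => //=.
move=> _ [[a b]] _ <-; rewrite /pushforward.
rewrite (_ : s @^-1` _ = `](a - c)%R, (b - c)%R]%classic); last first.
  by apply/seteqP; split => x /=; rewrite /s !in_itv/= ltrBlDr lerBrDr.
rewrite !lebesgue_measure_itv/= !lte_fin ltrD2r; case: ifP => // _.
by rewrite -!EFinB; congr (_%:E); ring.
Qed.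

Lemma ge0_integral_dilate (F : R -> \bar R) (c : R) : c != 0%R ->
  measurable_fun [set: R] F -> (forall x, 0 <= F x) ->
  \int[leb]_x F (c * x)%R = `|c|^-1%:E * \int[leb]_x F x.
Proof.
move=> c0 mF F0.
have ci : (0 <= `|c|^-1)%R by rewrite invr_ge0.
pose s : measurableTypeR R -> measurableTypeR R := fun x => (c * x)%R.
have ms : measurable_fun setT s by apply: measurable_funM.
have c1 : (0 <= `|c|)%R by [].
transitivity (\int[pushforward leb s]_x F x).
  by rewrite ge0_integral_pushforward.
rewrite -[in RHS](@ge0_integral_mscale _ _ _ _ _ _ (NngNum ci))//.
apply: eq_measure_integral => //= A mA _.
suff : leb A = mscale (NngNum c1) (pushforward leb s) A.
  rewrite /mscale/= => ->.
  by rewrite muleA -EFinM mulVf ?normr_eq0// mul1e.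
  exact: ms.
move=> ms'; apply: lebesgue_measure_unique => //=.
move=> _ [[a b]] _ <-; rewrite /mscale /pushforward/=.
rewrite /pushforward. have [cp|cn] : (0 < c \/ c < 0)%R by move: c0; rewrite neq_lt => /orP[]; [right|left].
  rewrite (_ : _ @^-1` _ = `](a / c)%R, (b / c)%R]%classic); last first.
    by apply/seteqP; split => x /=; rewrite /s !in_itv/= ltr_pdivrMr// ler_pdivlMr// ![(x * c)%R]mulrC.
  rewrite !lebesgue_measure_itv/= !lte_fin ltr_pM2r ?invr_gt0//; case: ifP => _; last by rewrite mule0.
  by rewrite -!EFinB -EFinM gtr0_norm// -mulrBl mulrC divfK// gt_eqF.
rewrite (_ : _ @^-1` _ = `[(b / c)%R, (a / c)%R[%classic); last first.
  by apply/seteqP; split => x /=; rewrite /s !in_itv/= ltr_ndivlMr// ler_ndivrMr// ![(x * c)%R]mulrC andbC.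
rewrite !lebesgue_measure_itv/= !lte_fin ltr_nM2r ?invr_lt0//; case: ifP => _; last by rewrite mule0.
by rewrite -!EFinB -EFinM ltr0_norm// -mulrBl mulrC mulrN divfK ?lt_eqF// opprB.
Qed.

End line_integral.

(** * Iterated integrals and linear changes of variables *)

Section iterated_integral.
Context (R : realType) (n : nat).
Local Open Scope ereal_scope.
Notation leb := (@lebesgue_measure R).
Notation V := 'rV[R]_n.
Implicit Types (g : V -> \bar R) (vs : seq V) (a v : V).

(** Matrices carry no measurable structure, so measurability of a function of a
    vector is expressed in the coordinates of the product sigma-algebra on tuples. *)
Definition borel g := measurable_fun [set: n.-tuple R] (g \o @row_of_tuple R n).

Lemma borel_comp d (T : measurableType d) g (phi : T -> V) : borel g ->
  (forall i, measurable_fun [set: T] (fun z => phi z 0%R i)) ->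
  measurable_fun [set: T] (g \o phi).
Proof.
move=> bg mphi.
have -> : g \o phi = (g \o @row_of_tuple R n) \o (fun z => [tuple phi z 0%R i | i < n]).
  apply/funext => z /=; congr (g _); apply/rowP => i.
  by rewrite mxE tnth_mktuple.
apply: measurableT_comp => //.
apply/measurable_fun_tnthP => i.
by apply: eq_measurable_fun (mphi i) => z _ /=; rewrite tnth_mktuple.
Qed.

Lemma borel_line g a v : borel g ->
  measurable_fun [set: R] (fun x : R => g (a + x *: v)%R).
Proof.
move=> bg; apply: (borel_comp (phi := fun x : R => (a + x *: v)%R)) => // i.
under eq_fun do rewrite !mxE.
by apply: measurable_funD => //; apply: measurable_funM.
Qed.

(** Up to the volume of the parallelepiped spanned by [vs], this is the integral of
    [g] over the affine subspace [a + span vs].  Iterating one-dimensional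
    integrals along an arbitrary list lets one coordinate be integrated out at a
    time, which is how every inequality below is reduced to the line. *)
Definition iint vs g : V -> \bar R :=
  foldr (fun v h a => \int[leb]_x h (a + x *: v)%R) g vs.

Lemma iint_cat s1 s2 g : iint (s1 ++ s2) g = iint s1 (iint s2 g).
Proof. exact: foldr_cat. Qed.

Lemma iint_ge0 vs g a : (forall x, 0 <= g x) -> 0 <= iint vs g a.
Proof.
move=> g0; elim: vs a => //= v vs IH a.
by apply: integral_ge0 => x _.
Qed.

Lemma borel_iint vs g : (forall x, 0 <= g x) -> borel g -> borel (iint vs g).
Proof.
move=> g0 bg; elim: vs => //= v vs IH.
pose f (z : n.-tuple R * R) := iint vs g (row_of_tuple z.1 + z.2 *: v)%R.
apply: (@measurable_fun_fubini_tonelli_F _ _ _ _ _ leb f).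
- apply: (borel_comp (phi := fun z : n.-tuple R * R => (row_of_tuple z.1 + z.2 *: v)%R)) => // i.
  under eq_fun do rewrite !mxE.
  apply: measurable_funD; last by apply: measurable_funM.
  exact: (measurableT_comp (measurable_tnth i)).
- by move=> z; exact: iint_ge0.
Qed.

Lemma iint_le vs g h a : (forall x, 0 <= g x) -> borel g -> borel h ->
  (forall x, g x <= h x) -> iint vs g a <= iint vs h a.
Proof.
move=> g0 bg bh gh; have h0 x : 0 <= h x by exact: le_trans (gh x).
elim: vs a => //= v vs IH a.
apply: ge0_le_integral => //.
- by move=> x _; exact: iint_ge0.
- by apply: borel_line; exact: borel_iint.
- by apply: borel_line; exact: borel_iint.
Qed.

Lemma iintZ vs g a (k : R) : (forall x, 0 <= g x) -> borel g -> (0 <= k)%R ->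
  iint vs (fun x => k%:E * g x) a = k%:E * iint vs g a.
Proof.
move=> g0 bg k0; elim: vs a => //= v vs IH a.
under eq_integral do rewrite IH.
rewrite ge0_integralZl//.
- by apply: borel_line; exact: borel_iint.
- by move=> x _; exact: iint_ge0.
Qed.

Lemma iint_shift_mem vs g a v (c : R) : (forall x, 0 <= g x) -> borel g ->
  v \in vs -> iint vs g (a + c *: v)%R = iint vs g a.
Proof.
move=> g0 bg; elim: vs a => //= u vs IH a; rewrite inE => /orP[/eqP ->|vvs].
  rewrite -[RHS](ge0_integral_shift c).
  - by apply: eq_integral => x _; rewrite -addrA -scalerDl [(c + x)%R]addrC.
  - by apply: borel_line; exact: borel_iint.
  - by move=> x; exact: iint_ge0.
by apply: eq_integral => x _; rewrite addrAC IH.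
Qed.

Lemma iint_shift k (U : 'M[R]_(k, n)) vs g a (c : 'rV[R]_k) :
  (forall x, 0 <= g x) -> borel g -> (forall i, row i U \in vs) ->
  iint vs g (a + c *m U)%R = iint vs g a.
Proof.
move=> g0 bg Uvs; rewrite mulmx_sum_row.
elim: (index_enum _) a => [|i s IH] a; first by rewrite big_nil addr0.
by rewrite big_cons addrA IH iint_shift_mem.
Qed.

(** Integrating along [f1 i] or along [f2 i] is the same for a function that is
    invariant under the differences [f2 i - f1 i]; this is the shear part of the
    change of variables. *)
Lemma iint_congr (I : Type) (s : seq I) (f1 f2 : I -> V) g a :
  (forall i b (c : R), g (b + c *: (f2 i - f1 i))%R = g b) ->
  iint [seq f1 i | i <- s] g a = iint [seq f2 i | i <- s] g a.
Proof.
move=> gf; suff [] : (forall i b (c : R),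
    iint [seq f1 i | i <- s] g (b + c *: (f2 i - f1 i)) = iint [seq f1 i | i <- s] g b)
  /\ forall a, iint [seq f1 i | i <- s] g a = iint [seq f2 i | i <- s] g a by [].
elim: s => //= i s [IH1 IH2]; split.
  by move=> j b c; apply: eq_integral => x _; rewrite addrAC IH1.
move=> b; apply: eq_integral => x _; rewrite -IH2 -[LHS](IH1 i _ x).
by rewrite -addrA -scalerDr [(f1 i + _)%R]addrC subrK.
Qed.

(** Tonelli's theorem; all invariance under reordering rests on it. *)
Lemma iint_swap u v vs g a : (forall x, 0 <= g x) -> borel g ->
  iint [:: u, v & vs] g a = iint [:: v, u & vs] g a.
Proof.
move=> g0 bg /=.
pose f (z : R * R) := iint vs g (a + z.1 *: u + z.2 *: v)%R.
transitivity (\int[leb]_y \int[leb]_x f (x, y)); last first.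
  by apply: eq_integral => x _; apply: eq_integral => y _; rewrite /f/= addrAC.
apply: (@fubini_tonelli _ _ _ _ R leb leb f).
- apply: (borel_comp (phi := fun z : R * R => (a + z.1 *: u + z.2 *: v)%R)).
    exact: borel_iint.
  move=> i; under eq_fun do rewrite !mxE.
  by apply: measurable_funD; [apply: measurable_funD => //|]; apply: measurable_funM.
- by move=> z; exact: iint_ge0.
Qed.

Lemma iint_perm s1 s2 g a : (forall x, 0 <= g x) -> borel g ->
  perm_eq s1 s2 -> iint s1 g a = iint s2 g a.
Proof.
move=> g0 bg p12; apply: (catCA_perm_ind (P := fun s => iint s1 g a = iint s g a)) p12 _ => //.
move=> t1 t2 t3 ->; elim: t2 t1 a => //= v t2 IH t1 a.
have -> : iint (t1 ++ v :: t2 ++ t3) g a = iint (v :: t1 ++ t2 ++ t3) g a.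
  elim: t1 a => // u t1 IH1 a; rewrite [RHS]iint_swap//= .
  by apply: eq_integral => x _; rewrite IH1.
rewrite [LHS]/=; apply: eq_integral => x _; exact: IH.
Qed.

Lemma iint_dilate_head v vs g a (c : R) : (forall x, 0 <= g x) -> borel g ->
  c != 0%R -> iint ((c *: v)%R :: vs) g a = `|c|^-1%:E * iint (v :: vs) g a.
Proof.
move=> g0 bg c0 /=; rewrite -[RHS]ge0_integral_dilate//.
- by apply: eq_integral => x _; rewrite scalerA mulrC.
- by apply: borel_line; exact: borel_iint.
- by move=> x; exact: iint_ge0.
Qed.

Lemma iint_dilate vs g a (c : R) : (forall x, 0 <= g x) -> borel g -> c != 0%R ->
  iint [seq c *: v | v <- vs]%R g a = (`|c|^-1 ^+ size vs)%:E * iint vs g a.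
Proof.
move=> g0 bg c0; elim: vs a => [|v vs IH] a; first by rewrite expr0 mul1e.
rewrite [LHS]/=; under eq_integral do rewrite IH.
rewrite ge0_integralZl ?lee_fin ?exprn_ge0 ?invr_ge0//.
- by rewrite -[X in _ * X]/(iint ((c *: v)%R :: vs) g a) iint_dilate_head// muleA -EFinM -exprSr.
- by apply: borel_line; exact: borel_iint.
- by move=> x _; exact: iint_ge0.
Qed.

Definition rows k (U : 'M[R]_(k, n)) : seq V := [seq row i U | i <- enum 'I_k].

Lemma rowsS k (U : 'M[R]_(k.+1, n)) :
  rows U = row ord0 U :: rows (row' ord0 U).
Proof.
rewrite /rows enum_ordSl/= -map_comp; congr cons; apply: eq_map => i /=.
by apply/rowP => j; rewrite !mxE.
Qed.

Lemma row_of_tcons k (x : R) (t : k.-tuple R) (U : 'M[R]_(k.+1, n)) :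
  (row_of_tuple (tcons (x, t)) *m U = x *: row ord0 U + row_of_tuple t *m row' ord0 U)%R.
Proof.
apply/rowP => j; rewrite !mxE big_ord_recl !mxE tnth0; congr (_ + _)%R.
by apply: eq_bigr => i _; rewrite !mxE tnthS.
Qed.

Lemma measurable_comb k (U : 'M[R]_(k, n)) a i :
  measurable_fun [set: k.-tuple R] (fun t => (a + row_of_tuple t *m U)%R 0%R i).
Proof.
under eq_fun do rewrite !mxE.
apply: measurable_funD => //; apply: measurable_sum => j.
under eq_fun do rewrite mxE.
by apply: measurable_funM => //; exact: measurable_tnth.
Qed.

(** The recursion that defines [lebesgue_tuple] is the one that defines [iint], so
    the two agree by one application of Tonelli's theorem per coordinate. *)
Lemma iint_lebesgue k (U : 'M[R]_(k, n)) g a : (forall x, 0 <= g x) -> borel g ->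
  \int[@lebesgue_tuple R k]_t g (a + row_of_tuple t *m U)%R = iint (rows U) g a.
Proof.
move=> g0 bg; elim: k U a => [|k IH] U a.
  transitivity (\int[\d_([tuple] : 0.-tuple R)]_t g (a + row_of_tuple t *m U)%R).
    by apply: eq_measure_integral.
  rewrite integral_dirac//; last exact: borel_comp (measurable_comb U a).
  rewrite diracT mul1e /rows enum_ord0/= (_ : row_of_tuple _ *m U = 0%R) ?addr0//.
  by apply/rowP => j; rewrite !mxE big_ord0.
have mt : measurable_fun setT (@tcons R k) by apply: measurable_cons.
have mcomb x : measurable_fun [set: k.-tuple R] (fun t => g (a + x *: row ord0 U + row_of_tuple t *m row' ord0 U)%R).
  exact: borel_comp (measurable_comb _ _).
transitivity (\int[pushforward (lebesgue_measure \x @lebesgue_tuple R k) (@tcons R k)]_t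
   g (a + row_of_tuple t *m U)%R).
  by apply: eq_measure_integral.
rewrite ge0_integral_pushforward//; last exact: borel_comp (measurable_comb _ _).
rewrite preimage_setT fubini_tonelli1//=; last first.
  apply: measurableT_comp => //; exact: borel_comp (measurable_comb _ _).
rewrite rowsS /=; apply: eq_integral => x _; rewrite -IH.
by apply: eq_integral => t _; rewrite /fubini_F/= row_of_tcons addrA.
Qed.

End iterated_integral.

Section change_of_variables.
Context (R : realType) (n : nat).
Local Open Scope ereal_scope.
Notation V := 'rV[R]_n.
Implicit Types (g : V -> \bar R) (a : V).

Lemma size_rows k (U : 'M[R]_(k, n)) : size (rows U) = k.
Proof. by rewrite /rows size_map size_enum_ord. Qed.

(** Two matrices listing the same vectors in different orders differ by a
    permutation matrix on the left. *)
Lemma rows_perm_eq k1 k2 (U1 : 'M[R]_(k1, n)) (U2 : 'M[R]_(k2, n)) :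
  perm_eq (rows U1) (rows U2) ->
  exists (e : k1 = k2) (s : 'S_k2), castmx (e, erefl) U1 = (perm_mx s *m U2)%R.
Proof.
move=> p12; have e : k1 = k2.
  by have := perm_size p12; rewrite !size_rows.
exists e; case: k2 / e U2 p12 => U2 p12.
have sz (U : 'M[R]_(k1, n)) : size (rows U) == k1 by rewrite size_rows.
have /tuple_permP[s sE] : perm_eq (Tuple (sz U1)) (Tuple (sz U2)) by [].
exists s; rewrite castmx_id -row_permE; apply/row_matrixP => i.
have nthE (U : 'M[R]_(k1, n)) (j : 'I_k1) : nth 0%R (rows U) j = row j U.
  by rewrite (nth_map j) ?size_enum_ord// nth_ord_enum.
have := congr1 (fun q : seq V => nth 0%R q i) sE.
rewrite [X in X = _ -> _]nthE => ->; rewrite -tnth_nth tnth_mktuple (tnth_nth 0%R) nthE.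
by rewrite row_permEsub row_rowsub.
Qed.

Lemma iint_row_perm k (s : 'S_k) (U : 'M[R]_(k, n)) g a : (forall x, 0 <= g x) -> borel g ->
  iint (rows (row_perm s U)) g a = iint (rows U) g a.
Proof.
move=> g0 bg; apply: iint_perm => //.
rewrite (_ : rows (row_perm s U) = [seq row i U | i <- [seq s i | i <- enum 'I_k]]).
  apply: perm_map; apply: uniq_perm.
  - by rewrite (map_inj_uniq (@perm_inj _ s)) enum_uniq.
  - exact: enum_uniq.
  move=> i; rewrite [RHS]mem_enum [RHS]inE; apply/mapP; exists (s^-1 i)%g; rewrite ?mem_enum//.
  by rewrite permKV.
rewrite -map_comp; apply: eq_map => i /=; by rewrite row_permEsub row_rowsub.
Qed.

(** The change of variables formula for [T], kept as a predicate of [T] because it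
    is closed under products and hence follows from an LUP decomposition. *)
Definition scales_iint k (T : 'M[R]_k) := forall (U : 'M[R]_(k, n)) g a,
  (forall x, 0 <= g x) -> borel g ->
  iint (rows (T *m U)%R) g a = `|\det T|^-1%:E * iint (rows U) g a.

Lemma scales_iintM k (T1 T2 : 'M[R]_k) :
  scales_iint T1 -> scales_iint T2 -> scales_iint (T1 *m T2).
Proof.
move=> s1 s2 U g a g0 bg.
by rewrite -mulmxA s1// s2// muleA -EFinM det_mulmx normrM invfM.
Qed.

Lemma scales_iint_perm k (s : 'S_k) : scales_iint (perm_mx s).
Proof.
move=> U g a g0 bg; rewrite -row_permE iint_row_perm// det_perm.
by rewrite normrX normrN1 expr1n invr1 mul1e.
Qed.

Lemma iint_rows_shift k (U : 'M[R]_(k, n)) (c : 'rV[R]_k) g a : (forall x, 0 <= g x) -> borel g ->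
  iint (rows U) g (a + c *m U)%R = iint (rows U) g a.
Proof.
by move=> g0 bg; apply: iint_shift => // i; apply: map_f; rewrite mem_enum.
Qed.

(** By induction on the size: modulo the span of the last rows, whose translations
    leave the inner integral invariant, the first row is only rescaled. *)
Lemma scales_iint_upper k (T : 'M[R]_k) :
  (forall i j : 'I_k, (j < i)%N -> T i j = 0%R) -> (forall i, T i i != 0%R) ->
  scales_iint T.
Proof.
elim: k T => [|k IH] T up dg U g a g0 bg.
  by rewrite det_mx00 normr1 invr1 mul1e /rows enum_ord0.
pose T' := row' ord0 (col' ord0 T).
have T'up (i j : 'I_k) : (j < i)%N -> T' i j = 0%R.
  by move=> ji; rewrite !mxE up.
have T'dg i : T' i i != 0%R by rewrite !mxE.
have detT : (\det T = T ord0 ord0 * \det T')%R.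
  rewrite -(det_tr T) det_trig; last by apply/is_trig_mxP => i j ij; rewrite mxE up.
  rewrite -(det_tr T') det_trig; last by apply/is_trig_mxP => i j ij; rewrite mxE T'up.
  by rewrite big_ord_recl !mxE; congr (_ * _)%R; apply: eq_bigr => i _; rewrite !mxE.
have row0E : row ord0 (T *m U) = (T ord0 ord0 *: row ord0 U +
    (\row_j T ord0 (lift ord0 j)) *m row' ord0 U)%R.
  apply/rowP => j; rewrite !mxE big_ord_recl; congr (_ + _)%R.
  by apply: eq_bigr => i _; rewrite !mxE.
have row'E : row' ord0 (T *m U)%R = (T' *m row' ord0 U)%R.
  apply/matrixP => i j; rewrite !mxE big_ord_recl up// mul0r add0r.
  by apply: eq_bigr => l _; rewrite !mxE.
rewrite rowsS row'E row0E [LHS]/= -/(iint _ _).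
under eq_integral do rewrite IH//.
rewrite ge0_integralZl ?lee_fin ?invr_ge0//; last 2 first.
- by apply: borel_line; exact: borel_iint.
- by move=> x _; exact: iint_ge0.
under eq_integral do rewrite scalerDr addrA scalemxAl iint_rows_shift//.
rewrite -[X in _ * X]/(iint ((T ord0 ord0 *: row ord0 U)%R :: rows (row' ord0 U)) g a).
rewrite iint_dilate_head// muleA -EFinM detT normrM invfM mulrC.
by rewrite rowsS.
Qed.

(** The first row is moved to the innermost position; the inner integral is then
    invariant under its multiples, which are exactly what the remaining rows have
    in excess. *)
Lemma scales_iint_lower k (T : 'M[R]_k) :
  (forall i j : 'I_k, (i < j)%N -> T i j = 0%R) -> (forall i, T i i != 0%R) ->
  scales_iint T.
Proof.
elim: k T => [|k IH] T lo dg U g a g0 bg.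
  by rewrite det_mx00 normr1 invr1 mul1e /rows enum_ord0.
pose T' := row' ord0 (col' ord0 T).
have T'lo (i j : 'I_k) : (i < j)%N -> T' i j = 0%R.
  by move=> ij; rewrite !mxE lo.
have T'dg i : T' i i != 0%R by rewrite !mxE.
have detT : (\det T = T ord0 ord0 * \det T')%R.
  rewrite det_trig; last by apply/is_trig_mxP => i j ij; rewrite lo.
  rewrite det_trig; last by apply/is_trig_mxP => i j ij; rewrite T'lo.
  by rewrite big_ord_recl; congr (_ * _)%R; apply: eq_bigr => i _; rewrite !mxE.
have row0E : row ord0 (T *m U) = (T ord0 ord0 *: row ord0 U)%R.
  apply/rowP => j; rewrite !mxE big_ord_recl big1 ?addr0// => i _.
  by rewrite lo ?mul0r.
set v := row ord0 U; set U' := row' ord0 U.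
have rowiE i : row i (row' ord0 (T *m U)) = (T (lift ord0 i) ord0 *: v + row i (T' *m U'))%R.
  apply/rowP => j; rewrite !mxE big_ord_recl; congr (_ + _)%R.
  by apply: eq_bigr => l _; rewrite !mxE.
have hd u (W : 'M[R]_(k, n)) b : iint (u :: rows W) g b = iint (rows W) (iint [:: u] g) b.
  by rewrite -iint_cat; apply: iint_perm => //; rewrite perm_sym perm_catC.
have h0 b : 0 <= iint [:: T ord0 ord0 *: v]%R g b by exact: iint_ge0.
have bh : borel (iint [:: T ord0 ord0 *: v]%R g) by exact: borel_iint.
rewrite rowsS row0E hd.
have -> : iint (rows (row' ord0 (T *m U)%R)) (iint [:: T ord0 ord0 *: v]%R g) a =
          iint (rows (T' *m U')%R) (iint [:: T ord0 ord0 *: v]%R g) a.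
  apply: (@iint_congr R n _ (enum 'I_k) (fun i => row i (row' ord0 (T *m U)%R))
                     (fun i => row i (T' *m U')%R)) => i b c.
  rewrite rowiE opprD addrCA subrr addr0 -scaleNr.
  have -> : (c *: (- T (lift ord0 i) ord0 *: v) =
     (c * (- T (lift ord0 i) ord0 / T ord0 ord0)) *: (T ord0 ord0 *: v))%R.
    by rewrite !scalerA -mulrA divfK.
  by apply: iint_shift_mem; rewrite ?mem_head.
rewrite IH// -hd iint_dilate_head// muleA -EFinM detT normrM invfM mulrC.
by rewrite -rowsS.
Qed.

Lemma scales_iint_unitmx k (T : 'M[R]_k) : T \in unitmx -> scales_iint T.
Proof.
case: k T => [|k] T Tu; first by apply: scales_iint_upper => -[].
have := cormen_lup_correct T; have := cormen_lup_perm T; have := cormen_lup_detL T.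
have := @cormen_lup_lower _ _ T; have := @cormen_lup_upper _ _ T.
case: (cormen_lup T) => [[P L] U]/= Uup Llo detL /existsP[s /eqP->] PT.
have TE : T = (perm_mx s^-1%g *m (L *m U))%R.
  by rewrite [(L *m U)%R](esym PT) mulmxA -perm_mxM mulVg perm_mx1 mul1mx.
have detU : (\det U != 0)%R.
  move: Tu; rewrite unitmxE TE !det_mulmx detL mul1r unitrM => /andP[_].
  by rewrite unitfE.
rewrite TE; apply: scales_iintM; first exact: scales_iint_perm.
apply: scales_iintM.
  apply: scales_iint_lower => [i j ij|i]; last by rewrite Llo// eqxx oner_neq0.
  by rewrite Llo ?(ltnW ij)// -val_eqE ltn_eqF.
apply: scales_iint_upper => // i; move: detU.
rewrite -det_tr det_trig; last by apply/is_trig_mxP => i' j ij; rewrite mxE Uup.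
by move=> /prodf_neq0/(_ i isT); rewrite mxE.
Qed.

End change_of_variables.

(** * Borel sets and section volumes *)

Section volumes.
Context (R : realType) (n : nat).
Local Open Scope ereal_scope.
Notation V := 'rV[R]_n.
Implicit Types (A : set V) (a : V).

Definition borel_set A := measurable [set t : n.-tuple R | A (row_of_tuple t)].

Definition ind A : V -> \bar R := fun x => (\1_A x)%:E.

Lemma ind_ge0 A x : 0 <= ind A x.
Proof. by rewrite lee_fin. Qed.

Lemma borel_ind A : borel_set A -> borel (ind A).
Proof.
move=> mA; rewrite /borel.
have -> : ind A \o @row_of_tuple R n = EFin \o \1_[set t : n.-tuple R | A (row_of_tuple t)].
  by apply/funext => t /=; rewrite /ind !indicE; congr (_%:R%:E); apply/idP/idP; rewrite !inE.
by apply/measurable_EFinP; exact: measurable_indic.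
Qed.

(** Balls for the sup norm are boxes, so an open set is a countable union of boxes
    with rational centres. *)
Lemma borel_open A : open A -> borel_set A.
Proof.
move=> oA; rewrite /borel_set.
pose box (z : 'rV[rat]_n * nat) : set (n.-tuple R) :=
  [set t | forall i, (`|ratr (z.1 0%R i) - tnth t i| < z.2.+1%:R^-1)%R].
pose D z := if `[< box z `<=` [set t | A (row_of_tuple t)] >] then box z else set0.
have -> : [set t | A (row_of_tuple t)] = \bigcup_z D z.
  apply/seteqP; split => t; last first.
    by move=> [z _]; rewrite /D; case: asboolP => // zA zt; exact: zA.
  move=> /= At; have : nbhs (row_of_tuple t) A by exact: open_nbhs_nbhs.
  rewrite -nbhs_ballE => -[e /= e0 eA].
  have [k ke] : exists k : nat, (k.+1%:R^-1 < e / 2)%R.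
    have e2 : (0 < e / 2)%R by rewrite divr_gt0.
    by have [k _ /(_ k (leqnn _)) ?] := near_infty_natSinv_lt (PosNum e2); exists k.
  have kp : (0 < k.+1%:R^-1 :> R)%R by rewrite invr_gt0.
  have /choice[q qt] : forall i, exists q : rat, (`|ratr q - tnth t i| < k.+1%:R^-1)%R.
    move=> i; have /rat_in_itvoo[q] : (tnth t i < tnth t i + k.+1%:R^-1)%R by rewrite ltrDl.
    rewrite in_itv/= => /andP[q1 q2]; exists q.
    by rewrite ger0_norm ?subr_ge0 ?ltW// ltrBlDl.
  exists (\row_i q i, k) => //.
  have tb : box (\row_i q i, k) t by move=> i /=; rewrite mxE.
  rewrite /D; case: asboolP => // -[] u ub /=; apply: eA; split => // i j.
  rewrite /ball/= !mxE (splitr e) -(subrKA (ratr (q j))).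
  have := ub j; rewrite /= mxE => ubj.
  apply: le_lt_trans (ler_normD _ _) _.
  by rewrite ltrD//; apply: lt_trans ke => //; rewrite distrC.
apply: countable_bigcupT_measurable; first exact: countableP.
move=> z; rewrite /D; case: asboolP => // _.
rewrite (_ : box z = \bigcap_i [set t | (`|ratr (z.1 0%R i) - tnth t i| < z.2.+1%:R^-1)%R]); last first.
  by apply/seteqP; split => t zt; [move=> i _; exact: zt|move=> i; exact: (zt i)].
apply: fin_bigcap_measurable; first exact: finite_finset.
move=> i _; rewrite -[X in measurable X]setTI.
have mf : measurable_fun [set: n.-tuple R] (fun t => `|ratr (z.1 0%R i) - tnth t i|%R).
  apply: measurableT_comp => //; apply: measurable_funB => //; exact: measurable_tnth.
rewrite (_ : [set _ | _] = (fun t => `|ratr (z.1 0%R i) - tnth t i|%R) @^-1` `]-oo, (z.2.+1%:R^-1)%R[%classic).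
  by apply: mf => //; exact: measurable_itv.
by apply/seteqP; split => t; rewrite /= in_itv.
Qed.

Lemma borel_closed A : closed A -> borel_set A.
Proof.
move=> cA; have := borel_open (closed_openC cA).
move=> /measurableC; rewrite (_ : ~` _ = [set t : n.-tuple R | A (row_of_tuple t)])//.
by apply/seteqP; split => t /=; [exact: contrapT|move=> At; apply].
Qed.

Lemma borel_set_comp d (T : measurableType d) A (phi : T -> V) : borel_set A ->
  (forall i, measurable_fun [set: T] (fun z => phi z 0%R i)) ->
  measurable [set z | A (phi z)].
Proof.
move=> mA mphi; pose f z := [tuple phi z 0%R i | i < n].
have mf : measurable_fun setT f.
  apply/measurable_fun_tnthP => i.
  by apply: eq_measurable_fun (mphi i) => z _ /=; rewrite tnth_mktuple.
have fE z : row_of_tuple (f z) = phi z by apply/rowP => i; rewrite mxE tnth_mktuple.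
rewrite (_ : [set z | _] = setT `&` f @^-1` [set t | A (row_of_tuple t)]); first exact: mf.
by rewrite setTI; apply/seteqP; split => z; rewrite /= fE.
Qed.

Lemma borel_set_comb k (U : 'M[R]_(k, n)) A a : borel_set A ->
  measurable [set t : k.-tuple R | A (a + row_of_tuple t *m U)%R].
Proof. by move=> mA; apply: borel_set_comp => //; exact: measurable_comb. Qed.

(** Section volumes are iterated integrals of an indicator function. *)
Lemma lebesgue_section k (U : 'M[R]_(k, n)) A a : borel_set A ->
  @lebesgue_tuple R k [set t | A (a + row_of_tuple t *m U)%R] = iint (rows U) (ind A) a.
Proof.
move=> mA; rewrite -iint_lebesgue; [|exact: ind_ge0|exact: borel_ind].
pose B := [set t : k.-tuple R | A (a + row_of_tuple t *m U)%R].
transitivity (\int[@lebesgue_tuple R k]_t (\1_B t)%:E).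
  by rewrite integral_indic ?setIT//; exact: borel_set_comb.
by apply: eq_integral => t _; rewrite /ind !indicE; congr ((nat_of_bool _)%:R%:E).
Qed.

End volumes.

Section boxes.
Context (R : realType).
Local Open Scope ereal_scope.

Lemma measurable_tuple_box k (a b : R) :
  measurable [set t : k.-tuple R | forall i, (a <= tnth t i <= b)%R].
Proof.
rewrite (_ : [set t | _] = \bigcap_(i in setT) ((fun t : k.-tuple R => tnth t i) @^-1` `[a, b]%classic)).
  apply: fin_bigcap_measurable; first exact: finite_finset.
  by move=> i _; rewrite -[X in measurable X]setTI; apply: measurable_tnth => //; exact: measurable_itv.
by apply/seteqP; split => t tb; [move=> i _ /=; rewrite in_itv/=; exact: tb|move=> i; have := tb i I; rewrite /= in_itv].
Qed.

Lemma lebesgue_tuple_box k (a b : R) : (a <= b)%R ->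
  lebesgue_tuple [set t : k.-tuple R | forall i, (a <= tnth t i <= b)%R] = ((b - a) ^+ k)%:E.
Proof.
move=> ab; elim: k => [|k IH].
  by rewrite /= expr0 /dirac indicE mem_set// => -[].
rewrite /= /pushforward.
rewrite (_ : _ @^-1` _ = `[a, b]%classic `*` [set t : k.-tuple R | forall i, (a <= tnth t i <= b)%R]).
  rewrite product_measure1E//.
  - rewrite exprS EFinM -IH; congr (_ * _).
    rewrite [LHS]lebesgue_measure_itv/= lte_fin; case: ltP => // ba.
    by rewrite (@le_anti _ _ a b) ?ab ?ba// subrr.
  - exact: measurable_tuple_box.
apply/seteqP; split => -[x t] /=.
  move=> H; split; first by have := H ord0; rewrite tnth0 in_itv.
  by move=> i; have := H (lift ord0 i); rewrite tnthS.
rewrite in_itv/= => -[xab tab] i; case: (unliftP ord0 i) => [j|] ->; first by rewrite tnthS.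
by rewrite tnth0.
Qed.

End boxes.

Section section_volumes.
Context (R : realType) (n : nat).
Notation V := 'rV[R]_n.
Implicit Types (A : set V) (a x : V).

Lemma row_free_gram_unit k (G : 'M[R]_(k, n)) : row_free G -> G *m G^T \in unitmx.
Proof.
move=> fG; rewrite -row_free_unit -kermx_eq0; apply/rowV0P => v /sub_kermxP vGG.
have : (v *m G) *m (v *m G)^T = 0 by rewrite trmx_mul mulmxA -(mulmxA v) vGG mul0mx.
move=> vG0; have {}vG0 : v *m G = 0.
  set u := v *m G in vG0 *.
  have S0 : \sum_j u 0 j ^+ 2 = 0.
    have /matrixP/(_ 0 0) := vG0; rewrite mxE [RHS]mxE => S0; rewrite -[RHS]S0.
    by apply: eq_bigr => j _; rewrite [X in _ * X]mxE expr2.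
  apply/rowP => j; rewrite [RHS]mxE; apply/eqP; rewrite -sqrf_eq0; apply/eqP.
  by apply: (psumr_eq0P _ S0) => // i _; exact: sqr_ge0.
by apply/(row_free_inj fG); rewrite mul0mx.
Qed.

Lemma gram_det_sq k (T : 'M[R]_k) (B : 'M[R]_(k, n)) : B *m B^T = 1%:M ->
  \det ((T *m B) *m (T *m B)^T) = \det T ^+ 2.
Proof.
move=> BB; rewrite trmx_mul mulmxA -(mulmxA T) BB mulmx1 det_mulmx det_tr.
by rewrite expr2.
Qed.

Lemma gram_det_gt0 k (G : 'M[R]_(k, n)) : row_free G -> 0 < \det (G *m G^T).
Proof.
move=> fG; have [B BB /andP[_ /submxP[T GT]]] := orthonormal_exists fG.
have := row_free_gram_unit fG; rewrite unitmxE unitfE GT gram_det_sq// => T0.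
by rewrite lt_neqAle eq_sym T0 sqr_ge0.
Qed.

Lemma fineZ (k : R) (X : \bar R) : fine (k%:E * X)%E = k * fine X.
Proof.
case: X => [x||]//=; rewrite mulr0.
  by rewrite mulry; case: (ltgtP k 0) => [/ltr0_sg->|/gtr0_sg->|->]; rewrite ?sgr0 ?mul0e ?mul1e ?mulN1e.
by rewrite mulrNy; case: (ltgtP k 0) => [/ltr0_sg->|/gtr0_sg->|->]; rewrite ?sgr0 ?mul0e ?mul1e ?mulN1e.
Qed.

(** Any basis of [F] can replace the orthonormal one at the cost of its Gram
    determinant, the squared volume of the parallelepiped that it spans. *)
Lemma section_volumeE k m (G : 'M[R]_(k, n)) (F : 'M[R]_(m, n)) A x :
  row_free G -> (G == F)%MS -> borel_set A ->
  section_volume A x F = Num.sqrt (\det (G *m G^T)) * fine (iint (rows G) (ind A) x).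
Proof.
move=> fG GF mA; rewrite /section_volume /volume.
have [BB BF] := orthonormal_basisP F; move: BB BF; move: (orthonormal_basis F) => B BB BF.
have e : k = \rank F by rewrite -(eqP fG); exact: eqmx_rank.
case: (\rank F) / e B BB BF => B BB /eqmxP BF.
have /submxP[T GT] : (G <= B)%MS by rewrite BF; case/andP: GF.
have Tu : T \in unitmx.
  have : G *m G^T \in unitmx by exact: row_free_gram_unit.
  by rewrite GT unitmxE gram_det_sq// unitrX_pos// -unitmxE.
have dT : \det T != 0 by rewrite -unitfE -unitmxE.
rewrite GT scales_iint_unitmx//; [|exact: ind_ge0|exact: borel_ind].
rewrite gram_det_sq// sqrtr_sqr fineZ mulrA divff ?normr_eq0// mul1r.
by rewrite -lebesgue_section.
Qed.

(** The parallelepiped is the image of the unit cube, so its section volume is the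
    Gram factor of [section_volumeE] times the measure of the cube. *)
Lemma wedge_normE k (G : 'M[R]_(k, n)) : row_free G ->
  wedge_norm G = Num.sqrt (\det (G *m G^T)).
Proof.
move=> fG; rewrite /wedge_norm fG.
have Gr : G *m G^T \in unitmx by exact: row_free_gram_unit.
pose P := G^T *m invmx (G *m G^T).
have GP : G *m P = 1%:M by rewrite /P mulmxA mulmxV.
have parE x : parallelepiped G x <-> (x *m P *m G = x /\ forall i, 0 <= (x *m P) 0 i <= 1).
  split; first by move=> [c c01 <-]; rewrite -(mulmxA c) GP mulmx1.
  by move=> [xE c01]; exists (x *m P).
have mrow m (W : 'M[R]_(n, m)) i : measurable_fun [set: n.-tuple R]
    (fun t => (row_of_tuple t *m W) 0 i).
  by apply: eq_measurable_fun (measurable_comb W 0 i) => t _; rewrite add0r.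
have mP : borel_set (parallelepiped G).
  pose E (j : 'I_n) : set (n.-tuple R) :=
    (fun t => (row_of_tuple t *m (P *m G - 1%:M)) 0 j) @^-1` `[0, 0]%classic.
  pose D (i : 'I_k) : set (n.-tuple R) :=
    (fun t => (row_of_tuple t *m P) 0 i) @^-1` `[0, 1]%classic.
  rewrite /borel_set (_ : [set t | _] = (\bigcap_(j in setT) E j) `&` (\bigcap_(i in setT) D i)).
    apply: measurableI; apply: fin_bigcap_measurable => [|i _]; try exact: finite_finset.
      by rewrite -[X in measurable X]setTI; apply: mrow => //; exact: measurable_itv.
    by rewrite -[X in measurable X]setTI; apply: mrow => //; exact: measurable_itv.
  have Ein t j : E j t <-> (row_of_tuple t *m P *m G) 0 j = row_of_tuple t 0 j.
    rewrite /E/= in_itv/= mulmxBr mulmx1 mulmxA [X in 0 <= X <= 0]mxE.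
    rewrite [X in 0 <= _ + X <= 0]mxE -eq_le eq_sym subr_eq0.
    by split => /eqP.
  apply/seteqP; split => t /=.
    move=> /parE[tE t01]; split; first by move=> j _; apply/Ein; rewrite tE.
    by move=> i _; rewrite /D/= in_itv/=.
  move=> [tE t01]; apply/parE; split; first by apply/rowP => j; apply/Ein; exact: tE.
  by move=> i; have := t01 i I; rewrite /D/= in_itv.
rewrite (@section_volumeE _ _ G)//; last exact/eqmxP.
rewrite -lebesgue_section// (_ : [set t | _] = [set t : k.-tuple R | forall i, 0 <= tnth t i <= 1]).
  by rewrite lebesgue_tuple_box// subr0 expr1n/= mulr1.
apply/seteqP; split => t /=; rewrite add0r.
  move=> [c c01] /(row_free_inj fG) ct i; have := c01 i.
  by rewrite ct mxE.
move=> t01; exists (row_of_tuple t) => // i; by rewrite mxE.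
Qed.

End section_volumes.

(** * The Prekopa-Leindler inequality on the line *)

Section prekopa_leindler_line.
Context (R : realType).
Local Open Scope ereal_scope.
Notation leb := (@lebesgue_measure R).

Lemma prod_powRM (I : Type) (s : seq I) (P : pred I) (x y c : I -> R) :
  (forall i, P i -> 0 <= x i)%R -> (forall i, P i -> 0 <= y i)%R ->
  (\prod_(i <- s | P i) (x i * y i) `^ c i =
   (\prod_(i <- s | P i) x i `^ c i) * \prod_(i <- s | P i) y i `^ c i)%R.
Proof.
move=> x0 y0; rewrite -big_split/=; apply: eq_bigr => i Pi.
by rewrite powRM ?x0 ?y0.
Qed.

Lemma prod_powR_cst (I : Type) (s : seq I) (P : pred I) (c : I -> R) (t : R) :
  (0 < t)%R -> (\sum_(i <- s | P i) c i = 1)%R ->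
  (\prod_(i <- s | P i) t `^ c i = t)%R.
Proof.
move=> t0 c1; transitivity (t `^ (\sum_(i <- s | P i) c i))%R; last by rewrite c1 powRr1// ltW.
apply: (big_rec2 (fun x y => x = t `^ y)%R); first by rewrite powRr0.
by move=> i y1 y2 _ ->; rewrite powRD// (gt_eqF t0) implybT.
Qed.

(** Each term [y] is at least [exp m * (1 + ln y - m)], where [m] is the weighted
    mean of the logarithms; these tangent lines sum up to [exp m]. *)
Lemma amgm_weighted (I : Type) (s : seq I) (P : pred I) (c y : I -> R) :
  (forall i, P i -> 0 <= c i)%R -> (\sum_(i <- s | P i) c i = 1)%R ->
  (forall i, P i -> 0 < y i)%R ->
  (\prod_(i <- s | P i) y i `^ c i <= \sum_(i <- s | P i) c i * y i)%R.
Proof.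
move=> c0 c1 y0; set m := (\sum_(i <- s | P i) c i * ln (y i))%R.
have -> : (\prod_(i <- s | P i) y i `^ c i = expR m)%R.
  rewrite /m; apply: (big_rec2 (fun x y => x = expR y)%R); first by rewrite expR0.
  by move=> i y1 y2 Pi ->; rewrite expRD /powR gt_eqF ?y0.
apply: (@le_trans _ _ (\sum_(i <- s | P i) c i * (expR m * (1 + (ln (y i) - m))))%R).
  under eq_bigr do rewrite mulrCA.
  rewrite -mulr_sumr ler_peMr ?expR_ge0//.
  under eq_bigr do rewrite mulrDr mulr1 mulrBr.
  by rewrite big_split/= sumrB c1 -mulr_suml c1 mul1r subrr addr0.
apply: ler_sum => i Pi; rewrite ler_wpM2l ?c0//.
apply: (@le_trans _ _ (expR m * expR (ln (y i) - m))%R).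
  by rewrite ler_wpM2l ?expR_ge0// expR_ge1Dx.
by rewrite -expRD addrC subrK lnK// posrE y0.
Qed.

Lemma interval_long_chord (A : set R) (rho : R) : is_interval A ->
  (0 <= rho)%R -> rho%:E < leb A ->
  exists a b, [/\ A a, A b, (a <= b)%R & (rho <= b - a)%R].
Proof.
move=> iA rho0 rhoA; apply: contrapT => nab.
have short a b : A a -> A b -> (b - a < rho)%R.
  move=> Aa Ab; rewrite ltNge; apply/negP => ba; apply: nab; exists a, b; split => //.
  by rewrite -subr_ge0 (le_trans rho0).
have [x Ax] : A !=set0.
  apply/set0P; apply: contraTneq rhoA => ->.
  by rewrite measure0 -leNgt lee_fin.
have ubA : has_ubound A.
  by exists (x + rho)%R => y Ay; rewrite -lerBlDl ltW ?short.
have lbA : has_lbound A.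
  by exists (x - rho)%R => y Ay; rewrite lerBlDl -lerBlDr ltW ?short.
have : leb A <= leb `[inf A, sup A].
  apply: le_measure; rewrite ?inE.
  - exact: is_interval_measurable.
  - exact: measurable_itv.
  - by move=> y Ay; rewrite /= in_itv/= ge_inf// sup_upper_bound//; split=> //; exists x.
apply/negP; rewrite -ltNge; apply: le_lt_trans rhoA.
rewrite lebesgue_measure_itv/= lte_fin; case: ifP => // _.
rewrite -EFinB lee_fin lerBlDr; apply: sup_le_ub; first by exists x.
move=> y Ay; rewrite addrC -lerBlDr; apply: lb_le_inf; first by exists x.
by move=> z Az; rewrite lerBlDr -lerBlDl ltW ?short.
Qed.

(** One-dimensional Brunn-Minkowski inequality.  For intervals it suffices to keep
    one long chord in each summand: the weighted sum of the chords is a segment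
    contained in [C]. *)
Lemma interval_sum_measure (I : finType) (P : pred I) (c : I -> R)
    (A : I -> set R) (C : set R) :
  (forall i, P i -> 0 < c i)%R ->
  (forall i, P i -> is_interval (A i)) -> (forall i, P i -> A i !=set0) ->
  measurable C ->
  (forall x : I -> R, (forall i, P i -> A i (x i)) -> C (\sum_(i | P i) c i * x i)%R) ->
  \sum_(i | P i) (c i)%:E * leb (A i) <= leb C.
Proof.
move=> c0 iA A0 mC AC.
have leb0 i : P i -> 0 <= leb (A i) by move=> Pi; exact: measure_ge0.
suff key (rho : I -> R) : (forall i, P i -> (0 <= rho i)%R) ->
    (forall i, P i -> (rho i = 0)%R \/ (rho i)%:E < leb (A i)) ->
    (\sum_(i | P i) c i * rho i)%:E <= leb C.
  (* Long chords of one infinite interval already make [C] infinite. *)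
  have [[j [Pj Ajy]]|fin] := pselect (exists j, P j /\ leb (A j) = +oo).
    suff -> : leb C = +oo by rewrite leey.
    apply/eqyP => r r0; pose rho i := if i == j then (r / c j)%R else 0%R.
    apply: le_trans (key rho _ _).
    - rewrite lee_fin (bigD1 j)//= /rho eqxx mulrC divfK ?gt_eqF ?c0// lerDl.
      by apply: sumr_ge0 => i /andP[_ /negbTE ->]; rewrite mulr0.
    - by move=> i Pi; rewrite /rho; case: eqP => // _; rewrite divr_ge0 ?ltW// c0.
    - by move=> i Pi; rewrite /rho; case: eqP => [->|_]; [right; rewrite Ajy ltry|left].
  have finA i : P i -> leb (A i) \is a fin_num.
    move=> Pi; rewrite ge0_fin_numE ?leb0// ltey; apply/eqP => Aiy.
    by apply: fin; exists i.
  pose l i := fine (leb (A i)).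
  have lE i : P i -> leb (A i) = (l i)%:E by move=> Pi; rewrite fineK ?finA.
  have l0 i : P i -> (0 <= l i)%R by move=> Pi; rewrite fine_ge0 ?leb0.
  under eq_bigr => i Pi do rewrite lE// -EFinM.
  rewrite sumEFin; have [->|Cy] := eqVneq (leb C) +oo; first by rewrite leey.
  have s0 : (0 <= \sum_(i | P i) c i)%R by apply: sumr_ge0 => i Pi; rewrite ltW ?c0.
  apply/lee_addgt0Pr => e e0.
  pose d := (e / (1 + \sum_(i | P i) c i))%R.
  have d0 : (0 < d)%R by rewrite divr_gt0// ltr_pwDl.
  apply: (@le_trans _ _ ((\sum_(i | P i) c i * Num.max 0 (l i - d))%:E + e%:E)).
    rewrite -EFinD lee_fin.
    apply: (@le_trans _ _ (\sum_(i | P i) c i * (l i - d) + e)%R); last first.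
      rewrite lerD2r; apply: ler_sum => i Pi; rewrite ler_wpM2l ?(ltW (c0 _ Pi))//.
      by rewrite le_max lexx orbT.
    under [in leRHS]eq_bigr do rewrite mulrBr.
    rewrite sumrB -addrA lerDl -mulr_suml addrC subr_ge0 /d mulrA ler_pdivrMr ?ltr_pwDl//.
    by rewrite mulrC ler_wpM2l ?ltW// ltrDr.
  rewrite leeD2r//; apply: key => [i Pi|i Pi]; first by rewrite le_max lexx.
  rewrite lE//; have [ld|ld] := leP (l i - d)%R 0%R; first by left.
  by right; rewrite lte_fin gtrBl.
move=> rho0 rhoA.
have /choice[ab abP] : forall i, exists ab : R * R, P i ->
    [/\ A i ab.1, A i ab.2, (ab.1 <= ab.2)%R & (rho i <= ab.2 - ab.1)%R].
  move=> i; have [Pi|] := boolP (P i); last by exists (0%R, 0%R).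
  have [r0|rlt] := rhoA _ Pi.
    have [x Ax] := A0 _ Pi; exists (x, x) => _; split => //=.
    by rewrite subrr r0.
  by have [a [b ?]] := interval_long_chord (iA _ Pi) (rho0 _ Pi) rlt; exists (a, b).
pose al := (\sum_(i | P i) c i * (ab i).1)%R.
pose be := (\sum_(i | P i) c i * (ab i).2)%R.
have albe : (al <= be)%R.
  by apply: ler_sum => i Pi; rewrite ler_wpM2l ?(ltW (c0 _ Pi))//; have [] := abP _ Pi.
(* A point of the segment is the weighted sum of the points at the same relative
   position [th] on each chord; [th] is arbitrary when the segment is a point. *)
have sub : `[al, be] `<=` C.
  move=> y; rewrite /= in_itv/= => /andP[aly ybe].
  pose th := (if be == al then 0 else (y - al) / (be - al))%R.
  have th01 : (0 <= th <= 1)%R.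
    rewrite /th; case: eqVneq => [_|ne]; first by rewrite lexx ler01.
    have lt : (0 < be - al)%R by rewrite subr_gt0 lt_neqAle eq_sym ne.
    rewrite ler_pdivrMr// mul1r lerD2r ybe andbT.
    by apply: divr_ge0; [rewrite subr_ge0|exact: ltW].
  have -> : y = (\sum_(i | P i) c i * ((ab i).1 + th * ((ab i).2 - (ab i).1)))%R.
    under eq_bigr do rewrite mulrDr mulrCA mulrBr.
    rewrite big_split/= -mulr_sumr sumrB -/al -/be /th; case: eqVneq => [e|ne].
      by rewrite mul0r addr0; apply/eqP; rewrite eq_le aly andbT -e.
    by rewrite divfK ?subr_eq0// addrC subrK.
  apply: AC => i Pi; have [Aa Ab ab_le _] := abP _ Pi.
  apply: (iA _ Pi _ _ Aa Ab); move/andP: th01 => [t0 t1].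
  have d0 : (0 <= (ab i).2 - (ab i).1)%R by rewrite subr_ge0.
  rewrite lerDl mulr_ge0//= -lerBrDl -[leRHS]mul1r ler_wpM2r//.
apply: (@le_trans _ _ (leb `[al, be])); last by rewrite le_measure ?inE//; exact: measurable_itv.
rewrite lebesgue_measure_itv/= lte_fin.
have le1 : (\sum_(i | P i) c i * rho i <= be - al)%R.
  rewrite -sumrB; apply: ler_sum => i Pi; rewrite -mulrBr ler_wpM2l ?(ltW (c0 _ Pi))//.
  by have [] := abP _ Pi.
case: ifPn => [_|]; first by rewrite -EFinB lee_fin.
by rewrite -leNgt => beal; rewrite lee_fin (le_trans le1)// subr_le0.
Qed.


(** Tonelli's theorem for the region under a graph, the source of the layer-cake
    formula. *)
Lemma layer_swap (A : set (R * R)) : measurable A ->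
  \int[leb]_x leb [set t | A (x, t)] = \int[leb]_t leb [set x | A (x, t)].
Proof.
move=> mA.
have := @indic_fubini_tonelli _ _ _ _ R leb leb A mA.
rewrite indic_fubini_tonelli_FE// indic_fubini_tonelli_GE//.
have xE x : xsection A x = [set t | A (x, t)].
  by apply/seteqP; split => t; rewrite /xsection/= inE.
have yE y : ysection A y = [set t | A (t, y)].
  by apply/seteqP; split => t; rewrite /ysection/= inE.
under [in X in X = _ -> _]eq_integral do rewrite /= xE.
by under [in X in _ = X -> _]eq_integral do rewrite /= yE.
Qed.

Let mfst (F : R -> \bar R) : measurable_fun [set: R] F ->
  measurable_fun [set: R * R] (fun z => F z.1).
Proof. by move=> mF; exact: (measurableT_comp mF measurable_fst). Qed.

Let msnd : measurable_fun [set: R * R] (fun z => z.2%:E).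
Proof. by apply/measurable_EFinP; exact: measurable_snd. Qed.

Let strip : set (R * R) := [set z | 0 < z.2 < 1]%R.

Let mstrip : measurable strip.
Proof.
rewrite (_ : strip = setT `*` `]0%R, 1%R[%classic); first exact: measurableX.
by apply/seteqP; split => z; rewrite /strip/= in_itv/=; tauto.
Qed.

(** Superlevel sets of log-concave functions on the line are intervals, which makes
    measurability and the Brunn-Minkowski inequality immediate. *)
Definition unimodal (F : R -> \bar R) :=
  forall t : R, is_interval [set x | t%:E < F x].

Lemma unimodal_measurable F : unimodal F -> measurable_fun [set: R] F.
Proof.
move=> uF; apply: (measurability _ (ErealGenOInfty.measurableE R)) => //.
move=> _ [_ [t ->] <-]; rewrite setTI; apply: is_interval_measurable => x y.
by rewrite /= !in_itv/= !andbT => Fx Fy z xzy; have := uF t x y Fx Fy z xzy; rewrite /= in_itv/= andbT.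
Qed.

(** When all suprema are [1], the superlevel sets of the [F i] at height [t < 1] are
    nonempty, so the Brunn-Minkowski inequality applies at each height; integrating
    over the heights gives an additive inequality, which is stronger than the
    multiplicative one. *)
Lemma prekopa_leindler_normalized (I : finType) (P : pred I) (c : I -> R)
    (F : I -> R -> \bar R) (H : R -> \bar R) :
  (forall i, P i -> 0 < c i)%R ->
  (forall i, P i -> unimodal (F i)) ->
  (forall i x, P i -> 0 <= F i x <= 1) ->
  (forall i (t : R), P i -> (t < 1)%R -> exists x, t%:E < F i x) ->
  measurable_fun [set: R] H -> (forall x, 0 <= H x) ->
  (forall (t : R) (x : I -> R), (0 < t < 1)%R -> (forall i, P i -> t%:E < F i (x i)) ->
     t%:E <= H (\sum_(i | P i) c i * x i)%R) ->
  \sum_(i | P i) (c i)%:E * \int[leb]_x F i x <= \int[leb]_x H x.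
Proof.
move=> c0 uF F01 supF mH H0 FH.
have mF i : P i -> measurable_fun [set: R] (F i) by move=> /uF; exact: unimodal_measurable.
pose A i := strip `&` [set z | z.2%:E < F i z.1].
pose B := strip `&` [set z | z.2%:E <= H z.1].
have mA i : P i -> measurable (A i).
  move=> Pi; apply: measurableI => //; rewrite -[X in measurable X]setTI.
  by apply: measurable_lte => //; apply: mfst; exact: mF.
have mB : measurable B.
  apply: measurableI => //; rewrite -[X in measurable X]setTI.
  by apply: measurable_lee => //; exact: mfst.
have sect d1 d2 (T1 : measurableType d1) (T2 : measurableType d2) (X : set (T1 * T2)) y :
    measurable X -> measurable [set x | X (x, y)].
  move=> mX; rewrite (_ : [set x | _] = ysection X y); first exact: measurable_ysection.
  by apply/seteqP; split => t; rewrite /ysection/= inE.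
have sect1 d1 d2 (T1 : measurableType d1) (T2 : measurableType d2) (X : set (T1 * T2)) x :
    measurable X -> measurable [set y | X (x, y)].
  move=> mX; rewrite (_ : [set y | _] = xsection X x); first exact: measurable_xsection.
  by apply/seteqP; split => t; rewrite /xsection/= inE.
have mlev X : measurable X -> measurable_fun [set: R] (fun t : R => leb [set x | X (x, t)]).
  move=> mX; have := measurable_fun_ysection leb mX.
  congr (measurable_fun _ _); apply/funext => t /=; congr (leb _).
  by apply/seteqP; split => z; rewrite /ysection/= inE.
apply: (@le_trans _ _ (\int[leb]_x leb [set t | B (x, t)])); last first.
  apply: ge0_le_integral => //.
  - have := measurable_fun_xsection leb mB.
    congr (measurable_fun _ _); apply/funext => x /=; congr (leb _).
    by apply/seteqP; split => z; rewrite /xsection/= inE.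
  - move=> x _; have [->|Hy] := eqVneq (H x) +oo; first by rewrite leey.
    have Hf : H x \is a fin_num by rewrite ge0_fin_numE ?ltey.
    apply: (@le_trans _ _ (leb `]0%R, fine (H x)])).
      apply: le_measure; rewrite ?inE//; first exact: sect1.
      move=> t [/= /andP[t0 _]]; rewrite in_itv/= t0 /=.
      by rewrite -lee_fin fineK.
    rewrite lebesgue_measure_itv/= lte_fin; case: ifP => // _.
    by rewrite sube0 fineK.
rewrite layer_swap//.
have -> : \sum_(i | P i) (c i)%:E * (\int[leb]_x F i x) =
          \sum_(i | P i) (c i)%:E * (\int[leb]_t leb [set x | A i (x, t)]).
  apply: eq_bigr => i Pi; congr (_ * _); rewrite -layer_swap; last exact: mA.
  apply: eq_integral => x _; have /andP[F0 F1] := F01 i x Pi.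
  have Ff : F i x \is a fin_num.
    by rewrite ge0_fin_numE// (le_lt_trans F1) ?ltry.
  rewrite (_ : [set t | _] = `]0%R, fine (F i x)[%classic).
    rewrite lebesgue_measure_itv/= lte_fin; case: ifPn => [_|].
      by rewrite sube0 fineK.
    by rewrite -leNgt => Fle; apply/eqP; rewrite eq_le F0 -(fineK Ff) lee_fin Fle.
  apply/seteqP; split => t; rewrite /A /strip /= in_itv/= -(lte_fin t (fine _)) fineK//.
    by move=> [/andP[-> _] ->].
  move=> /andP[t0 tF]; rewrite t0 tF; split=> //=.
  by rewrite -lte_fin (lt_le_trans tF).
pose G i t := if P i then (c i)%:E * leb [set x | A i (x, t)] else 0.
have G0 i t : 0 <= G i t.
  by rewrite /G; case: ifPn => // Pi; rewrite mule_ge0 ?measure_ge0// lee_fin ltW ?c0.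
have mG i : measurable_fun [set: R] (G i).
  have [Pi|nPi] := boolP (P i); last first.
    by rewrite (_ : G i = cst 0)//; apply/funext => t; rewrite /G (negbTE nPi).
  rewrite (_ : G i = fun t => (c i)%:E * leb [set x | A i (x, t)]); last first.
    by apply/funext => t; rewrite /G Pi.
  apply: measurable_funeM.
  by apply: mlev; exact: mA.
have -> : \sum_(i | P i) (c i)%:E * (\int[leb]_t leb [set x | A i (x, t)]) =
          \int[leb]_t \sum_i G i t.
  rewrite ge0_integral_sum// big_mkcond/=; apply: eq_bigr => i _; rewrite /G.
  have [Pi|nPi] := boolP (P i); last by rewrite integral0.
  rewrite ge0_integralZl//; first by apply: mlev; exact: mA.
  by rewrite lee_fin ltW ?c0.
apply: ge0_le_integral => //.
- by move=> t _; apply: sume_ge0.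
- exact: emeasurable_sum.
- exact: mlev.
move=> t _; rewrite /G -big_mkcond/=.
have [/andP[t0 t1]|tn] := boolP (0 < t < 1)%R; last first.
  rewrite big1 ?measure_ge0// => i Pi.
  rewrite (_ : [set x | _] = set0) ?measure0 ?mule0//.
  by apply/seteqP; split=> x //= [] /=; rewrite /strip/= (negbTE tn).
have AE i : [set x | A i (x, t)] = [set x | t%:E < F i x].
  by apply/seteqP; split => x; rewrite /A /strip/= t0 t1/=; [case|split].
under eq_bigr do rewrite AE.
apply: interval_sum_measure => //.
- by move=> i Pi; exact: uF.
- by move=> i Pi; have [x ?] := supF i t Pi t1; exists x.
- exact: sect.
move=> x xA; rewrite /B /strip/= t0 t1; split => //.
by apply: FH; rewrite ?t0.
Qed.

End prekopa_leindler_line.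

Section prekopa_leindler_line_general.
Context (R : realType).
Local Open Scope ereal_scope.
Notation leb := (@lebesgue_measure R).

(** Monotone convergence; it reduces the Prekopa-Leindler inequality to bounded
    functions, whose suprema can be normalized. *)
Lemma lt_integral_truncation (F : R -> \bar R) (a : R) :
  measurable_fun [set: R] F -> (forall x, 0 <= F x) ->
  a%:E < \int[leb]_x F x ->
  exists2 M : R, (0 < M)%R & a%:E < \int[leb]_x mine (F x) M%:E.
Proof.
move=> mF F0 aF.
pose g k x := mine (F x) (k%:R)%:E.
have mg k : measurable_fun [set: R] (g k) by exact: measurable_mine.
have g0 k x : 0 <= g k x by rewrite le_min F0 lee_fin/=.
have ndg x : {homo g^~ x : k l / (k <= l)%N >-> k <= l}.
  by move=> k l kl; rewrite /g le_min2// lee_fin ler_nat.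
have glim x : limn (g^~ x) = F x.
  apply/cvg_lim => //; have [Fy|Fy] := eqVneq (F x) +oo.
    rewrite (_ : g^~ x = fun k => (k%:R)%:E); first by rewrite Fy; exact/cvgeryP/cvgr_idn.
    by apply/funext => k; rewrite /g Fy minye.
  have Ff : F x \is a fin_num by rewrite ge0_fin_numE ?ltey.
  apply: cvg_near_cst; near=> k.
  rewrite /g min_l// -(fineK Ff) lee_fin ltW//.
  near: k; exact: nbhs_infty_gtr.
have cg : (fun k => \int[leb]_x g k x) @ \oo --> \int[leb]_x F x.
  under [X in _ --> X]eq_integral do rewrite -glim.
  by apply: cvg_monotone_convergence.
have [//|nM] := pselect (exists2 M : R, (0 < M)%R & a%:E < \int[leb]_x mine (F x) M%:E).
exfalso; move: aF; apply/negP; rewrite -leNgt.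
rewrite -(cvg_lim _ cg)//; apply: lime_le; first by apply/cvg_ex; eexists; exact: cg.
apply: nearW => k; rewrite leNgt; apply/negP => akg; apply: nM.
exists (k.+1%:R) => //; apply: lt_le_trans akg _.
apply: ge0_le_integral => //.
- exact: measurable_mine.
- exact: measurable_mine.
- by move=> x _; exact: (ndg x k k.+1).
Unshelve. all: by end_near. Qed.

Lemma unimodal_min (F : R -> \bar R) (M : R) : unimodal F ->
  unimodal (fun x => mine (F x) M%:E).
Proof.
move=> uF t x y /=; rewrite !lt_min => /andP[Fx tM] /andP[Fy _] z xzy.
by rewrite /= lt_min tM andbT; exact: (uF t x y Fx Fy z xzy).
Qed.

Lemma unimodal_scale (F : R -> \bar R) (k : R) : (0 < k)%R -> unimodal F ->
  unimodal (fun x => k%:E * F x).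
Proof.
move=> k0 uF t x y /= Fx Fy z xzy.
have e u : (t%:E < k%:E * F u) = ((t / k)%:E < F u).
  by rewrite muleC EFinM lte_pdivrMr.
by move: Fx Fy; rewrite !e => Fx Fy; exact: (uF (t / k)%R x y Fx Fy z xzy).
Qed.

(** After truncation and division by the suprema this is
    [prekopa_leindler_normalized] followed by the weighted AM-GM inequality.
    Strict lower bounds [a i] of the integrals stand in for the integrals, which
    may be infinite. *)
Lemma prekopa_leindler_line (I : finType) (P : pred I) (c : I -> R)
    (F : I -> R -> \bar R) (H : R -> \bar R) (D : R) (a : I -> R) :
  (forall i, P i -> 0 < c i)%R -> (\sum_(i | P i) c i = 1)%R -> (0 < D)%R ->
  (forall i, P i -> unimodal (F i)) -> (forall i x, P i -> 0 <= F i x) ->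
  measurable_fun [set: R] H -> (forall x, 0 <= H x) ->
  (forall b x : I -> R, (forall i, P i -> (0 < b i)%R /\ (b i)%:E < F i (x i)) ->
     (D * \prod_(i | P i) b i `^ c i)%:E <= H (\sum_(i | P i) c i * x i)%R) ->
  (forall i, P i -> (0 < a i)%R /\ (a i)%:E < \int[leb]_x F i x) ->
  (D * \prod_(i | P i) a i `^ c i)%:E <= \int[leb]_x H x.
Proof.
move=> c0 c1 D0 uF F0 mH H0 FH aF.
have /choice[M MP] : forall i, exists M : R, P i ->
    (0 < M)%R /\ (a i)%:E < \int[leb]_x mine (F i x) M%:E.
  move=> i; have [Pi|] := boolP (P i); last by exists 0%R.
  have [M M0 aM] := lt_integral_truncation (unimodal_measurable (uF _ Pi))
     (fun x => F0 i x Pi) (aF _ Pi).2.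
  by exists M.
pose G i x := mine (F i x) (M i)%:E.
have G0 i x : P i -> 0 <= G i x.
  by move=> Pi; rewrite /G le_min F0//= lee_fin ltW// (MP _ Pi).1.
pose S i := ereal_sup (range (G i)).
have GS i x : G i x <= S i by apply: ereal_sup_ubound; exists x.
have SM i : S i <= (M i)%:E.
  by apply: ge_ereal_sup => _ [x _ <-]; rewrite ge_min lexx orbT.
have S0 i : P i -> 0 < S i.
  move=> Pi; rewrite lt_neqAle (le_trans (G0 i 0%R Pi) (GS i 0%R)) andbT eq_sym.
  apply/eqP => Si0; have := (MP _ Pi).2; apply/negP; rewrite -leNgt.
  rewrite integral0_eq ?lee_fin ?ltW ?(aF _ Pi).1// => x _.
  by apply/eqP; rewrite eq_le (G0 i x Pi) andbT -Si0 GS.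
pose s i := fine (S i).
have sE i : P i -> S i = (s i)%:E.
  move=> Pi; rewrite fineK// ge0_fin_numE ?(le_lt_trans (SM i)) ?ltry//.
  exact/ltW/S0.
have s0 i : P i -> (0 < s i)%R by move=> Pi; rewrite -lte_fin -sE// S0.
pose sg := (\prod_(i | P i) s i `^ c i)%R.
have sg0 : (0 < sg)%R.
  by apply: prodr_gt0 => i Pi; rewrite powR_gt0// s0.
have Dsg0 : (0 < D * sg)%R by rewrite mulr_gt0.
have uG i : P i -> unimodal (G i) by move=> Pi; exact/unimodal_min/uF.
have : \sum_(i | P i) (c i)%:E * \int[leb]_x ((s i)^-1%:E * G i x) <=
       \int[leb]_x ((D * sg)^-1%:E * H x).
  apply: (@prekopa_leindler_normalized _ I P c (fun i x => (s i)^-1%:E * G i x)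
    (fun x => (D * sg)^-1%:E * H x) c0).
  - by move=> i Pi; apply: unimodal_scale; rewrite ?invr_gt0 ?s0//; exact: uG.
  - move=> i x Pi; rewrite mule_ge0 ?lee_fin ?invr_ge0 ?(ltW (s0 _ Pi))// ?G0//=.
    by rewrite muleC lee_pdivrMr ?s0// mul1e -sE.
  - move=> i t Pi t1; have : (t * s i)%:E < S i.
      by rewrite sE// lte_fin gtr_pMl// s0.
    move=> /ereal_sup_gt[_ [x _ <-]] tG; exists x.
    by rewrite muleC lte_pdivlMr ?s0.
  - exact: measurable_funeM.
  - by move=> x; rewrite mule_ge0// lee_fin invr_ge0 ltW.
  - move=> t x /andP[t0 t1] tG.
    rewrite muleC lee_pdivlMr//.
    apply: le_trans (FH (fun i => t * s i)%R x _).
      rewrite lee_fin prod_powRM; [|by move=> *; exact: ltW|by move=> i /s0/ltW].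
      by rewrite prod_powR_cst// [leRHS]mulrCA.
    move=> i Pi; split; first by rewrite mulr_gt0// s0.
    have := tG i Pi; rewrite muleC lte_pdivlMr ?s0// => /lt_le_trans; apply.
    by rewrite ge_min lexx.
rewrite ge0_integralZl//; last by rewrite lee_fin invr_ge0 ltW.
rewrite [leRHS]muleC lee_pdivlMr// => le.
apply: le_trans le.
have aG i : P i -> (a i / s i)%:E <= \int[leb]_x ((s i)^-1%:E * G i x).
  move=> Pi; rewrite ge0_integralZl//.
  - by rewrite mulrC EFinM lee_pmul2l// ?lte_fin ?invr_gt0 ?s0// ltW// (MP _ Pi).2.
  - by apply: unimodal_measurable; exact: uG.
  - by move=> x _; exact: G0.
  - by rewrite lee_fin invr_ge0 ltW// s0.
apply: (@le_trans _ _ ((\sum_(i | P i) c i * (a i / s i))%:E * (D * sg)%:E)).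
  rewrite -EFinM lee_fin.
  have -> : (\prod_(i | P i) a i `^ c i = sg * \prod_(i | P i) (a i / s i) `^ c i)%R.
    rewrite -prod_powRM.
    - by apply: eq_bigr => i Pi; rewrite mulrC divfK// gt_eqF// s0.
    - by move=> i /s0/ltW.
    - by move=> i Pi; rewrite divr_ge0// ltW ?s0// (aF _ Pi).1.
  rewrite mulrA mulrC ler_wpM2r ?(ltW Dsg0)//; apply: amgm_weighted => // i Pi.
    exact/ltW/c0.
  by rewrite divr_gt0 ?s0// (aF _ Pi).1.
rewrite lee_pmul2r// -sumEFin; apply: lee_sum => i Pi.
by rewrite EFinM lee_pmul2l ?lte_fin ?c0// aG.
Qed.

End prekopa_leindler_line_general.

(** * Log-concave functions and coordinate subspaces *)

Section prekopa_leindler_tensor.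
Context (R : realType) (n : nat).
Local Open Scope ereal_scope.
Notation leb := (@lebesgue_measure R).
Notation V := 'rV[R]_n.
Implicit Types (g h : V -> \bar R) (vs : seq V) (a v : V).

(** [h (sum_i c_i x_i) >= prod_i hs_i(x_i) ^ c_i], where extended real values are
    replaced by the positive reals below them so that only powers of reals occur. *)
Definition dominates_products (I : finType) (c : I -> R) (h : V -> \bar R) (hs : I -> V -> \bar R) :=
  forall (b : I -> R) (x : I -> V),
    (forall i, (0 < b i)%R /\ (b i)%:E < hs i (x i)) ->
    (\prod_i b i `^ c i)%:E <= h (\sum_i c i *: x i)%R.

(** The two-function case of [dominates_products], with weights [l] and [1 - l]. *)
Definition log_concave g := forall l : R, (0 < l < 1)%R ->
  @dominates_products bool (fun e => if e then l else 1 - l)%R g (fun=> g).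

Lemma log_concave_unimodal g a v : (forall x, 0 <= g x) -> log_concave g ->
  unimodal (fun x : R => g (a + x *: v)%R).
Proof.
move=> g0 gl t x y /= tx ty z /andP[xz zy].
have [t0|t0] := ltP t 0%R; first by rewrite (lt_le_trans _ (g0 _)) ?lte_fin.
have [<-//|xz'] := eqVneq x z; have [->//|zy'] := eqVneq z y.
have {xz xz'} xz : (x < z)%R by rewrite lt_neqAle xz' xz.
have {zy zy'} zy : (z < y)%R by rewrite lt_neqAle zy' zy.
have xy : (0 < y - x)%R by rewrite subr_gt0 (lt_trans xz).
have [b tb bxy] : exists2 b : R, (t < b)%R & b%:E < mine (g (a + x *: v)%R) (g (a + y *: v)%R).
  have : t%:E < mine (g (a + x *: v)%R) (g (a + y *: v)%R) by rewrite lt_min tx.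
  case: (mine _ _) => [r| |]; rewrite ?lte_fin; last by [].
    by move=> tr; exists ((t + r) / 2)%R; rewrite ?lte_fin ?midf_lt.
  by move=> _; exists (t + 1)%R; rewrite ?ltry// ltrDl.
pose l := ((z - x) / (y - x))%R.
have l01 : (0 < l < 1)%R.
  apply/andP; split; first by rewrite divr_gt0// subr_gt0.
  by rewrite /l ltr_pdivrMr// mul1r ltrD2r.
have := gl _ l01 (fun=> b) (fun e => if e then (a + y *: v)%R else (a + x *: v)%R).
rewrite !big_bool/= -powRD; last first.
  by rewrite (gt_eqF (le_lt_trans t0 tb)) implybT.
rewrite [(l + _)%R]addrC subrK powRr1; last exact/ltW/(le_lt_trans t0).
have -> : (l *: (a + y *: v) + (1 - l) *: (a + x *: v) = a + z *: v)%R.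
  rewrite !scalerDr !scalerA addrACA -!scalerDl addrCA subrr addr0 scale1r.
  congr (_ + _ *: _)%R; rewrite /l; field; exact: lt0r_neq0.
move=> H; apply: lt_le_trans (H _); first by rewrite lte_fin.
move: bxy; rewrite lt_min => /andP[bx by_].
by case; rewrite (le_lt_trans t0 tb).
Qed.

(** Integrating out the direction [v] in the functions selected by [P], and in [h],
    preserves domination: for frozen base points this is [prekopa_leindler_line]
    along [v], the other functions contributing a constant factor. *)
Lemma dominates_products_line (I : finType) (c : I -> R) (P : pred I) h (hs : I -> V -> \bar R) v :
  (forall i, 0 < c i)%R -> (\sum_(i | P i) c i = 1)%R ->
  (forall x, 0 <= h x) -> (forall i x, 0 <= hs i x) ->
  log_concave h -> (forall i, log_concave (hs i)) ->
  dominates_products c h hs ->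
  dominates_products c (iint [:: v] h) (fun i => if P i then iint [:: v] (hs i) else hs i).
Proof.
move=> c0 c1 h0 hs0 hl hsl hh b x bx.
have b0 i : (0 < b i)%R by case: (bx i).
rewrite (bigID P)/= mulrC.
apply: (@prekopa_leindler_line _ I P c (fun i y => hs i (x i + y *: v)%R)) => //.
- by apply: prodr_gt0 => i _; rewrite powR_gt0.
- by move=> i _; exact: log_concave_unimodal.
- by apply: unimodal_measurable; exact: log_concave_unimodal.
- move=> b' y b'y.
  pose b2 i := if P i then b' i else b i.
  pose x2 i := if P i then (x i + y i *: v)%R else x i.
  have := hh b2 x2.
  rewrite (bigID P)/= mulrC.
  under eq_bigr => i /negbTE nPi do rewrite /b2 nPi.
  under [X in (_ * X)%R]eq_bigr => i Pi do rewrite /b2 Pi.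
  have -> : (\sum_i c i *: x2 i = \sum_i c i *: x i + (\sum_(i | P i) c i * y i) *: v)%R.
    rewrite scaler_suml [in X in (_ + X)%R]big_mkcond/= -big_split/=; apply: eq_bigr => i _.
    by rewrite /x2; case: (P i); rewrite ?addr0// scalerDr scalerA.
  apply=> i; rewrite /b2 /x2; have := bx i; case: ifPn => // Pi _; exact: b'y.
- by move=> i Pi; have := bx i; rewrite Pi.
Qed.

(** Prekopa's theorem: marginals of log-concave functions are log-concave. *)
Lemma log_concave_line g v : (forall x, 0 <= g x) -> log_concave g ->
  log_concave (iint [:: v] g).
Proof.
move=> g0 gl l l01.
apply: (@dominates_products_line bool _ predT g (fun=> g) v) => //.
- by case; case/andP: l01 => // l0 l1; rewrite subr_gt0.
- by rewrite big_bool/= addrC subrK.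
- exact: gl.
Qed.

Lemma log_concave_iint vs g : (forall x, 0 <= g x) -> log_concave g ->
  log_concave (iint vs g).
Proof.
move=> g0 gl; elim: vs => // v vs IH.
by apply: (@log_concave_line (iint vs g)) => // x; exact: iint_ge0.
Qed.

(** Barthe's reverse Brascamp-Lieb inequality for coordinate subspaces.  Since every
    index is covered with total weight [1], the coordinates can be integrated out
    one after the other by [dominates_products_line]. *)
Lemma dominates_products_iint (I : finType) (J : eqType) (c : I -> R) (w : J -> V) (C : I -> pred J)
    (s : seq J) h (hs : I -> V -> \bar R) :
  (forall i, 0 < c i)%R ->
  (forall j, j \in s -> \sum_(i | C i j) c i = 1)%R ->
  (forall x, 0 <= h x) -> (forall i x, 0 <= hs i x) ->
  log_concave h -> (forall i, log_concave (hs i)) ->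
  dominates_products c h hs ->
  dominates_products c (iint [seq w j | j <- s] h) (fun i => iint [seq w j | j <- s & C i j] (hs i)).
Proof.
move=> c0 c1 h0 hs0 hl hsl hh; elim: s c1 => // j s IH c1.
have {}IH : dominates_products c (iint [seq w j | j <- s] h)
    (fun i => iint [seq w j | j <- s & C i j] (hs i)).
  by apply: IH => k ks; apply: c1; rewrite inE ks orbT.
have := @dominates_products_line I c (fun i => C i j) _ _ (w j) c0 (c1 j (mem_head _ _)) _ _ _ _ IH.
have -> : (fun i => if C i j then iint [:: w j] (iint [seq w j | j <- s & C i j] (hs i))
   else iint [seq w j | j <- s & C i j] (hs i)) = (fun i => iint [seq w j0 | j0 <- j :: s & C i j0] (hs i)).
  by apply/funext => i /=; case: ifP.
apply.
- by move=> x; exact: iint_ge0.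
- by move=> i x; exact: iint_ge0.
- exact: log_concave_iint.
- by move=> i; exact: log_concave_iint.
Qed.

End prekopa_leindler_tensor.

(** * Chebyshev's and Berwald's inequalities for the exponential law *)

Section exponential_moments.
Context (R : realType).

(** [exp (- a) * exp_moment k a] is the incomplete Gamma integral of
    [exp (- s) * s ^ k] over [s >= a]. *)
Fixpoint exp_moment (k : nat) (s : R) : R :=
  if k is k'.+1 then s ^+ k + k%:R * exp_moment k' s else 1.

Lemma exp_moment0 k : exp_moment k 0 = k`!%:R.
Proof. by elim: k => //= k ->; rewrite expr0n add0r -natrM factS. Qed.

Lemma is_derive_exp_moment k (s : R) :
  is_derive s 1 (exp_moment k) (exp_moment k s - s ^+ k).
Proof.
elim: k => [|k IH]; first by rewrite /= subrr; exact: is_derive_cst.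
rewrite /=.
have -> : s ^+ k.+1 + k.+1%:R * exp_moment k s - s ^+ k.+1 =
  (k.+1%:R * s ^+ k) *: 1 + k.+1%:R *: (exp_moment k s - s ^+ k).
  rewrite /GRing.scale/=; ring.
apply: is_deriveD.
  rewrite (_ : (fun x : R => x ^+ k.+1) = (id : R -> R) ^+ k.+1); last first.
    by apply/funext => x; rewrite exprfctE.
  exact: (is_deriveX k.+1 (is_derive_id s 1)).
Qed.

Lemma cvg_expRN_pow k : expR (- s) * s ^+ k @[s --> +oo] --> (0 : R).
Proof.
have c0 : (fun s : R => (k.+1)`!%:R * s^-1) s @[s --> +oo] --> (0 : R).
  rewrite -(mulr0 (k.+1)`!%:R); apply: cvgM; first exact: cvg_cst.
  by apply/gtr0_cvgV0; [exact: nbhs_pinfty_gt|exact: cvg_id].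
apply: (squeeze_cvgr _ (cvg_cst 0) c0).
near=> s; have s0 : 0 < s by near: s; exact: nbhs_pinfty_gt.
rewrite mulr_ge0 ?expR_ge0 ?exprn_ge0 ?(ltW s0)//= expRN.
rewrite ler_pdivlMr// -mulrA -exprSr ler_pdivrMl ?expR_gt0//.
have := expR_ge1Dxn k (ltW s0).
rewrite -(ler_pM2r (_ : 0 < k.+1`!%:R)) ?ltr0n ?fact_gt0//.
apply: le_trans; rewrite mulrDl divfK ?pnatr_eq0 -?lt0n ?fact_gt0//.
by rewrite lerDr mul1r.
Unshelve. all: by end_near. Qed.

Lemma cvg_exp_moment k : expR (- s) * exp_moment k s @[s --> +oo] --> (0 : R).
Proof.
elim: k => [|k IH] /=; first by under eq_fun do rewrite mulr1; exact: cvgr_expR.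
rewrite -[X in _ --> X](addr0 0) -[X in _ --> _ + X](mulr0 k.+1%:R).
under eq_fun do rewrite mulrDr mulrCA.
apply: cvgD; first exact: cvg_expRN_pow.
by apply: cvgM => //; exact: cvg_cst.
Qed.

Lemma is_derive_expRN (s : R) : is_derive s 1 (fun s => expR (- s)) (- expR (- s)).
Proof.
have := is_derive1_comp (is_derive_expR (- s)) (is_deriveN (is_derive_id s 1)).
by rewrite mulrN1.
Qed.

Lemma is_derive_exp_moment_weight k (s : R) :
  is_derive s 1 (fun s => - (expR (- s) * exp_moment k s)) (expR (- s) * s ^+ k).
Proof.
have := is_deriveN (is_deriveM (is_derive_expRN s) (is_derive_exp_moment k s)).
by rewrite /GRing.scale/=; congr is_derive; ring.
Qed.

Lemma integral_expRN_pow_itv k (a : R) : 0 <= a ->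
  (\int[lebesgue_measure]_(s in `[a, +oo[) (expR (- s) * s ^+ k)%:E =
   (expR (- a) * exp_moment k a)%:E)%E.
Proof.
move=> a0; set F := fun s => - (expR (- s) * exp_moment k s).
have dF s : derivable F s 1 by have [] := is_derive_exp_moment_weight k s.
have cF : continuous F by move=> s; exact/differentiable_continuous/derivable1_diffP.
rewrite (@ge0_continuous_FTC2y _ _ F a 0).
- by rewrite sub0e -EFinN opprK.
- by move=> s sa; rewrite mulr_ge0 ?expR_ge0// exprn_ge0// (le_trans a0).
- apply: continuous_subspaceT => s.
  apply: cvgM; last exact: exprn_continuous.
  apply: continuous_comp; last exact: continuous_expR.
  exact: opp_continuous.
- by rewrite -[X in _ --> X]oppr0; apply: cvgN; exact: cvg_exp_moment.
- by move=> s _; exact: dF.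
- exact/cvg_at_right_filter/cF.
- move=> s _; rewrite derive1E; by have [_ ->] := is_derive_exp_moment_weight k s.
Qed.

End exponential_moments.

Section exponential_weight.
Context (R : realType).
Local Open Scope ereal_scope.
Notation leb := (@lebesgue_measure R).

(** The density of the standard exponential law. *)
Definition expw (s : R) : R := if (0 < s)%R then expR (- s) else 0%R.

Lemma expw_ge0 s : (0 <= expw s)%R.
Proof. by rewrite /expw; case: ifP => // _; exact: expR_ge0. Qed.

Lemma expw_gt0 s : (0 < s)%R -> expw s = expR (- s).
Proof. by rewrite /expw => ->. Qed.

Lemma measurable_expw : measurable_fun [set: R] expw.
Proof.
apply: measurable_fun_ifT => //; first exact: measurable_fun_ltr.
by apply: measurableT_comp.
Qed.

Lemma integral_expw_pow_itv k (a : R) : (0 <= a)%R ->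
  \int[leb]_(s in `]a, +oo[) (expw s * s ^+ k)%:E = (expR (- a) * exp_moment k a)%:E.
Proof.
move=> a0; rewrite -integral_expRN_pow_itv// -integral_itv_obnd_cbnd.
  apply: eq_integral => s; rewrite inE/= in_itv/= andbT => sa.
  by rewrite expw_gt0// (le_lt_trans a0).
apply/measurable_EFinP; apply: measurable_funTS; apply: measurable_funM; last exact: measurable_funX.
exact: measurableT_comp.
Qed.

Lemma integral_expw_pow k : \int[leb]_s (expw s * s ^+ k)%:E = k`!%:R%:E.
Proof.
rewrite -exp_moment0 -[exp_moment k 0]mul1r -[X in (X * _)%R]expR0 -[X in expR X]oppr0.
rewrite -integral_expw_pow_itv// [RHS]integral_mkcond; apply: eq_integral => s _.
rewrite patchE; case: ifPn => //; rewrite notin_setE/= in_itv/= andbT => /negP/negbTE s0.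
by rewrite /expw s0 mul0r.
Qed.

Lemma integral_expw_itv (a : R) : (0 <= a)%R ->
  \int[leb]_(s in `]a, +oo[) (expw s)%:E = (expR (- a))%:E.
Proof.
move=> a0; rewrite -[in RHS](mulr1 (expR _)) -(integral_expw_pow_itv 0 a0).
by apply: eq_integral => s _; rewrite expr0 mulr1.
Qed.

(** Expectation for the standard exponential law. *)
Definition Eexp (F : R -> \bar R) := \int[leb]_s ((expw s)%:E * F s).

Let expwM_ge0 (F : R -> \bar R) s : (forall t, (0 < t)%R -> 0 <= F t) ->
  0 <= (expw s)%:E * F s.
Proof.
move=> F0; have [s0|s0] := ltP 0%R s; first by rewrite mule_ge0 ?F0// lee_fin expw_ge0.
by rewrite /expw ltNge s0/= mul0e.
Qed.

Lemma Eexp_ge0 F : (forall s, (0 < s)%R -> 0 <= F s) -> 0 <= Eexp F.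
Proof. by move=> F0; apply: integral_ge0 => s _; exact: expwM_ge0. Qed.

Lemma Eexp_cst (c : \bar R) : 0 <= c -> Eexp (cst c) = c.
Proof.
move=> c0; rewrite /Eexp ge0_integralZr//.
- under eq_integral => s _ do rewrite -[expw s]mulr1 -[X in (_ * X)%R](expr0 s).
  by rewrite integral_expw_pow mul1e.
- by apply/measurable_EFinP; exact: measurable_expw.
- by move=> s _; rewrite lee_fin expw_ge0.
Qed.

Let mEF (F : R -> \bar R) : measurable_fun [set: R] F ->
  measurable_fun [set: R] (fun s => (expw s)%:E * F s).
Proof.
by move=> mF; apply: emeasurable_funM => //; apply/measurable_EFinP; exact: measurable_expw.
Qed.

Lemma Eexp_le F G : measurable_fun [set: R] F -> measurable_fun [set: R] G ->
  (forall s, (0 < s)%R -> 0 <= F s) ->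
  (forall s, (0 < s)%R -> F s <= G s) -> Eexp F <= Eexp G.
Proof.
move=> mF mG F0 FG; apply: ge0_le_integral => //.
- by move=> s _; exact: expwM_ge0.
- exact: mEF.
- exact: mEF.
move=> s _; have [s0|s0] := ltP 0%R s.
  by rewrite lee_wpmul2l ?lee_fin ?expw_ge0// FG.
by rewrite /expw ltNge s0/= !mul0e.
Qed.

Lemma EexpD F G : measurable_fun [set: R] F -> measurable_fun [set: R] G ->
  (forall s, (0 < s)%R -> 0 <= F s) -> (forall s, (0 < s)%R -> 0 <= G s) ->
  Eexp (fun s => F s + G s) = Eexp F + Eexp G.
Proof.
move=> mF mG F0 G0; rewrite /Eexp -ge0_integralD//; last 4 first.
- by move=> s _; exact: expwM_ge0.
- exact: mEF.
- by move=> s _; exact: expwM_ge0.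
- exact: mEF.
apply: eq_integral => s _; have [s0|s0] := ltP 0%R s.
  by rewrite ge0_muleDr ?F0 ?G0.
by rewrite /expw ltNge s0/= !mul0e adde0.
Qed.

Lemma EexpZ F (k : \bar R) : measurable_fun [set: R] F ->
  (forall s, (0 < s)%R -> 0 <= F s) -> 0 <= k -> Eexp (fun s => k * F s) = k * Eexp F.
Proof.
move=> mF F0 k0; rewrite /Eexp -ge0_integralZl//; last 2 first.
- exact: mEF.
- by move=> s _; exact: expwM_ge0.
by apply: eq_integral => s _; rewrite muleCA.
Qed.

Lemma Eexp_pow k : Eexp (fun s => (s ^+ k)%:E) = k`!%:R%:E.
Proof.
by rewrite -integral_expw_pow; apply: eq_integral => s _; rewrite EFinM.
Qed.

End exponential_weight.

Section exponential_inequalities.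
Context (R : realType).
Local Open Scope ereal_scope.
Implicit Types (u v : R -> R).

Definition increasing_ge0 u := (forall s, (0 <= u s)%R) /\ {homo u : s t / (s <= t)%R}.

Lemma increasing_ge0_measurable u : increasing_ge0 u -> measurable_fun [set: R] (EFin \o u).
Proof. by move=> [_ um]; apply/measurable_EFinP; exact: nondecreasing_measurable. Qed.

Lemma increasing_ge0M u v : increasing_ge0 u -> increasing_ge0 v ->
  increasing_ge0 (fun s => u s * v s)%R.
Proof.
move=> [u0 um] [v0 vm]; split=> [s|s t st]; first exact: mulr_ge0.
by rewrite ler_pM// ?um ?vm.
Qed.

(** Chebyshev's association inequality.  Two increasing functions satisfy
    [u s * v t + v s * u t <= u s * v s + u t * v t]; taking expectations in [t] and
    then in [s] gives twice the claim, with no integrability assumption. *)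
Lemma chebyshev_Eexp u v : increasing_ge0 u -> increasing_ge0 v ->
  Eexp (EFin \o u) * Eexp (EFin \o v) <= Eexp (fun s => (u s * v s)%:E).
Proof.
move=> iu iv; have iuv := increasing_ge0M iu iv.
have [u0 um] := iu; have [v0 vm] := iv.
have mu := increasing_ge0_measurable iu; have mv := increasing_ge0_measurable iv.
have muv : measurable_fun [set: R] (fun s => (u s * v s)%:E) := increasing_ge0_measurable iuv.
have eu0 s : 0 <= (EFin \o u) s by rewrite lee_fin.
have ev0 s : 0 <= (EFin \o v) s by rewrite lee_fin.
have uv0 s : 0 <= (u s * v s)%:E by rewrite lee_fin mulr_ge0.
set U := Eexp (EFin \o u); set V := Eexp (EFin \o v); set W := Eexp _.
have U0 : 0 <= U by exact: Eexp_ge0.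
have V0 : 0 <= V by exact: Eexp_ge0.
have W0 : 0 <= W by exact: Eexp_ge0.
have rearr (s t : R) : (u s * v t + v s * u t <= u s * v s + u t * v t)%R.
  wlog st : s t / (s <= t)%R => [H|].
    by case: (leP s t) => [/H//|/ltW/H]; lra.
  have := um _ _ st; have := vm _ _ st; nra.
have step s : (u s)%:E * V + (v s)%:E * U <= (u s * v s)%:E + W.
  rewrite -EexpZ ?lee_fin// -(EexpZ mu)// ?lee_fin//.
  rewrite -(@Eexp_cst _ (u s * v s)%:E)// -!EexpD//; try by apply: measurable_funeM.
  - apply: Eexp_le => //.
    + by apply: emeasurable_funD; apply: measurable_funeM.
    + exact: emeasurable_funD.
    + by move=> t _; rewrite adde_ge0// mule_ge0// lee_fin.
    + by move=> t _; rewrite /= -!EFinM -!EFinD lee_fin.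
  - by move=> t _; exact: uv0.
  - by move=> t _; rewrite mule_ge0// lee_fin.
  - by move=> t _; rewrite mule_ge0// lee_fin.
have : Eexp (fun s => V * (EFin \o u) s) + Eexp (fun s => U * (EFin \o v) s) <= W + W.
  rewrite -[X in _ <= _ + X](@Eexp_cst _ W)// -!EexpD//; try by apply: measurable_funeM.
  - apply: Eexp_le => //.
    + by apply: emeasurable_funD; apply: measurable_funeM.
    + exact: emeasurable_funD.
    + by move=> t _; rewrite adde_ge0// mule_ge0// lee_fin.
    + by move=> s _; rewrite /= [V * _]muleC [U * _]muleC.
  - by move=> t _; rewrite mule_ge0// lee_fin.
  - by move=> t _; rewrite mule_ge0// lee_fin.
rewrite !EexpZ// -/U -/V [V * U]muleC => UVW; rewrite leNgt; apply/negP => WUV.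
by move: UVW; apply/negP; rewrite -ltNge lteD.
Qed.

Lemma chebyshev_Eexp_prod (I : Type) (s : seq I) (u : I -> R -> R) :
  (forall i, increasing_ge0 (u i)) ->
  \prod_(i <- s) Eexp (EFin \o u i) <= Eexp (fun t => (\prod_(i <- s) u i t)%:E).
Proof.
move=> iu; elim: s => [|i s IH].
  rewrite big_nil; under [X in Eexp X]eq_fun do rewrite big_nil.
  by rewrite (Eexp_cst (c := 1)).
rewrite big_cons.
have -> : (fun t => (\prod_(j <- i :: s) u j t)%:E) = (fun t => (u i t * \prod_(j <- s) u j t)%:E).
  by apply/funext => t; rewrite big_cons.
have iP : increasing_ge0 (fun t => \prod_(i <- s) u i t)%R.
  elim: s {IH} => [|j s IH]; first by split=> [t|t t' _] /=; rewrite !big_nil.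
  have [h0 hm] := increasing_ge0M (iu j) IH.
  by split=> [t|t t' tt']; rewrite !big_cons ?h0 ?hm.
apply: le_trans (chebyshev_Eexp (iu i) iP).
by apply: lee_wpmul2l => //; apply: Eexp_ge0 => t _; rewrite lee_fin (iu i).1.
Qed.

(** The function [x ^ k.+1 - (k.+1) * th ^ k * x] decreases before [th] and increases
    after it. *)
Lemma exprB_tangent (k : nat) (a b th : R) : (0 <= a)%R -> (0 <= b)%R -> (0 <= th)%R ->
  (b <= a <= th)%R || (th <= a <= b)%R ->
  (a ^+ k.+1 + k.+1%:R * th ^+ k * b <= b ^+ k.+1 + k.+1%:R * th ^+ k * a)%R.
Proof.
move=> a0 b0 th0 H.
suff : (a ^+ k.+1 - b ^+ k.+1 <= (a - b) * (k.+1%:R * th ^+ k))%R by lra.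
rewrite subrXX.
case/orP: H => /andP[h1 h2].
  rewrite ler_wpM2l ?subr_ge0//.
  apply: (@le_trans _ _ (\sum_(i < k.+1) th ^+ k)%R); last first.
    by rewrite sumr_const card_ord mulr_natl.
  apply: ler_sum => i _; rewrite -[in leRHS](subnK (leq_ord i)) exprD.
  by rewrite ler_pM ?exprn_ge0// lerXn2r// ?nnegrE// (le_trans h1).
rewrite ler_wnM2l ?subr_le0//.
apply: (@le_trans _ _ (\sum_(i < k.+1) th ^+ k)%R).
  by rewrite sumr_const card_ord mulr_natl.
apply: ler_sum => i _; rewrite -[in leLHS](subnK (leq_ord i)) exprD.
by rewrite ler_pM ?exprn_ge0// lerXn2r// ?nnegrE// (le_trans h1).
Qed.

(** Comparison with [B s = be * s ^ d].  Since [A s / s ^ d] is nonincreasing, [A] is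
    above [B] up to some point and below it afterwards, and since [A] is increasing
    its values there lie on the two sides of some [th].  The tangent inequality
    [exprB_tangent] at [th] then compares the moments, as the mean of [B] exceeds
    that of [A]. *)
Lemma berwald_Eexp_gt (A : R -> R) (d k : nat) (al be : R) :
  increasing_ge0 A ->
  (forall l s : R, (0 < l <= 1)%R -> (0 < s)%R -> (l ^+ d * A s <= A (l * s))%R) ->
  Eexp (EFin \o A) = al%:E -> (al < be * d`!%:R)%R -> (0 <= be)%R ->
  Eexp (fun s => (A s ^+ k.+1)%:E) <= (be ^+ k.+1 * (k.+1 * d)`!%:R)%:E.
Proof.
move=> iA hA EA albe be0; have [A0 Am] := iA.
pose B (s : R) : R := (be * s ^+ d)%R.
have mA := increasing_ge0_measurable iA.
have mB : measurable_fun [set: R] (EFin \o B).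
  by apply/measurable_EFinP; apply: measurable_funM => //; exact: measurable_funX.
pose S := [set s : R | (0 < s)%R /\ (B s <= A s)%R].
have Sdown s t : S s -> (0 < t)%R -> (t <= s)%R -> S t.
  move=> [s0 BA] t0 ts; split => //.
  have l01 : (0 < t / s <= 1)%R by rewrite divr_gt0//= ler_pdivrMr// mul1r.
  have := hA _ _ l01 s0; rewrite divfK ?gt_eqF//; apply: le_trans.
  apply: (@le_trans _ _ ((t / s) ^+ d * B s)%R).
    by rewrite /B mulrCA -exprMn divfK ?gt_eqF.
  by rewrite ler_wpM2l// exprn_ge0// divr_ge0// ltW.
have [th [th0 thP]] : exists th : R, (0 <= th)%R /\
    forall s, (0 < s)%R -> (B s <= A s <= th)%R || (th <= A s <= B s)%R.
  have [[s0 Ss0]|nS] := pselect (S !=set0); last first.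
    exists 0%R; split => // s sp; rewrite A0/= ; apply/orP; right.
    by rewrite leNgt; apply/negP => /ltW BA; apply: nS; exists s.
  have [z [z0 nSz]] : exists z : R, (0 < z)%R /\ ~ S z.
    apply: contrapT => nz; have allS s : (0 < s)%R -> (B s <= A s)%R.
      by move=> sp; have [[]//|nSs] := pselect (S s); case: nz; exists s.
    move: albe; apply/negP; rewrite -leNgt -lee_fin -EA EFinM -(Eexp_pow R d) -EexpZ ?lee_fin//.
    - apply: Eexp_le => [|//|s sp|s sp].
      + by apply: measurable_funeM; apply/measurable_EFinP; exact: measurable_funX.
      + by rewrite mule_ge0// lee_fin exprn_ge0// ltW.
      + by rewrite -EFinM lee_fin allS.
    - by apply/measurable_EFinP; exact: measurable_funX.
    - by move=> s sp; rewrite lee_fin exprn_ge0 ?(ltW sp).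
  have sSz s : S s -> (s <= z)%R.
    by move=> Ss; rewrite leNgt; apply/negP => /ltW zs; apply: nSz; exact: (Sdown s).
  have ubA : has_ubound (A @` S) by exists (A z) => _ [s /sSz/Am ? <-].
  (* [S] is the initial segment on which [A] is above [B]; it is bounded because
     otherwise the mean of [A] would be at least that of [B]. *)
  exists (sup (A @` S)); split.
    apply: le_trans (A0 s0) _; apply: ub_le_sup => //; by exists s0.
  move=> s sp; have [Ss|nSs] := pselect (S s).
    apply/orP; left; rewrite (proj2 Ss)/=; apply: ub_le_sup => //; by exists s.
  apply/orP; right; apply/andP; split; last first.
    by rewrite leNgt; apply/negP => /ltW BA; apply: nSs.
  apply: ge_sup; first by exists (A s0); exists s0.
  move=> _ [t St <-]; apply: Am; rewrite leNgt; apply/negP => /ltW st.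
  by apply: nSs; exact: (Sdown t).
have B0 s : (0 < s)%R -> (0 <= B s)%R by move=> sp; rewrite mulr_ge0 ?exprn_ge0 ?(ltW sp).
pose K : R := (k.+1%:R * th ^+ k)%R.
have K0 : (0 <= K)%R by rewrite mulr_ge0// exprn_ge0.
have EB : Eexp (EFin \o B) = (be * d`!%:R)%:E.
  rewrite EFinM -(Eexp_pow R d) -EexpZ ?lee_fin//.
  - by apply/measurable_EFinP; exact: measurable_funX.
  - by move=> s sp; rewrite lee_fin exprn_ge0 ?(ltW sp).
have EBk : Eexp (fun s => (B s ^+ k.+1)%:E) = (be ^+ k.+1 * (k.+1 * d)`!%:R)%:E.
  rewrite EFinM -(Eexp_pow R (k.+1 * d)) -EexpZ ?lee_fin ?exprn_ge0//.
  - by congr Eexp; apply/funext => s; rewrite /B exprMn -exprM mulnC EFinM.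
  - by apply/measurable_EFinP; exact: measurable_funX.
  - by move=> s sp; rewrite lee_fin exprn_ge0 ?(ltW sp).
have mAk : measurable_fun [set: R] (fun s => (A s ^+ k.+1)%:E).
  by apply/measurable_EFinP; apply: measurable_funX; exact/measurable_EFinP.
have mBk : measurable_fun [set: R] (fun s => (B s ^+ k.+1)%:E).
  by apply/measurable_EFinP; apply: measurable_funX; exact/measurable_EFinP.
have : Eexp (fun s => (A s ^+ k.+1)%:E) + K%:E * Eexp (EFin \o B) <=
       Eexp (fun s => (B s ^+ k.+1)%:E) + K%:E * Eexp (EFin \o A).
  rewrite -!EexpZ ?lee_fin// -?EexpD//; try by apply: measurable_funeM.
  - apply: Eexp_le => //.
    + by apply: emeasurable_funD => //; apply: measurable_funeM.
    + by apply: emeasurable_funD => //; apply: measurable_funeM.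
    + by move=> s sp; rewrite adde_ge0 ?mule_ge0 ?lee_fin ?exprn_ge0 ?B0.
    + move=> s sp; rewrite -!EFinM -!EFinD lee_fin; apply: exprB_tangent => //; first exact: B0.
      exact: thP.
  - by move=> s sp; rewrite lee_fin exprn_ge0 ?B0.
  - by move=> s sp; rewrite mule_ge0 ?lee_fin.
  - by move=> s sp; rewrite lee_fin exprn_ge0.
  - by move=> s sp; rewrite mule_ge0 ?lee_fin ?B0.
  - by move=> s sp; rewrite lee_fin ?B0.
rewrite EA EB EBk -!EFinM.
have X0 : 0 <= Eexp (fun s => (A s ^+ k.+1)%:E).
  by apply: Eexp_ge0 => s _; rewrite lee_fin exprn_ge0.
case: (Eexp _) X0 => [x| |] // _; rewrite -!EFinD !lee_fin => xle.
have : (K * al <= K * (be * d`!%:R))%R by rewrite ler_wpM2l// ltW.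
by move: xle; set p := (K * _)%R; set q := (K * al)%R; lra.
Qed.


(** Berwald's inequality: among increasing functions with [A s / s ^ d] nonincreasing
    and given mean, the power [s ^ d] has the largest moments. *)
Lemma berwald_Eexp (A : R -> R) (d k : nat) (al : R) :
  increasing_ge0 A ->
  (forall l s : R, (0 < l <= 1)%R -> (0 < s)%R -> (l ^+ d * A s <= A (l * s))%R) ->
  Eexp (EFin \o A) = al%:E ->
  Eexp (fun s => (A s ^+ k.+1)%:E) <= ((al / d`!%:R) ^+ k.+1 * (k.+1 * d)`!%:R)%:E.
Proof.
move=> iA hA EA; have [A0 _] := iA.
have al0 : (0 <= al)%R by rewrite -lee_fin -EA; apply: Eexp_ge0 => s _; rewrite lee_fin.
have df : (0 < d`!%:R :> R)%R by rewrite ltr0n fact_gt0.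
pose b0 := (al / d`!%:R)%R; have b00 : (0 <= b0)%R by rewrite divr_ge0// ltW.
have ub (be : R) : (b0 < be)%R ->
    Eexp (fun s => (A s ^+ k.+1)%:E) <= (be ^+ k.+1 * (k.+1 * d)`!%:R)%:E.
  move=> bb; apply: berwald_Eexp_gt iA hA EA _ _; last by rewrite ltW// (le_lt_trans b00).
  by rewrite -ltr_pdivrMr.
have X0 : 0 <= Eexp (fun s => (A s ^+ k.+1)%:E).
  by apply: Eexp_ge0 => s _; rewrite lee_fin exprn_ge0.
case: (Eexp _) ub X0 => [x| |] ub X0 //.
  rewrite lee_fin; apply: (@cvgr_to_ge _ b0^'+ _ _ (fun be => be ^+ k.+1 * (k.+1 * d)`!%:R)%R).
    apply: cvgM; last exact: cvg_cst.
    exact/cvg_at_right_filter/exprn_continuous.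
  by near=> be; rewrite -lee_fin; apply: ub; near: be; exact: nbhs_right_gt.
have := ub (b0 + 1)%R; rewrite ltrDl ltr01 => /(_ isT).
by rewrite leye_eq.
Unshelve. all: by end_near. Qed.

End exponential_inequalities.

(** * Gauges and the dual Loomis-Whitney inequality *)

Section layers.
Context (R : realType) (n : nat).
Local Open Scope ereal_scope.
Notation leb := (@lebesgue_measure R).
Notation V := 'rV[R]_n.
Implicit Types (L : R -> set V) (vs : seq V) (a x : V).

(** Measurability of [fun (s, x) => L s x], tested along affine parametrizations
    because that is the form in which Tonelli's theorem needs it. *)
Definition jointly_borel L := forall k (U : 'M[R]_(k, n)) a,
  measurable [set z : k.-tuple R * R | L z.2 (a + row_of_tuple z.1 *m U)%R].

Lemma jointly_borel_set L s : jointly_borel L -> borel_set (L s).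
Proof.
move=> mL; have := measurable_ysection s (mL n 1%:M%R 0%R).
congr measurable; apply/seteqP; split => t; rewrite /ysection/= inE/= add0r mulmx1//.
Qed.

Lemma jointly_borel_fiber L x : jointly_borel L -> measurable [set s : R | L s x].
Proof.
move=> mL; have := measurable_xsection ([tuple] : 0.-tuple R) (mL 0%N 0%R x).
by congr measurable; apply/seteqP; split => s; rewrite /xsection/= inE/= mulmx0 addr0.
Qed.

(** When [L] is increasing this is [exp (- rho)] with [rho] the first [s] such that
    [L s x].  Log-concave functions and exponentials of gauges both have this form,
    which turns their integrals into expectations of volumes. *)
Definition layered L x := Eexp (fun s => ind (L s) x).

Lemma layered_ge0 L x : 0 <= layered L x.
Proof. by apply: Eexp_ge0 => s _; exact: ind_ge0. Qed.

Lemma measurable_ind_fiber L x : jointly_borel L ->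
  measurable_fun [set: R] (fun s => ind (L s) x).
Proof.
move=> mL; rewrite (_ : (fun s => _) = EFin \o \1_[set s | L s x]).
  by apply/measurable_EFinP; apply: measurable_indic; exact: jointly_borel_fiber.
by apply/funext => s; rewrite /ind /= !indicE; congr ((nat_of_bool _)%:R%:E).
Qed.

Lemma indE (A : set V) x : A x -> ind A x = 1.
Proof. by move=> Ax; rewrite /ind indicE mem_set. Qed.

Lemma indNE (A : set V) x : ~ A x -> ind A x = 0.
Proof. by move=> Ax; rewrite /ind indicE memNset. Qed.

Lemma Eexp_tail (rho : R) : (0 <= rho)%R ->
  Eexp (fun s => (\1_(`]rho, +oo[%classic) s)%:E) = (expR (- rho))%:E.
Proof.
move=> r0; rewrite -integral_expw_itv// [RHS]integral_mkcond; apply: eq_integral => s _.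
by rewrite patchE indicE; case: ifPn => _; rewrite ?mule1 ?mule0.
Qed.

Lemma Eexp_tailc (rho : R) : (0 <= rho)%R ->
  Eexp (fun s => (\1_(`[rho, +oo[%classic) s)%:E) = (expR (- rho))%:E.
Proof.
move=> r0; rewrite -integral_expw_itv// integral_itv_obnd_cbnd; last first.
  by apply/measurable_EFinP; apply: measurable_funTS; exact: measurable_expw.
rewrite [RHS]integral_mkcond; apply: eq_integral => s _.
by rewrite patchE indicE; case: ifPn => _; rewrite ?mule1 ?mule0.
Qed.

Lemma layered_ge L x (rho : R) : jointly_borel L -> (0 <= rho)%R ->
  (forall s, (rho < s)%R -> L s x) -> (expR (- rho))%:E <= layered L x.
Proof.
move=> mL r0 Lx; rewrite -Eexp_tail//; apply: Eexp_le.
- by apply/measurable_EFinP; exact: measurable_indic.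
- exact: measurable_ind_fiber.
- by move=> s _; rewrite lee_fin.
move=> s s0; rewrite indicE; case: (boolP (s \in _)) => [|_]; last exact: ind_ge0.
by rewrite inE/= in_itv/= andbT => /Lx/indE ->.
Qed.

Lemma layered_le L x (rho : R) : jointly_borel L -> (0 <= rho)%R ->
  (forall s, (0 < s)%R -> L s x -> (rho <= s)%R) -> layered L x <= (expR (- rho))%:E.
Proof.
move=> mL r0 Lx; rewrite -Eexp_tailc//; apply: Eexp_le.
- exact: measurable_ind_fiber.
- by apply/measurable_EFinP; exact: measurable_indic.
- by move=> s _; exact: ind_ge0.
move=> s s0; rewrite indicE; case: (boolP (s \in _)) => [_|].
  by rewrite lee_fin indicE; case: (_ \in _).
rewrite notin_setE/= in_itv/= andbT => /negP; rewrite -ltNge => srho.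
rewrite indNE// => /(Lx _ s0); apply/negP; by rewrite -ltNge.
Qed.

Lemma layered_gt L x (b : R) : jointly_borel L -> (0 < b)%R -> b%:E < layered L x ->
  exists s, [/\ (0 < s)%R, L s x & (b < expR (- s))%R].
Proof.
move=> mL b0 bh; apply: contrapT => ns.
move: bh; apply/negP; rewrite -leNgt.
have [b1|b1] := leP 1%R b.
  apply: (@le_trans _ _ 1); last by rewrite lee_fin.
  by rewrite -[1]/(1%R%:E) -expR0 -[X in expR X]oppr0 layered_le// => s s0 _; exact: ltW.
have := @layered_le L x (- ln b)%R mL.
rewrite opprK lnK ?posrE//; apply; first by rewrite oppr_ge0 ln_le0// ltW.
move=> s s0 Ls; rewrite leNgt; apply/negP => sb; apply: ns; exists s; split => //.
by rewrite -[ltLHS]lnK ?posrE// ltr_expR ltrNr.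
Qed.

Lemma rows_of_seq vs : exists U : 'M[R]_(size vs, n), rows U = vs.
Proof.
exists (\matrix_(i < size vs) nth 0%R vs i).
apply: (@eq_from_nth _ 0%R); first by rewrite /rows size_map size_enum_ord.
rewrite /rows size_map size_enum_ord => i ivs.
by rewrite (nth_map (Ordinal ivs)) ?size_enum_ord// rowK nth_enum_ord.
Qed.

Let mjoint L k (U : 'M[R]_(k, n)) a : jointly_borel L ->
  measurable_fun [set: k.-tuple R * R]
   (fun z => (expw z.2)%:E * ind (L z.2) (a + row_of_tuple z.1 *m U)%R).
Proof.
move=> mL; apply: emeasurable_funM.
  apply/measurable_EFinP; exact: (measurableT_comp (@measurable_expw R) measurable_snd).
have -> : (fun z : k.-tuple R * R => ind (L z.2) (a + row_of_tuple z.1 *m U)%R) =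
   EFin \o \1_[set z : k.-tuple R * R | L z.2 (a + row_of_tuple z.1 *m U)%R].
  by apply/funext => z; rewrite /ind /= !indicE; congr ((nat_of_bool _)%:R%:E).
by apply/measurable_EFinP; apply: measurable_indic; exact: mL.
Qed.

Lemma borel_layered L : jointly_borel L -> borel (layered L).
Proof.
move=> mL; rewrite /borel.
pose f (z : n.-tuple R * R) := (expw z.2)%:E * ind (L z.2) (0 + row_of_tuple z.1 *m 1%:M)%R.
rewrite (_ : _ \o _ = fubini_F leb f).
  apply: measurable_fun_fubini_tonelli_F; first exact: mjoint.
  by move=> z; rewrite mule_ge0// ?ind_ge0// lee_fin expw_ge0.
apply/funext => t; rewrite /fubini_F/= /layered /Eexp /f; apply: eq_integral => s _.
by rewrite add0r mulmx1.
Qed.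

Lemma iint_layered L vs a : jointly_borel L ->
  iint vs (layered L) a = Eexp (fun s => iint vs (ind (L s)) a).
Proof.
move=> mL; have [U <-] := rows_of_seq vs.
rewrite -iint_lebesgue; [|exact: layered_ge0|exact: borel_layered].
pose f (z : (size vs).-tuple R * R) := (expw z.2)%:E * ind (L z.2) (a + row_of_tuple z.1 *m U)%R.
transitivity (\int[leb]_s \int[@lebesgue_tuple R (size vs)]_t f (t, s)).
  apply: (@fubini_tonelli _ _ _ _ R (@lebesgue_tuple R (size vs)) leb f); first exact: mjoint.
  by move=> z; rewrite /f mule_ge0// ?ind_ge0// lee_fin expw_ge0.
apply: eq_integral => s _; rewrite -iint_lebesgue; [|exact: ind_ge0|].
  rewrite -ge0_integralZl//.
  - apply: borel_comp (measurable_comb _ _).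
    by apply: borel_ind; exact: jointly_borel_set.
  - by move=> t _; exact: ind_ge0.
  - by rewrite lee_fin expw_ge0.
by apply: borel_ind; exact: jointly_borel_set.
Qed.

End layers.

Section gauge.
Context (R : realType) (n : nat).
Local Open Scope ereal_scope.
Notation leb := (@lebesgue_measure R).
Notation V := 'rV[R]_n.
Implicit Types (L : set V) (vs : seq V) (a x : V).

Lemma lee_all_fractions (p : R) (X : \bar R) :
  (forall t : R, (0 < t < 1)%R -> (t * p)%:E <= X) -> p%:E <= X.
Proof.
move=> tX; case: X tX => [x| |] tX; last 2 first.
- by rewrite leey.
- by have := tX (2^-1)%R; rewrite invr_gt0 invf_lt1 ?ltr1n// ltr0n => /(_ isT).
rewrite lee_fin; apply: (@cvgr_to_le _ 1%R^'- _ _ (fun t => t * p)%R).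
  rewrite -[X in _ --> X](mul1r p); apply: cvgM; last exact: cvg_cst.
  by apply/cvg_at_left_filter; exact: cvg_id.
near=> t; rewrite -lee_fin; apply: tX; apply/andP; split; near: t.
  by apply: nbhs_left_gt.
exact: nbhs_left_lt.
Unshelve. all: by end_near. Qed.

Lemma iint_comp_scale vs (g : V -> \bar R) (c : R) a :
  iint vs (fun x => g (c *: x)%R) a = iint [seq c *: v | v <- vs]%R g (c *: a)%R.
Proof.
elim: vs a => //= v vs IH a; apply: eq_integral => x _.
by rewrite IH scalerDr !scalerA mulrC.
Qed.

Lemma iint_ind_dilate vs L (r : R) : (0 < r)%R -> borel_set L ->
  iint vs (fun x => ind L (r^-1 *: x)%R) 0%R = (r ^+ size vs)%:E * iint vs (ind L) 0%R.
Proof.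
move=> r0 mL; rewrite iint_comp_scale scaler0 iint_dilate ?invr_eq0 ?gt_eqF//.
- by rewrite normfV invrK gtr0_norm.
- exact: ind_ge0.
- exact: borel_ind.
Qed.

(** Convexity, together with the presence of the origin that makes the dilates
    increasing. *)
Definition convex_star L := L 0%R /\ forall x y (t : R), (0 < t < 1)%R ->
  L x -> L y -> L (t *: x + (1 - t) *: y)%R.

Definition dilates L (r : R) : set V := [set x | (0 < r)%R /\ L (r^-1 *: x)%R].

Lemma jointly_borel_dilates L : borel_set L -> jointly_borel (dilates L).
Proof.
move=> mL k U a.
rewrite (_ : [set z | _] = [set z | (0 < z.2)%R] `&`
    [set z | L (z.2 `^ (-1) *: (a + row_of_tuple z.1 *m U))%R]).
  apply: measurableI.
    rewrite -[X in measurable X]setTI.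
    have := @measurable_snd _ _ (k.-tuple R) R measurableT _ (measurable_itv `]0%R, +oo[).
    by congr measurable; apply/seteqP; split => z [_] /=; rewrite in_itv/= andbT.
  apply: borel_set_comp => // i.
  rewrite (_ : (fun z => _) = (fun z => z.2 `^ (-1) * (a + row_of_tuple z.1 *m U) 0 i)%R); last first.
    by apply/funext => z; rewrite mxE.
  apply: measurable_funM.
    exact: (measurableT_comp (measurable_powR (-1)) measurable_snd).
  exact: (measurableT_comp (measurable_comb U a i) measurable_fst).
by apply/seteqP; split => z [z0 Lz]; split => //; move: Lz; rewrite /= powR_inv1 ?(ltW z0).
Qed.

Lemma convex_star_shrink L x (t : R) : convex_star L -> (0 <= t <= 1)%R -> L x -> L (t *: x)%R.
Proof.
move=> [L0 cL] /andP[]; rewrite le_eqVlt => /orP[/eqP<- _|t0]; first by rewrite scale0r.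
rewrite le_eqVlt => /orP[/eqP->|t1]; first by rewrite scale1r.
by move=> Lx; have := cL x 0%R t; rewrite t0 t1 scaler0 addr0; apply.
Qed.

(** Subadditivity of the gauge of a convex set. *)
Lemma dilatesD L (r s : R) x y : convex_star L ->
  dilates L r x -> dilates L s y -> dilates L (r + s)%R (x + y)%R.
Proof.
move=> [L0 cL] [r0 Lx] [s0 Ly]; have rs : (0 < r + s)%R by rewrite addr_gt0.
split => //; have := cL _ _ (r / (r + s))%R _ Lx Ly.
rewrite divr_gt0//= ltr_pdivrMr// mul1r ltrDl s0 => /(_ isT).
congr L; rewrite !scalerA scalerDr; congr (_ *: _ + _ *: _)%R; field; rewrite ?gt_eqF//.
Qed.

Lemma dilatesZ L (r c : R) x : (0 < c)%R -> dilates L r x -> dilates L (c * r)%R (c *: x)%R.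
Proof.
move=> c0 [r0 Lx]; split; first by rewrite mulr_gt0.
by rewrite scalerA invfM mulrAC mulVf ?gt_eqF// mul1r.
Qed.

Lemma dilates_le L (r s : R) x : convex_star L -> (r <= s)%R -> dilates L r x -> dilates L s x.
Proof.
move=> cL rs [r0 Lx]; have s0 : (0 < s)%R by exact: lt_le_trans rs.
split => //; have := @convex_star_shrink _ _ (r / s)%R cL _ Lx.
rewrite divr_ge0 ?(ltW r0) ?(ltW s0)//= ler_pdivrMr// mul1r rs => /(_ isT).
by congr L; rewrite scalerA mulrAC divff ?gt_eqF// mul1r.
Qed.

(** [exp (- gauge of L)], without mentioning the gauge, which may be infinite. *)
Definition exp_gauge L := layered (dilates L).

(** The gauge is sublinear, so [exp (- gauge)] is superadditive in the multiplicative
    sense for all positive weights, whatever their sum. *)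
Lemma dominates_products_exp_gauge (I : finType) (c : I -> R) L :
  borel_set L -> convex_star L -> (forall i, 0 < c i)%R ->
  dominates_products c (exp_gauge L) (fun=> exp_gauge L).
Proof.
move=> mL cL c0 b x bx; have jL := jointly_borel_dilates mL.
have /choice[r rP] : forall i, exists r : R,
    [/\ (0 < r)%R, dilates L r (x i) & (b i < expR (- r))%R].
  by move=> i; have [b0 bh] := bx i; exact: layered_gt.
pose rho := (\sum_i c i * r i)%R.
have rho0 : (0 <= rho)%R.
  by apply: sumr_ge0 => i _; rewrite mulr_ge0// ltW//; have [] := rP i.
apply: (@le_trans _ _ (expR (- rho))%:E).
  rewrite lee_fin -sumrN expR_sum; apply: ler_prod => i _.
  have [r0 _ br] := rP i; have [b0 _] := bx i.
  rewrite powR_ge0/= -mulrN mulrC expRM ge0_ler_powR ?nnegrE ?expR_ge0 ?(ltW br) ?(ltW b0) ?(ltW (c0 i))//.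
apply: layered_ge => // s rhos.
suff : (\sum_i c i *: x i = 0 /\ rho = 0)%R \/ dilates L rho (\sum_i c i *: x i)%R.
  case=> [[-> rh0]|]; last by apply: dilates_le => //; exact: ltW.
  by rewrite /dilates/= scaler0 -rh0; split => //; exact: cL.1.
apply: (big_rec2 (fun y t => (y = 0 /\ t = 0)%R \/ dilates L t y)); first by left.
move=> i t y _ IH; right; have [r0 dx _] := rP i; have := dilatesZ (c0 i) dx.
by case: IH => [[-> ->]|dy] dx'; [rewrite !addr0|exact: dilatesD].
Qed.

Lemma log_concave_exp_gauge L : borel_set L -> convex_star L -> log_concave (exp_gauge L).
Proof.
move=> mL cL l /andP[l0 l1]; apply: dominates_products_exp_gauge => // -[] //.
by rewrite subr_gt0.
Qed.

(** The dilate [r L] has volume [r ^ d * |L|], and the mean of [r ^ d] for the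
    exponential law is [d!]. *)
Lemma iint_exp_gauge vs L : borel_set L ->
  iint vs (exp_gauge L) 0%R = ((size vs)`!%:R)%:E * iint vs (ind L) 0%R.
Proof.
move=> mL; have jL := jointly_borel_dilates mL.
rewrite iint_layered// -(Eexp_pow R) muleC -EexpZ; last 3 first.
- by apply/measurable_EFinP; exact: measurable_funX.
- by move=> s s0; rewrite lee_fin exprn_ge0// ltW.
- by apply: iint_ge0; exact: ind_ge0.
apply: eq_integral => r _; have [r0|r0] := ltP 0%R r; last first.
  by rewrite /expw ltNge r0/= !mul0e.
congr (_ * _); rewrite muleC -iint_ind_dilate//; congr (iint _ _ _).
apply/funext => x; rewrite /ind !indicE; congr ((nat_of_bool _)%:R%:E).
by apply/idP/idP; rewrite !inE /dilates/=; [case|split].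
Qed.

(** Liakopoulos' dual Loomis-Whitney inequality: [dominates_products_iint] applied to
    [exp_gauge L], whose integral over a coordinate subspace of dimension [d] is
    [d!] times the volume of the section of [L]. *)
Lemma dual_loomis_whitney (I : finType) (J : eqType) (k : nat) (w : J -> V)
    (C : I -> pred J) (s : seq J) L (A : R) (a : I -> R) :
  (0 < k)%N -> (forall j, j \in s -> #|[pred i | C i j]| = k) ->
  borel_set L -> convex_star L ->
  iint [seq w j | j <- s] (ind L) 0%R = A%:E ->
  (forall i, iint [seq w j | j <- s & C i j] (ind L) 0%R = (a i)%:E) ->
  (\prod_i ((size [seq j <- s | C i j])`!%:R * a i) <= ((size s)`!%:R * A) ^+ k)%R.
Proof.
move=> k0 Ck mL cL AE aE.
have kR : (0 < k%:R :> R)%R by rewrite ltr0n.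
have a0 i : (0 <= a i)%R by rewrite -lee_fin -aE iint_ge0//; exact: ind_ge0.
have A0 : (0 <= A)%R by rewrite -lee_fin -AE iint_ge0//; exact: ind_ge0.
pose e i : R := ((size [seq j <- s | C i j])`!%:R * a i)%R.
have e0 i : (0 <= e i)%R by rewrite mulr_ge0.
have [/existsP[i /eqP ei0]|/existsPn epos] := boolP [exists i, e i == 0%R].
  rewrite (bigD1 i)//= -/(e i) ei0 mul0r exprn_ge0// mulr_ge0//.
have {}e0 i : (0 < e i)%R by rewrite lt_neqAle eq_sym epos e0.
have dom : dominates_products (fun=> k%:R^-1)%R (iint [seq w j | j <- s] (exp_gauge L))
    (fun i => iint [seq w j | j <- s & C i j] (exp_gauge L)).
  apply: (@dominates_products_iint R n I J (fun=> k%:R^-1)%R w C s (exp_gauge L) (fun=> exp_gauge L)).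
  - by move=> i; rewrite invr_gt0.
  - move=> j js; rewrite sumr_const (_ : #|_| = k); last by rewrite -(Ck j js).
    by rewrite -[LHS]mulr_natl divff ?gt_eqF.
  - exact: layered_ge0.
  - by move=> i; exact: layered_ge0.
  - exact: log_concave_exp_gauge.
  - by move=> i; exact: log_concave_exp_gauge.
  - by apply: dominates_products_exp_gauge => // i; rewrite invr_gt0.
set X := ((size s)`!%:R * A)%R.
have X0 : (0 <= X)%R by rewrite mulr_ge0.
(* Domination needs strict lower bounds, so the integrals are scaled by [t < 1]. *)
apply: (@cvgr_to_le _ 1%R^'- _ _ (fun t => t ^+ #|I| * \prod_i e i)%R).
  rewrite -[X in _ --> X](mul1r (\prod_i _)%R); apply: cvgM; last exact: cvg_cst.
  rewrite -[X in _ --> X](expr1n R #|I|).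
  exact/cvg_at_left_filter/exprn_continuous.
near=> t.
have t0 : (0 < t)%R by near: t; exact: nbhs_left_gt.
have t1 : (t < 1)%R by near: t; exact: nbhs_left_lt.
have := dom (fun i => t * e i)%R (fun=> 0%R).
rewrite [X in iint _ _ X]big1; last by move=> i _; rewrite scaler0.
rewrite iint_exp_gauge// AE size_map -EFinM lee_fin -/X => /(_ _)H.
have {}H : (\prod_i (t * e i) `^ k%:R^-1 <= X)%R.
  apply: H => i; rewrite iint_exp_gauge// aE size_map -EFinM lte_fin -/(e i).
  by rewrite mulr_gt0//; split=> //; rewrite gtr_pMl.
have -> : (t ^+ #|I| * \prod_i e i = (\prod_i (t * e i) `^ k%:R^-1) ^+ k)%R.
  rewrite -prodrXl -prodr_const -big_split/=; apply: eq_bigr => i _.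
  by rewrite -powR_mulrn ?powR_ge0// -powRrM mulVf ?gt_eqF// powRr1// mulr_ge0// ltW.
by rewrite lerXn2r ?nnegrE// prodr_ge0// => i _; exact: powR_ge0.
Unshelve. all: by end_near. Qed.

End gauge.

(** * Uniform covers and log-concave functions *)

Section core.
Context (R : realType) (n : nat).
Local Open Scope ereal_scope.
Notation leb := (@lebesgue_measure R).
Notation V := 'rV[R]_n.
Implicit Types (vs : seq V) (a x : V).

(** Log-concavity with weak bounds, obtained from the strict ones by scaling them by
    factors tending to [1]. *)
Lemma log_concave_le (g : V -> \bar R) (l a b : R) x y : log_concave g ->
  (0 < l < 1)%R -> (0 < a)%R -> (0 < b)%R -> a%:E <= g x -> b%:E <= g y ->
  (a `^ l * b `^ (1 - l))%:E <= g (l *: x + (1 - l) *: y)%R.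
Proof.
move=> gl l01 a0 b0 ax by_; apply: lee_all_fractions => t /andP[t0 t1].
have := gl l l01 (fun e => if e then t * a else t * b)%R (fun e => if e then x else y).
rewrite !big_bool/=.
have -> : ((t * a) `^ l * (t * b) `^ (1 - l) = t * (a `^ l * b `^ (1 - l)))%R.
  rewrite !powRM ?ltW// mulrACA -powRD ?(gt_eqF t0) ?implybT//.
  by rewrite [(l + _)%R]addrC subrK powRr1 ?ltW.
apply; case; rewrite mulr_gt0//; split=> //.
  by apply: lt_le_trans ax; rewrite lte_fin gtr_pMl.
by apply: lt_le_trans by_; rewrite lte_fin gtr_pMl.
Qed.

Variables (f : V -> \bar R) (M : R).
Hypotheses (f_ge0 : forall x, 0 <= f x) (f_borel : borel f) (f_lc : log_concave f).
Hypotheses (M_gt0 : (0 < M)%R) (f_le : forall x, f x <= M%:E) (f0 : f 0%R = M%:E).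

(** Level sets of [- ln (f / M)]; they increase with [s] and are empty for [s < 0]. *)
Definition exp_level (s : R) : set V := [set x | (M * expR (- s))%:E <= f x].

Let Ms_gt0 s : (0 < M * expR (- s))%R.
Proof. by rewrite mulr_gt0// expR_gt0. Qed.

Lemma jointly_borel_exp_level : jointly_borel exp_level.
Proof.
move=> k U a; rewrite -[X in measurable X]setTI.
apply: measurable_lee => //.
  apply/measurable_EFinP; apply: measurable_funM => //.
  by apply: measurableT_comp => //; apply: measurableT_comp => //; exact: measurable_snd.
apply: (measurableT_comp (f := fun t : k.-tuple R => f (a + row_of_tuple t *m U)%R)).
  exact: borel_comp (measurable_comb _ _).
exact: measurable_fst.
Qed.

(** The layer-cake formula for the exponential law of the level. *)
Lemma layered_exp_level x : f x = M%:E * layered exp_level x.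
Proof.
have jL := jointly_borel_exp_level.
have Mi : (0 <= M^-1)%R by rewrite invr_ge0 ltW.
have ff : f x \is a fin_num by rewrite ge0_fin_numE// (le_lt_trans (f_le x)) ?ltry.
move: (f_le x) (f_ge0 x); rewrite -(fineK ff); set r := fine (f x) => rM r0.
have fr : f x = r%:E by rewrite fineK.
rewrite !lee_fin in rM r0.
move: r0; rewrite le_eqVlt => /orP[/eqP r0|r0].
  rewrite -r0 (_ : layered _ _ = 0) ?mule0//; apply: integral0_eq => s _.
  by rewrite indNE ?mule0// /exp_level/= fr -r0 lee_fin; apply/negP; rewrite -ltNge.
pose rho := (- ln (r / M))%R.
have rM0 : (0 < r / M)%R by rewrite divr_gt0.
have rho0 : (0 <= rho)%R by rewrite oppr_ge0 ln_le0// ler_pdivrMr// mul1r.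
have levE s : exp_level s x <-> (rho <= s)%R.
  rewrite /exp_level/= fr lee_fin mulrC -ler_pdivlMr//.
  by rewrite -[leRHS]lnK ?posrE// ler_expR lerNl.
have -> : layered exp_level x = (expR (- rho))%:E.
  apply/eqP; rewrite eq_le; apply/andP; split.
    by apply: layered_le => // s _ /levE.
  by apply: layered_ge => // s rs; apply/levE; exact: ltW.
by rewrite opprK lnK ?posrE// -EFinM mulrC divfK// gt_eqF.
Qed.

Lemma iint_exp_level vs a : iint vs f a = M%:E * Eexp (fun s => iint vs (ind (exp_level s)) a).
Proof.
have jL := jointly_borel_exp_level.
rewrite -iint_layered// -iintZ ?ltW//; [|exact: layered_ge0|exact: borel_layered].
by congr (iint _ _ _); apply/funext => x; rewrite layered_exp_level.
Qed.

Lemma convex_star_exp_level s : (0 < s)%R -> convex_star (exp_level s).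
Proof.
move=> s0; split=> [|x y t t01 Lx Ly].
  rewrite /exp_level/= f0 lee_fin ger_pMr//.
  by rewrite -[leRHS]expR0 ler_expR oppr_le0 ltW.
have := log_concave_le f_lc t01 (Ms_gt0 s) (Ms_gt0 s) Lx Ly.
by rewrite -powRD ?(gt_eqF (Ms_gt0 s)) ?implybT// [(t + _)%R]addrC subrK powRr1// ltW.
Qed.

(** Log-concavity between [x / l] and the maximum point [0]: shrinking a point by [l]
    shrinks its level by [l]. *)
Lemma exp_level_shrink s (l : R) x : (0 < l <= 1)%R -> (0 < s)%R ->
  exp_level s (l^-1 *: x)%R -> exp_level (l * s) x.
Proof.
move=> /andP[l0]; rewrite le_eqVlt => /orP[/eqP ->|l1] s0; first by rewrite invr1 scale1r mul1r.
move=> Lx; have l01 : (0 < l < 1)%R by rewrite l0.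
have := log_concave_le f_lc l01 (Ms_gt0 s) M_gt0 Lx (_ : M%:E <= f 0%R).
rewrite f0 scaler0 addr0 scalerA divff ?gt_eqF// scale1r => /(_ (lexx _)).
congr (_%:E <= _); rewrite powRM ?expR_ge0 ?ltW// mulrAC -powRD ?(gt_eqF M_gt0) ?implybT//.
by rewrite [(l + _)%R]addrC subrK powRr1 ?ltW// -expRM mulNr [(s * l)%R]mulrC.
Qed.

Lemma iint_exp_level_lty vs s : iint vs f 0%R < +oo -> iint vs (ind (exp_level s)) 0%R < +oo.
Proof.
have jL := jointly_borel_exp_level; move=> fin.
apply: (@le_lt_trans _ _ ((M * expR (- s))^-1%:E * iint vs f 0%R)).
  rewrite -iintZ// ?invr_ge0 ?(ltW (Ms_gt0 s))//; apply: iint_le.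
  - exact: ind_ge0.
  - by apply: borel_ind; exact: jointly_borel_set.
  - exact: measurable_funeM.
  move=> x; have [Lx|nLx] := pselect (exp_level s x).
    by rewrite indE// muleC lee_pdivlMr// mul1e.
  by rewrite indNE// mule_ge0// lee_fin invr_ge0 ltW.
by rewrite lte_mul_pinfty// lee_fin invr_ge0 ltW.
Qed.

(** With [A s] and [a_i s] the volumes of [exp_level s] and of its coordinate
    sections, and [E] the expectation for the exponential law of [s],
    [prod_i d_i! E a_i <= E (prod_i d_i! a_i) <= E ((d! A) ^ k) <= (k d)! (E A) ^ k]
    by Chebyshev's inequality, by the dual Loomis-Whitney inequality for each level
    set, and by Berwald's inequality. *)
Theorem log_concave_uniform_cover (I : finType) (J : eqType) (k : nat) (w : J -> V)
    (C : I -> pred J) (s : seq J) :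
  (forall j, j \in s -> #|[pred i | C i j]| = k) ->
  iint [seq w j | j <- s] f 0%R < +oo ->
  (forall i, iint [seq w j | j <- s & C i j] f 0%R < +oo) ->
  ((\prod_i ((size [seq j <- s | C i j])`!%:R * fine (iint [seq w j | j <- s & C i j] f 0%R))) * M ^+ k
   <= (k * size s)`!%:R * fine (iint [seq w j | j <- s] f 0%R) ^+ k * M ^+ #|I|)%R.
Proof.
move=> Ck finV finVi.
have jL := jointly_borel_exp_level.
case: k Ck => [|k] Ck.
  have nC i : [seq j <- s | C i j] = [::].
    apply/eqP; rewrite -(negbK (_ == _)) -has_filter; apply/hasPn => j js.
    by have /card0_eq/(_ i) := Ck j js; rewrite inE => ->.
  under eq_bigr => i _ do rewrite nC/= f0/= mul1r.
  by rewrite prodr_const !expr0 mulr1 mul0n mul1r mul1r.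
(* Volumes of the level sets, with the properties that Chebyshev's and Berwald's
   inequalities require. *)
have vol (vs : seq V) : iint vs f 0%R < +oo -> exists2 A : R -> R,
    (forall t, iint vs (ind (exp_level t)) 0%R = (A t)%:E) &
    [/\ increasing_ge0 A,
       forall l t : R, (0 < l <= 1)%R -> (0 < t)%R -> (l ^+ size vs * A t <= A (l * t))%R &
       exists2 al, Eexp (EFin \o A) = al%:E & fine (iint vs f 0%R) = (M * al)%R].
  move=> fin; pose A t := fine (iint vs (ind (exp_level t)) 0%R).
  have AE t : iint vs (ind (exp_level t)) 0%R = (A t)%:E.
    by rewrite /A fineK// ge0_fin_numE ?iint_exp_level_lty// iint_ge0//; exact: ind_ge0.
  exists A => //; split.
  - split=> [t|t u tu]; first by rewrite -lee_fin -AE iint_ge0//; exact: ind_ge0.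
    rewrite -lee_fin -!AE; apply: iint_le.
    + exact: ind_ge0.
    + by apply: borel_ind; exact: jointly_borel_set.
    + by apply: borel_ind; exact: jointly_borel_set.
    move=> x; have [Lx|nLx] := pselect (exp_level t x); last by rewrite indNE// ind_ge0.
    rewrite !indE//; apply: le_trans Lx; rewrite lee_fin ler_wpM2l ?(ltW M_gt0)//.
    by rewrite ler_expR lerN2.
  - move=> l t l01 t0; have l0 : (0 < l)%R by case/andP: l01.
    rewrite -lee_fin EFinM -!AE -iint_ind_dilate//; last exact: jointly_borel_set.
    apply: iint_le.
    + by move=> x; exact: ind_ge0.
    + rewrite /borel -[X in measurable_fun _ X]/(ind (exp_level t) \o (fun u => l^-1 *: @row_of_tuple R n u)%R).
      apply: borel_comp; first (by apply: borel_ind; exact: jointly_borel_set).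
      move=> i; under eq_fun do rewrite !mxE.
      by apply: measurable_funM => //; exact: measurable_tnth.
    + by apply: borel_ind; exact: jointly_borel_set.
    move=> x; have [Lx|nLx] := pselect (exp_level t (l^-1 *: x)%R); last by rewrite indNE// ind_ge0.
    by rewrite !indE//; exact: exp_level_shrink.
  have E : iint vs f 0%R = M%:E * Eexp (EFin \o A).
    by rewrite iint_exp_level; congr (_ * Eexp _); apply/funext => t; rewrite AE.
  have E0 : 0 <= Eexp (EFin \o A).
    by apply: Eexp_ge0 => t _; rewrite /= -AE iint_ge0//; exact: ind_ge0.
  case: (Eexp _) E E0 => [al| |] E E0 //; first by exists al => //; rewrite E.
  by move: fin; rewrite E mulry gtr0_sg// mul1e.
have [A AE [iA hA [al EA ->]]] := vol _ finV.
have /choice[a aP] : forall i, exists a : R -> R,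
    [/\ forall t, iint [seq w j | j <- s & C i j] (ind (exp_level t)) 0%R = (a t)%:E,
      increasing_ge0 a & exists2 be, Eexp (EFin \o a) = be%:E &
        fine (iint [seq w j | j <- s & C i j] f 0%R) = (M * be)%R].
  by move=> i; have [a ? [? _ ?]] := vol _ (finVi i); exists a.
have /choice[be beP] : forall i, exists be : R, Eexp (EFin \o a i) = be%:E /\
    fine (iint [seq w j | j <- s & C i j] f 0%R) = (M * be)%R.
  by move=> i; have [_ _ [b ? ?]] := aP i; exists b.
under eq_bigr => i _ do rewrite (beP i).2.
pose d i := (size [seq j <- s | C i j])`!%:R : R.
have d0 i : (0 <= d i)%R by [].
have ida i : increasing_ge0 (fun t => d i * a i t)%R.
  have [_ [a0 am] _] := aP i; split=> [t|t u tu]; first by rewrite mulr_ge0.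
  by rewrite ler_wpM2l ?am.
have Eda i : Eexp (fun t => (d i * a i t)%:E) = (d i * be i)%:E.
  have [_ ia _] := aP i; rewrite EFinM -(beP i).1 -EexpZ ?lee_fin//.
  - exact: increasing_ge0_measurable.
  - by move=> t _; rewrite lee_fin ia.1.
have iprod : increasing_ge0 (fun t => \prod_i (d i * a i t))%R.
  have H : forall r : seq I, increasing_ge0 (fun t => \prod_(i <- r) (d i * a i t))%R.
    elim=> [|i r IH]; first by split=> [t|t t' _] /=; rewrite !big_nil.
    have [h0 hm] := increasing_ge0M (ida i) IH.
    by split=> [t|t t' tt']; rewrite !big_cons ?h0 ?hm.
  exact: H.
pose df := ((size s)`!%:R : R)%R.
have df0 : (0 < df)%R by rewrite ltr0n fact_gt0.
have mAk : measurable_fun [set: R] (fun t => (A t ^+ k.+1)%:E).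
  apply/measurable_EFinP; apply: measurable_funX; apply/measurable_EFinP.
  exact: increasing_ge0_measurable.
have key : (\prod_i (d i * be i) <= (k.+1 * size s)`!%:R * al ^+ k.+1)%R.
  rewrite -lee_fin -prodEFin; under eq_bigr => i _ do rewrite -Eda.
  apply: le_trans (chebyshev_Eexp_prod (index_enum I) ida) _.
  apply: (@le_trans _ _ (Eexp (fun t => (df ^+ k.+1)%:E * (A t ^+ k.+1)%:E))).
    apply: Eexp_le.
    - exact: increasing_ge0_measurable.
    - exact: measurable_funeM.
    - by move=> t _; rewrite lee_fin iprod.1.
    move=> t t0; rewrite -EFinM -exprMn lee_fin.
    apply: (@dual_loomis_whitney _ _ _ _ _ w C s (exp_level t)) => //.
    - exact: jointly_borel_set.
    - exact: convex_star_exp_level.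
    - by move=> i; have [-> _ _] := aP i.
  rewrite EexpZ ?lee_fin ?exprn_ge0 ?(ltW df0)//; last first.
    by move=> t _; rewrite lee_fin exprn_ge0// iA.1.
  have := berwald_Eexp k iA hA EA; rewrite size_map -/df => /(lee_wpmul2l _) ber.
  apply: le_trans (ber (df ^+ k.+1)%:E _) _; first by rewrite lee_fin exprn_ge0// ltW.
  rewrite -EFinM lee_fin mulrA -exprMn [(df * _)%R]mulrC divfK ?gt_eqF//.
  by rewrite mulrC.
have -> : (\prod_i (d i * (M * be i)) = M ^+ #|I| * \prod_i (d i * be i))%R.
  rewrite -prodr_const -big_split/=; apply: eq_bigr => i _; ring.
rewrite exprMn.
have -> : ((k.+1 * size s)`!%:R * (M ^+ k.+1 * al ^+ k.+1) * M ^+ #|I| =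
  M ^+ #|I| * ((k.+1 * size s)`!%:R * al ^+ k.+1) * M ^+ k.+1)%R by ring.
by rewrite ler_wpM2r ?exprn_ge0 ?(ltW M_gt0)// ler_wpM2l// exprn_ge0// ltW.
Qed.

End core.

(** * Sections of compact convex sets *)

Section convex_body_sections.
Context (R : realType) (n : nat).
Notation V := 'rV[R]_n.
Implicit Types (K : set V) (a x : V).

Lemma compact_coord_bounded K : compact K ->
  exists2 M : R, 0 <= M & forall x, K x -> forall i, `|x 0 i| <= M.
Proof.
move=> /compact_bounded[M [_ bM]]; exists (Num.max 0 (M + 2)); first by rewrite le_max lexx.
move=> x Kx i; rewrite le_max; apply/orP; right.
have xM : `|x| < M + 2.
  by apply: (@le_lt_trans _ _ (M + 1)); [apply: (bM (M + 1)) => //; rewrite ltrDl|rewrite ltrD2l ltr1n].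
have : ball (0 : V) (M + 2) x by rewrite mx_norm_ball /ball_/= sub0r normrN.
by move=> [_ /(_ 0 i)]; rewrite /ball/= mxE sub0r normrN => /ltW.
Qed.

Lemma compact_borel K : compact K -> borel_set K.
Proof. by move=> cK; apply: borel_closed; apply: compact_closed => //; exact: norm_hausdorff. Qed.

(** The coordinates of a bounded set in a free family are bounded. *)
Lemma iint_compact_lty k (G : 'M[R]_(k, n)) K a : compact K -> row_free G ->
  (iint (rows G) (ind K) a < +oo)%E.
Proof.
move=> cK fG; have mK := compact_borel cK; have [M M0 KM] := compact_coord_bounded cK.
have /row_freeP[P GP] := fG.
pose B := \sum_i \sum_j (M + `|a 0 j|) * `|P j i|.
rewrite -lebesgue_section//.
pose box := [set t : k.-tuple R | forall i, - `|B| <= tnth t i <= `|B|].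
apply: (@le_lt_trans _ _ (lebesgue_tuple box)).
  apply: le_measure; rewrite ?inE.
  - exact: borel_set_comb.
  - exact: measurable_tuple_box.
  move=> t /= Kt i; rewrite -ler_norml.
  have -> : tnth t i = ((a + row_of_tuple t *m G - a) *m P) 0 i.
    by rewrite addrC addKr -mulmxA GP mulmx1 mxE.
  rewrite mxE; apply: le_trans (ler_norm_sum _ _ _) _.
  apply: (@le_trans _ _ (\sum_j (M + `|a 0 j|) * `|P j i|)).
    apply: ler_sum => j _; rewrite normrM ler_wpM2r// mxE [(- a) _ _]mxE.
    by apply: le_trans (ler_normB _ _) _; rewrite lerD2r KM.
  apply: le_trans (ler_norm _); rewrite /B (bigD1 i)//= lerDl.
  apply: sumr_ge0 => i' _; apply: sumr_ge0 => j _.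
  by rewrite mulr_ge0// addr_ge0.
by rewrite lebesgue_tuple_box ?ltry// ge0_cp.
Qed.

Lemma log_concave_ind K : convex_set K -> log_concave (ind K).
Proof.
move=> cK l l01 b x bx.
have xK e : K (x e) /\ b e < 1.
  have [b0 bK] := bx e; have [Kx|nK] := pselect (K (x e)).
    by split => //; move: bK; rewrite indE// lte_fin.
  by move: bK; rewrite indNE// lte_fin ltNge ltW.
have K2 : K (\sum_e (if e then l else 1 - l) *: x e).
  rewrite big_bool/=; case/andP: l01 => l0 l1.
  have l1' : 0 <= l <= 1 by rewrite !ltW.
  have := cK (x true) (x false) (Itv01 (ltW l0) (ltW l1)).
  by rewrite !inE => /(_ (xK _).1 (xK _).1).
rewrite indE// lee_fin; apply: prodr_ile1 => e _; rewrite powR_ge0/=.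
apply: (@le_trans _ _ (1 `^ (if e then l else 1 - l))); last by rewrite powR1.
apply: ge0_ler_powR.
- by case/andP: l01 => l0 l1; case: e; rewrite ?subr_ge0 ltW.
- by rewrite nnegrE ltW//; case: (bx e).
- by rewrite nnegrE.
- exact/ltW/(xK e).2.
Qed.

End convex_body_sections.

(** * Gram determinants and dual bases *)

Section families.
Context (R : realType) (n : nat).
Notation V := 'rV[R]_n.
Implicit Types (w v : 'I_n -> V) (A B S : {set 'I_n}).

Lemma map_enum_val A : [seq enum_val i | i <- enum 'I_#|A|] = enum A.
Proof.
case: (pickP (mem A)) => [x0 xA|A0]; last first.
  have A00 : #|A| = 0%N by exact: eq_card0.
  have -> : enum A = [::] by apply: size0nil; rewrite -cardE.
  by have -> : enum 'I_#|A| = [::] by apply: size0nil; rewrite size_enum_ord.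
apply: (@eq_from_nth _ x0); first by rewrite size_map size_enum_ord cardE.
move=> i; rewrite size_map size_enum_ord => iA.
rewrite (nth_map (Ordinal iA)) ?size_enum_ord//.
by rewrite (enum_val_nth x0) nth_enum_ord.
Qed.

Lemma rows_family_mx w A : rows (family_mx w A) = [seq w i | i <- enum A].
Proof.
rewrite -map_enum_val -map_comp; apply: eq_map => i /=.
by rewrite rowK.
Qed.

Lemma rows_col_mx k1 k2 (U : 'M[R]_(k1, n)) (Q : 'M[R]_(k2, n)) :
  rows (col_mx U Q) = rows U ++ rows Q.
Proof.
apply: (@eq_from_nth _ 0); first by rewrite size_cat !size_rows.
have nthE k (W : 'M[R]_(k, n)) (j : 'I_k) : nth 0 (rows W) j = row j W.
  by rewrite (nth_map j) ?size_enum_ord// nth_ord_enum.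
move=> i; rewrite size_rows => ik; rewrite nth_cat size_rows.
rewrite -[i]/(val (Ordinal ik)) nthE; case: split_ordP => j -> /=.
  by rewrite nthE; apply/rowP => l; rewrite [LHS]mxE [RHS]mxE col_mxEu.
by rewrite addKn nthE; apply/rowP => l; rewrite [LHS]mxE [RHS]mxE col_mxEd.
Qed.

Lemma row_free_basis_family w : basis_of fullv [tuple w i | i < n] ->
  forall A, row_free (family_mx w A).
Proof.
move=> /basis_free/freeP fw A.
rewrite -kermx_eq0; apply/rowV0P => c /sub_kermxP cw.
pose k (j : 'I_n) := \sum_(i < #|A| | enum_val i == j) c 0 i.
have kE (i : 'I_#|A|) : k (enum_val i) = c 0 i.
  rewrite /k (big_pred1 i)// => l /=; apply/eqP/eqP => [/enum_val_inj//|->//].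
apply/rowP => i; rewrite [RHS]mxE -kE; apply: fw.
rewrite -[RHS]cw mulmx_sum_row.
under eq_bigr do rewrite nth_mktuple.
under [RHS]eq_bigr do rewrite rowK.
rewrite (eq_bigr (fun j => \sum_(i < #|A| | enum_val i == j) c 0 i *: w (enum_val i))).
  rewrite (exchange_big_dep predT)//=; apply: eq_bigr => l _.
  by rewrite (big_pred1 (enum_val l))// => j; rewrite eq_sym.
by move=> j _; rewrite scaler_suml; apply: eq_bigr => l /eqP ->.
Qed.

Lemma family_mx_sub w A i : i \in A -> (w i <= family_mx w A)%MS.
Proof.
move=> iA; rewrite -[i in w i](enum_rankK_in iA)//.
by rewrite -(rowK (fun i => w (enum_val i))); exact: row_sub.
Qed.

Lemma family_mx_subP w A m (F : 'M[R]_(m, n)) :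
  (forall i, i \in A -> (w i <= F)%MS) -> (family_mx w A <= F)%MS.
Proof. by move=> wF; apply/row_subP => i; rewrite rowK wF// enum_valP. Qed.

Lemma family_mxS w A B : A \subset B -> (family_mx w A <= family_mx w B)%MS.
Proof. by move=> /fintype.subsetP AB; apply: family_mx_subP => i /AB; exact: family_mx_sub. Qed.

Lemma gram_det_perm k1 k2 (U1 : 'M[R]_(k1, n)) (U2 : 'M[R]_(k2, n)) :
  perm_eq (rows U1) (rows U2) -> \det (U1 *m U1^T) = \det (U2 *m U2^T).
Proof.
move=> /rows_perm_eq[e [s]]; case: k2 / e U2 s => U2 s; rewrite castmx_id => ->.
rewrite trmx_mul mulmxA -(mulmxA (perm_mx s)) !det_mulmx det_tr det_perm.
by rewrite mulrAC -expr2 sqrr_sign mul1r.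
Qed.

(** [v] is the basis dual to [w] on [S]. *)
Definition biorthogonal S v w :=
  forall i j, i \in S -> j \in S -> v i *m (w j)^T = (i == j)%:R%:M.

Lemma biorthogonal_gram S v w A B : biorthogonal S v w -> A \subset S -> B \subset S ->
  family_mx v A *m (family_mx w B)^T = \matrix_(i, j) (enum_val i == enum_val j)%:R.
Proof.
move=> vw /fintype.subsetP AS /fintype.subsetP BS; apply/matrixP => i j; rewrite [RHS]mxE.
have := vw (enum_val i) (enum_val j) (AS _ (enum_valP i)) (BS _ (enum_valP j)).
move=> /matrixP/(_ 0 0); rewrite [RHS]mxE/= mulr1n => <-.
by rewrite !mxE; apply: eq_bigr => l _; rewrite !mxE.
Qed.

Lemma biorthogonal_gram1 S v w A : biorthogonal S v w -> A \subset S ->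
  family_mx v A *m (family_mx w A)^T = 1%:M.
Proof.
move=> vw AS; rewrite (biorthogonal_gram vw)//; apply/matrixP => i j; rewrite !mxE.
by rewrite (inj_eq enum_val_inj).
Qed.

Lemma biorthogonal_gram0 S v w A : biorthogonal S v w -> A \subset S ->
  family_mx v A *m (family_mx w (S :\: A))^T = 0.
Proof.
move=> vw AS; rewrite (biorthogonal_gram vw)// ?finset.subsetDl//; apply/matrixP => i j; rewrite !mxE.
case: eqP => // e; have := enum_valP j; rewrite -e !inE => /andP[/negP[]].
exact: enum_valP.
Qed.

Lemma biorthogonal_row_free S v w A : biorthogonal S v w -> A \subset S ->
  row_free (family_mx v A).
Proof.
by move=> vw AS; apply/row_freeP; exists (family_mx w A)^T; exact: (biorthogonal_gram1 vw AS).
Qed.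

(** The dual basis inside [span w]: the rows of [(H H^T)^-1 H]. *)
Lemma biorthogonal_exists S w : row_free (family_mx w S) ->
  exists2 v, biorthogonal S v w & (family_mx v S <= family_mx w S)%MS.
Proof.
move=> fH; set H := family_mx w S.
pose D := invmx (H *m H^T) *m H.
have DH : D *m H^T = 1%:M by rewrite -mulmxA mulVmx// row_free_gram_unit.
pose v i := \sum_(k < #|S|) (enum_val k == i)%:R *: row k D.
have vE k : v (enum_val k) = row k D.
  rewrite /v (bigD1 k)//= eqxx scale1r big1 ?addr0// => l lk.
  by rewrite (inj_eq enum_val_inj) (negbTE lk) scale0r.
exists v.
  move=> i j iS jS; rewrite -(enum_rankK_in iS iS) -(enum_rankK_in iS jS) vE.
  set k := enum_rank_in _ _; set l := enum_rank_in _ _.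
  have -> : w (enum_val l) = row l H by rewrite rowK.
  have -> : row k D *m (row l H)^T = ((D *m H^T) k l)%:M.
    apply/matrixP => i0 j0; rewrite !ord1 !mxE mulr1n; apply: eq_bigr => r _.
    by rewrite !mxE.
  by rewrite DH mxE (inj_eq enum_val_inj).
apply: family_mx_subP => i iS; rewrite -(enum_rankK_in iS iS) vE.
by apply: submx_trans (row_sub _ _) _; exact: submxMl.
Qed.

(** Jacobi's complementary minor identity.  Compare the bases [Y] of [span w] made of
    [w] on [A] and on [S - A], and [X] made of [v] on [A] and of [w] on [S - A]: with
    [X = T Y], the block-triangular matrices [X X^T] and [X Y^T] have determinants
    [det T ^ 2 det (Y Y^T)] and [det T det (Y Y^T)]. *)
Lemma biorthogonal_gram_det S v w A : biorthogonal S v w -> A \subset S ->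
  row_free (family_mx w S) -> (family_mx v S <= family_mx w S)%MS ->
  \det (family_mx v A *m (family_mx v A)^T) * \det (family_mx w S *m (family_mx w S)^T) =
  \det (family_mx w (S :\: A) *m (family_mx w (S :\: A))^T).
Proof.
move=> vw AS fH vH; set B := S :\: A.
set VA := family_mx v A; set HB := family_mx w B; set HA := family_mx w A.
pose X := col_mx VA HB; pose Y := col_mx HA HB.
have YH : \det (Y *m Y^T) = \det (family_mx w S *m (family_mx w S)^T).
  apply: gram_det_perm; rewrite rows_col_mx !rows_family_mx -map_cat; apply: perm_map.
  apply: uniq_perm.
  - rewrite cat_uniq !enum_uniq andbT/=; apply/hasPn => i; rewrite !mem_enum.
    by rewrite inE => /andP[].
  - exact: enum_uniq.
  move=> i; rewrite mem_cat !mem_enum !inE; case: (boolP (i \in A)) => //= iA.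
  by rewrite (fintype.subsetP AS).
have HY : (family_mx w S <= Y)%MS.
  apply: family_mx_subP => i iS; rewrite -addsmxE.
  have [iA|iA] := boolP (i \in A).
    by apply: submx_trans (addsmxSl _ _); exact: family_mx_sub.
  by apply: submx_trans (addsmxSr _ _); apply: family_mx_sub; rewrite inE iA.
have /submxP[T XT] : (X <= Y)%MS.
  rewrite col_mx_sub -[X in _ && X]/(HB <= Y)%MS.
  rewrite (submx_trans _ HY) ?(submx_trans _ HY)//.
    by apply: family_mxS; exact: finset.subsetDl.
  by apply: submx_trans vH; exact: family_mxS.
have XX : \det (X *m X^T) = \det (VA *m VA^T) * \det (HB *m HB^T).
  rewrite tr_col_mx mul_col_row (biorthogonal_gram0 vw AS) -/HB.
  by rewrite det_lblock.
have XY : \det (X *m Y^T) = \det (HB *m HB^T).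
  rewrite tr_col_mx mul_col_row (biorthogonal_gram1 vw AS) (biorthogonal_gram0 vw AS).
  by rewrite det_lblock det1 mul1r.
have HB0 : \det (HB *m HB^T) != 0.
  rewrite -unitfE -unitmxE; apply: row_free_gram_unit.
  have BS : B \subset S by exact: finset.subsetDl.
  apply/row_freeP; exists (family_mx v B)^T.
  by rewrite -[LHS]trmxK trmx_mul trmxK (biorthogonal_gram1 vw BS) trmx1.
have XYE : X *m Y^T = T *m (Y *m Y^T) by rewrite XT mulmxA.
have XXE : X *m X^T = T *m (Y *m Y^T) *m T^T by rewrite XT trmx_mul !mulmxA.
move: XX XY; rewrite XXE XYE !det_mulmx det_tr YH.
set g := \det (family_mx w S *m _); set t := \det T => XX XY.
have tE : t = \det (VA *m VA^T) by apply: (mulIf HB0); rewrite -XX XY mulrC.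
by rewrite -tE XY.
Qed.

Lemma col_mx_gram_det k1 k2 (U : 'M[R]_(k1, n)) (Q : 'M[R]_(k2, n)) :
  U *m Q^T = 0 -> Q *m Q^T = 1%:M ->
  \det (col_mx U Q *m (col_mx U Q)^T) = \det (U *m U^T).
Proof. by move=> UQ QQ; rewrite tr_col_mx mul_col_row UQ QQ det_lblock det1 mulr1. Qed.

Lemma col_mx_row_free k1 k2 (U : 'M[R]_(k1, n)) (Q : 'M[R]_(k2, n)) :
  row_free U -> U *m Q^T = 0 -> Q *m Q^T = 1%:M -> row_free (col_mx U Q).
Proof.
move=> fU UQ QQ; rewrite -kermx_eq0; apply/rowV0P => c /sub_kermxP.
rewrite -[c]hsubmxK mul_row_col => cUQ.
have c2 : rsubmx c = 0.
  have := congr1 (fun x => x *m Q^T) cUQ.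
  by rewrite mulmxDl -!mulmxA UQ QQ mulmx0 add0r mulmx1 mul0mx.
have c1 : lsubmx c = 0.
  by apply: (row_free_inj fU); rewrite mul0mx -[RHS]cUQ c2 mul0mx addr0.
by rewrite c1 c2 row_mx0.
Qed.

Lemma rank_orthocompl m (F : 'M[R]_(m, n)) : \rank (orthocompl F) = (n - \rank F)%N.
Proof. by rewrite /orthocompl mxrank_ker mxrank_tr. Qed.

Lemma sub_orthocompl_mul m k1 k2 (F : 'M[R]_(m, n)) (U : 'M[R]_(k1, n)) (Q : 'M[R]_(k2, n)) :
  (U <= F)%MS -> (Q <= orthocompl F)%MS -> U *m Q^T = 0.
Proof.
move=> /submxP[D ->] /sub_kermxP QF.
by rewrite -mulmxA -[X in X *m Q^T]trmxK -trmx_mul QF trmx0 mulmx0.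
Qed.

(** If [U] and [B] are orthogonal and together span [F], then the orthogonal
    complement of [B] is spanned by [U] and the orthogonal complement of [F]. *)
Lemma col_mx_orthocompl k1 k2 k3 m (F : 'M[R]_(m, n)) (U : 'M[R]_(k1, n)) (Q : 'M[R]_(k2, n))
    (B : 'M[R]_(k3, n)) :
  row_free U -> row_free B -> (U <= F)%MS -> (B <= F)%MS -> U *m B^T = 0 ->
  (k1 + k3)%N = \rank F -> Q *m Q^T = 1%:M -> (Q == orthocompl F)%MS ->
  (col_mx U Q == orthocompl B)%MS.
Proof.
move=> fU fB UF BF UB k13 QQ QF.
have QF' := QF; case/andP: QF' => QsF _.
have UQ : U *m Q^T = 0 by exact: sub_orthocompl_mul QsF.
have sub : (col_mx U Q <= orthocompl B)%MS.
  rewrite col_mx_sub; apply/andP; split; first by apply/sub_kermxP.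
  by apply/sub_kermxP; rewrite -[LHS]trmxK trmx_mul trmxK (sub_orthocompl_mul BF QsF) trmx0.
rewrite -(geq_leqif (mxrank_leqif_eq sub)) rank_orthocompl (eqP fB).
have /eqP -> := col_mx_row_free fU UQ QQ.
have fQ : row_free Q by apply/row_freeP; exists Q^T.
have := eqmx_rank QF; rewrite (eqP fQ) rank_orthocompl => ->.
rewrite -k13; have : (k1 + k3 <= n)%N by rewrite k13 rank_leq_col.
lia.
Qed.

End families.

(** * Section volumes for uniform covers *)

Section real_forms.
Context (R : realType).

Lemma Gamma_nat (N : nat) : Gamma (1 + N%:R : R) = N`!%:R.
Proof.
rewrite /Gamma /Rintegral.
transitivity (fine (expR (- 0) * exp_moment N 0 : R)%:E); last first.
  by rewrite /= oppr0 expR0 mul1r exp_moment0.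
congr fine; rewrite -integral_expw_pow_itv//; apply: eq_integral => t.
rewrite inE/= in_itv/= andbT => t0; rewrite expw_gt0// [1 + _]addrC addrK powR_mulrn ?ltW//.
by rewrite mulrC.
Qed.

Lemma powRX (x c : R) (k : nat) : 0 <= x -> (x ^+ k) `^ c = x `^ (k%:R * c).
Proof. by move=> x0; rewrite -powR_mulrn// powRrM. Qed.

Lemma prod_powR (I : finType) (X : I -> R) (c : R) : (forall j, 0 <= X j) ->
  (\prod_j X j) `^ c = \prod_j X j `^ c.
Proof.
move=> X0; suff [] : 0 <= \prod_j X j /\ (\prod_j X j) `^ c = \prod_j X j `^ c by [].
apply: (big_rec2 (fun x y => 0 <= x /\ x `^ c = y)); first by rewrite powR1.
by move=> j y x _ [y0 <-]; rewrite mulr_ge0// powRM.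
Qed.

(** The power [c] of the hypothesis, divided by [M ^ q]; the quotient [k] of the
    combinatorial cover enters only through [q = k c]. *)
Lemma cover_power_form (m k : nat) (p q c M I N : R) (e X : 'I_m -> R) :
  (0 < m)%N -> 0 < c -> m%:R * c = p -> k%:R * c = q ->
  0 <= M -> 0 <= I -> 0 < N -> (forall j, 0 <= X j) -> (forall j, 0 <= e j) ->
  (M = 0 -> forall j, X j = 0) ->
  (0 < M -> \prod_j (e j * X j) * M ^+ k <= N * I ^+ k * M ^+ m) ->
  \prod_j e j `^ c * \prod_j X j `^ c / N `^ c <= M `^ (p - q) * I `^ q.
Proof.
move=> m0 c0 mp kq M0 I0 N0 X0 e0 MX core.
move: M0; rewrite le_eqVlt => /orP[/eqP M0|M0].
  rewrite (_ : \prod_j X j `^ c = 0) ?mulr0 ?mul0r ?mulr_ge0 ?powR_ge0//.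
  rewrite (bigD1 (Ordinal m0))//= MX ?powR0 ?mul0r ?gt_eqF//.
rewrite ler_pdivrMr ?powR_gt0//.
have P0 : 0 <= \prod_j (e j * X j) by apply: prodr_ge0 => j _; exact: mulr_ge0.
have := ge0_ler_powR (ltW c0) _ _ (core M0).
rewrite !nnegrE !mulr_ge0 ?exprn_ge0 ?(ltW M0) ?(ltW N0)// => /(_ isT isT).
rewrite !powRM ?mulr_ge0 ?exprn_ge0 ?(ltW M0) ?(ltW N0)// !powRX ?(ltW M0)// mp kq.
rewrite prod_powR; last by move=> j; exact: mulr_ge0.
have -> : \prod_j (e j * X j) `^ c = \prod_j e j `^ c * \prod_j X j `^ c.
  by rewrite -big_split/=; apply: eq_bigr => j _; rewrite powRM.
have -> : M `^ p = M `^ (p - q) * M `^ q.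
  by rewrite -powRD ?(gt_eqF M0) ?implybT// subrK.
rewrite mulrA ler_pM2r ?powR_gt0// => le; apply: le_trans le _.
by rewrite le_eqVlt; apply/orP; left; apply/eqP; ring.
Qed.

End real_forms.

Section cover_sections.
Context (R : realType) (n : nat).
Notation V := 'rV[R]_n.

Lemma section_volume_col_mx k1 k2 m (U : 'M[R]_(k1, n)) (Q : 'M[R]_(k2, n))
    (F : 'M[R]_(m, n)) (K : set V) : borel_set K ->
  row_free U -> U *m Q^T = 0 -> Q *m Q^T = 1%:M -> (col_mx U Q == F)%MS ->
  section_volume K 0 F =
  Num.sqrt (\det (U *m U^T)) * fine (iint (rows U) (iint (rows Q) (ind K)) 0).
Proof.
move=> mK fU UQ QQ GF; rewrite (section_volumeE _ (col_mx_row_free fU UQ QQ))//.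
by rewrite col_mx_gram_det// rows_col_mx iint_cat.
Qed.

Lemma volume_section (K : set V) : borel_set K -> volume K = section_volume K 0 (1%:M : 'M[R]_n).
Proof.
move=> mK; rewrite (@section_volumeE _ _ _ _ 1%:M)//; last 2 first.
- by rewrite row_free_unit unitmx1.
- exact/eqmxP.
rewrite mul1mx trmx1 det1 sqrtr1 mul1r -lebesgue_section// /volume.
by congr (fine (lebesgue_tuple _)); apply/seteqP; split => t /=; rewrite add0r mulmx1.
Qed.

Variables (S : {set 'I_n}) (v : 'I_n -> V) (r : nat) (Q : 'M[R]_(r, n)) (K : set V).
Hypotheses (cK : compact K) (vK : convex_set K) (fV : row_free (family_mx v S)).
Hypotheses (VQ : family_mx v S *m Q^T = 0) (QQ : Q *m Q^T = 1%:M).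

Let f := iint (rows Q) (ind K).

Let mK : borel_set K := compact_borel cK.

Let f_ge0 x : (0 <= f x)%E.
Proof. by apply: iint_ge0; exact: ind_ge0. Qed.

Let f_borel : borel f.
Proof. by apply: borel_iint; [exact: ind_ge0|exact: borel_ind]. Qed.

Let f_lc : log_concave f.
Proof. by apply: log_concave_iint; [exact: ind_ge0|exact: log_concave_ind]. Qed.

Let fQ : row_free Q.
Proof. by apply/row_freeP; exists Q^T. Qed.

Let f_fin x : f x \is a fin_num.
Proof. by rewrite ge0_fin_numE//; exact: iint_compact_lty. Qed.

(** Up to the volume of the parallelepiped spanned by [v] on [A], this is the volume
    of the section of [K] by the sum of the span of [v] on [A] and of the row space
    of [Q]. *)
Definition partial_volume (A : {set 'I_n}) := fine (iint [seq v i | i <- enum A] f 0).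

Lemma partial_volume_ge0 A : 0 <= partial_volume A.
Proof. by apply: fine_ge0; exact: iint_ge0. Qed.

Lemma partial_volume0 : partial_volume finset.set0 = fine (f 0).
Proof. by rewrite /partial_volume enum_set0. Qed.

Hypothesis f_max : forall x, (f x <= f 0)%E.

Let sub_free (A : {set 'I_n}) : A \subset S -> row_free (family_mx v A) /\ family_mx v A *m Q^T = 0.
Proof.
move=> AS; have [T TE] := submxP (family_mxS v AS); split; last first.
  by rewrite TE -mulmxA VQ mulmx0.
have [u uv _] := biorthogonal_exists fV.
apply/row_freeP; exists (family_mx u A)^T.
by rewrite -[LHS]trmxK trmx_mul trmxK (biorthogonal_gram1 uv AS) trmx1.
Qed.

Let pv_lty (A : {set 'I_n}) : A \subset S -> (iint [seq v i | i <- enum A] f 0 < +oo)%E.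
Proof.
move=> AS; have [fA AQ] := sub_free AS.
rewrite -rows_family_mx /f -iint_cat -rows_col_mx; apply: iint_compact_lty => //.
exact: col_mx_row_free.
Qed.

Lemma partial_volume_null A : fine (f 0) = 0 -> partial_volume A = 0.
Proof.
move=> f00; rewrite /partial_volume.
have fE : f = (fun x => 0%:E * f x)%E.
  apply/funext => x; rewrite mul0e; apply/eqP; rewrite eq_le f_ge0 andbT.
  by rewrite (le_trans (f_max x))// -(fineK (f_fin 0)) f00.
by rewrite fE iintZ// mul0e.
Qed.

Lemma uniform_cover_partial_volume (m k : nat) (C : 'I_m -> {set 'I_n}) :
  (forall j, C j \subset S) -> (forall i, i \in S -> #|[pred j | i \in C j]| = k) ->
  0 < fine (f 0) ->
  \prod_j ((#|C j|)`!%:R * partial_volume (C j)) * fine (f 0) ^+ k <=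
  (k * #|S|)`!%:R * partial_volume S ^+ k * fine (f 0) ^+ m.
Proof.
move=> CS Ck M0.
have f_le x : (f x <= (fine (f 0))%:E)%E by rewrite fineK.
have f0E : f 0 = (fine (f 0))%:E by rewrite fineK.
have enumC j : [seq i <- enum S | i \in C j] = enum (C j).
  rewrite /enum_mem -filter_predI; apply: eq_filter => i /=.
  by apply/andP/idP => [[]//|iC]; split=> //; exact: (fintype.subsetP (CS j)).
have := @log_concave_uniform_cover R n f _ f_ge0 f_borel f_lc M0 f_le f0E 'I_m 'I_n k v
  (fun j => [pred i | i \in C j]) (enum S).
rewrite -cardE card_ord; under eq_bigr => j _ do rewrite enumC -cardE -/(partial_volume _).
apply.
- by move=> i; rewrite mem_enum; exact: Ck.
- exact: pv_lty.
- by move=> j; rewrite enumC; exact: pv_lty.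
Qed.

(** With equal weights [c = p / m], every index belongs to exactly [k = 1 / c] of the
    sets [C j], hence to exactly [m - k] of their complements, and the arguments of
    the Gamma function are [1 + k d] and [1 + (m - k) d].  The second inequality is
    thus the first one for the complementary cover. *)
Lemma uniform_cover_powers (m : nat) (C : 'I_m -> {set 'I_n}) (p : R) :
  uniform_cover S C (fun=> p / m%:R) ->
  let c := p / m%:R in
  \prod_j (#|C j|)`!%:R `^ c * \prod_j partial_volume (C j) `^ c /
    Gamma (1 + #|S|%:R * m%:R / p) `^ c <= fine (f 0) `^ (p - 1) * partial_volume S /\
  \prod_j (#|S :\: C j|)`!%:R `^ c * \prod_j partial_volume (S :\: C j) `^ c /
    Gamma (1 + #|S|%:R * m%:R * (p - 1) / p) `^ c <= fine (f 0) * partial_volume S `^ (p - 1).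
Proof.
move=> [m0 CS q0 cov] c; have c0 : 0 < c by exact: (q0 (Ordinal m0)).
have mR : 0 < m%:R :> R by rewrite ltr0n.
have p0 : 0 < p by move: c0; rewrite /c pmulr_lgt0// invr_gt0.
have mc : m%:R * c = p by rewrite /c mulrC divfK// gt_eqF.
have M0 : 0 <= fine (f 0) by apply: fine_ge0.
have pv0 := partial_volume_ge0; have pvn A := @partial_volume_null A.
have M1 : fine (f 0) = fine (f 0) `^ (p - (p - 1)) by rewrite subKr powRr1.
have I1 : partial_volume S = partial_volume S `^ 1 by rewrite powRr1.
have fact0 N : 0 < N`!%:R :> R by rewrite ltr0n fact_gt0.
(* For empty [S] the exponent [p] is unconstrained and both sides are powers of
   the same volume. *)
have [S0|[i0 i0S]] := set_0Vmem S.
  have C0 j : C j = finset.set0 by apply/eqP; rewrite -finset.subset0 -S0.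
  have le q : fine (f 0) `^ p <= fine (f 0) `^ (p - q) * fine (f 0) `^ q.
    move: M0; rewrite le_eqVlt => /orP[/eqP <-|M0].
      by rewrite powR0 ?gt_eqF// mulr_ge0// powR_ge0.
    by rewrite -powRD ?(gt_eqF M0) ?implybT// subrK.
  have e1 : \prod_(j < m) (0`!%:R : R) `^ c = 1 by rewrite big1// => j _; rewrite powR1.
  have M_p : \prod_(j < m) fine (f 0) `^ c = fine (f 0) `^ p.
    by rewrite prodr_const card_ord -powR_mulrn ?powR_ge0// -powRrM mulrC mc.
  have G1 : Gamma (1 + 0 : R) = 1 by rewrite -[X in 1 + X]/(0%:R) Gamma_nat.
  have SC j : S :\: C j = finset.set0 by apply/eqP; rewrite -finset.subset0 S0 finset.set0D.
  have e2 : \prod_j (#|C j|)`!%:R `^ c = 1 :> R.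
    by rewrite -[RHS]e1; apply: eq_bigr => j _; rewrite C0 cards0.
  have e3 : \prod_j (#|S :\: C j|)`!%:R `^ c = 1 :> R.
    by rewrite -[RHS]e1; apply: eq_bigr => j _; rewrite SC cards0.
  have X2 : \prod_j partial_volume (C j) `^ c = fine (f 0) `^ p.
    by rewrite -M_p; apply: eq_bigr => j _; rewrite C0 partial_volume0.
  have X3 : \prod_j partial_volume (S :\: C j) `^ c = fine (f 0) `^ p.
    by rewrite -M_p; apply: eq_bigr => j _; rewrite SC partial_volume0.
  have PS : partial_volume S = fine (f 0) by rewrite S0 partial_volume0.
  rewrite e2 e3 X2 X3 PS S0 cards0 !mul0r G1 powR1 !mul1r divr1; split.
    by rewrite -[X in _ <= _ * X](powRr1 M0).
  by rewrite [X in _ <= X * _]M1.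
pose k := #|[pred j | i0 \in C j]|.
have cnt i : i \in S -> (#|[pred j | i \in C j]|)%:R * c = 1.
  move=> iS; rewrite -[RHS](cov _ iS) -mulr_sumr mulrC; congr (_ * _).
  by rewrite -sum1_card natr_sum big_mkcond/=; apply: eq_bigr => j _; rewrite inE; case: (_ \in _).
have kc : k%:R * c = 1 by exact: cnt.
have Ck i : i \in S -> #|[pred j | i \in C j]| = k.
  move=> iS; apply/eqP; rewrite -(eqr_nat R); apply/eqP.
  by apply: (mulIf (lt0r_neq0 c0)); rewrite cnt.
have CSk i : i \in S -> #|[pred j | i \in S :\: C j]| = (m - k)%N.
  move=> iS; rewrite -(Ck _ iS); have := cardC [pred j | i \in C j].
  rewrite card_ord => cE; rewrite -[X in (X - _)%N]cE addKn.
  by apply: eq_card => j; rewrite !inE iS andbT.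
have km : (k <= m)%N by have := max_card [pred j | i0 \in C j]; rewrite card_ord.
have mkc : (m - k)%:R * c = p - 1 by rewrite natrB// mulrBl mc kc.
have mp : m%:R / p = k%:R.
  have -> : m%:R = k%:R * p by rewrite -mc mulrCA kc mulr1.
  by rewrite mulfK// gt_eqF.
split.
  have -> : #|S|%:R * m%:R / p = (k * #|S|)%:R by rewrite -mulrA mp -natrM mulnC.
  rewrite I1 Gamma_nat.
  apply: (cover_power_form (k := k)) => //; first by move=> M00 j; exact: pvn.
  exact: uniform_cover_partial_volume.
rewrite [X in _ <= X * _]M1.
have -> : #|S|%:R * m%:R * (p - 1) / p = ((m - k) * #|S|)%:R.
  rewrite natrM natrB// -mp; field; exact: lt0r_neq0.
rewrite Gamma_nat.
apply: (cover_power_form (k := m - k)) => //; first by move=> M00 j; exact: pvn.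
by apply: uniform_cover_partial_volume => // j; exact: finset.subsetDl.
Qed.

End cover_sections.

Section assembly.
Context (R : realType).

(** The Gram factors [W j] of the sections cancel, whereas a common extra factor [t]
    of all sections comes out with the total weight [m c] of the cover. *)
Lemma cover_weights_factor (m : nat) (c a t E G : R) (W X Y : 'I_m -> R) :
  (forall j, 0 < W j) -> 0 < t -> (forall j, 0 <= X j) ->
  (forall j, Y j = W j * t * X j) ->
  a * E / (G * \prod_j W j `^ c) * \prod_j Y j `^ c =
  a * t `^ (m%:R * c) * (E * \prod_j X j `^ c / G).
Proof.
move=> W0 t0 X0 YE.
have PW : 0 < \prod_j W j `^ c by apply: prodr_gt0 => j _; exact: powR_gt0.
have -> : \prod_j Y j `^ c = \prod_j W j `^ c * t `^ (m%:R * c) * \prod_j X j `^ c.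
  have -> : t `^ (m%:R * c) = \prod_(j < m) t `^ c.
    by rewrite prodr_const card_ord -powR_mulrn ?powR_ge0// -powRrM mulrC.
  rewrite -!big_split/=; apply: eq_bigr => j _; rewrite YE.
  by rewrite !powRM ?mulr_ge0 ?(ltW (W0 j)) ?(ltW t0).
rewrite invfM; set u := \prod_j W j `^ c in PW *.
have -> : a * E * (G^-1 * u^-1) * (u * t `^ (m%:R * c) * \prod_j X j `^ c) =
  a * t `^ (m%:R * c) * (E * \prod_j X j `^ c / G) * (u^-1 * u) by ring.
by rewrite mulVf ?mulr1// gt_eqF.
Qed.

End assembly.

Theorem theorem5p4 (R : realType) (n : nat) (w : 'I_n -> 'rV[R]_n)
    (S : {set 'I_n}) (m : nat) (C : 'I_m -> {set 'I_n}) (p : R)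
    (K : set 'rV[R]_n) :
  let d := #|S| in
  let dj (j : 'I_m) := #|C j| in
  let dtj (j : 'I_m) := (d - dj j)%N in
  let H := family_mx w S in
  let Hj (j : 'I_m) := family_mx w (C j) in
  let Htj (j : 'I_m) := family_mx w (S :\: C j) in
  basis_of fullv [tuple w i | i < n] ->
  uniform_cover S C (fun=> p / m%:R) ->
  convex_body K ->
  (forall x : 'rV[R]_n, (x <= H)%MS ->
     section_volume K x (orthocompl H) <= section_volume K 0 (orthocompl H)) ->
  [/\ section_volume K 0 (orthocompl H) `^ (p - 1) * volume K >=
        (wedge_norm H `^ (p - 1) * \prod_(j < m) (dj j)`!%:R `^ (p / m%:R)) /
        (Gamma (1 + d%:R * m%:R / p) `^ (p / m%:R) *
           \prod_(j < m) wedge_norm (Htj j) `^ (p / m%:R)) *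
        \prod_(j < m) section_volume K 0 (orthocompl (Htj j)) `^ (p / m%:R),
      section_volume K 0 (orthocompl H) * volume K `^ (p - 1) >=
        (wedge_norm H * \prod_(j < m) (dtj j)`!%:R `^ (p / m%:R)) /
        (Gamma (1 + d%:R * m%:R * (p - 1) / p) `^ (p / m%:R) *
           \prod_(j < m) wedge_norm (Hj j) `^ (p / m%:R)) *
        \prod_(j < m) section_volume K 0 (orthocompl (Hj j)) `^ (p / m%:R),
      section_volume K 0 (orthocompl H) `^ (p - 1) * volume K >=
        (wedge_norm H * \prod_(j < m) (dj j)`!%:R `^ (p / m%:R)) /
        (Gamma (1 + d%:R * m%:R / p) `^ (p / m%:R) *
           \prod_(j < m) wedge_norm (Hj j) `^ (p / m%:R)) *
        \prod_(j < m) section_volume K 0 (Hj j + orthocompl H)%MS `^ (p / m%:R) &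
      section_volume K 0 (orthocompl H) * volume K `^ (p - 1) >=
        (wedge_norm H `^ (p - 1) * \prod_(j < m) (dtj j)`!%:R `^ (p / m%:R)) /
        (Gamma (1 + d%:R * m%:R * (p - 1) / p) `^ (p / m%:R) *
           \prod_(j < m) wedge_norm (Htj j) `^ (p / m%:R)) *
        \prod_(j < m) section_volume K 0 (Htj j + orthocompl H)%MS `^ (p / m%:R)].
Proof.
move=> d dj dtj H Hj Htj bw cov [cK vK _] Kmax.
have mK := compact_borel cK.
have fw := row_free_basis_family bw.
have [m0 CS q0 _] := cov.
set c := p / m%:R; have c0 : 0 < c := q0 (Ordinal m0).
have mR : 0 < m%:R :> R by rewrite ltr0n.
have mc : m%:R * c = p by rewrite /c mulrC divfK// gt_eqF.
have [QQ QF] := orthonormal_basisP (orthocompl H).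
move: (orthonormal_basis (orthocompl H)) QQ QF => Q QQ QF.
have fQ : row_free Q by apply/row_freeP; exists Q^T.
have QsF : (Q <= orthocompl H)%MS by case/andP: QF.
set f := iint (rows Q) (ind K).
have f_fin x : f x \is a fin_num.
  by rewrite ge0_fin_numE; [exact: iint_compact_lty|apply: iint_ge0; exact: ind_ge0].
have secH x : section_volume K x (orthocompl H) = fine (f x).
  by rewrite (section_volumeE _ fQ QF)// QQ det1 sqrtr1 mul1r.
have orth k (U : 'M[R]_(k, n)) : (U <= H)%MS -> U *m Q^T = 0.
  by move=> UH; exact: sub_orthocompl_mul QsF.
have full k (U : 'M[R]_(k, n)) : row_free U -> (U <= H)%MS -> k = d ->
    (col_mx U Q == (1%:M : 'M[R]_n))%MS.
  move=> fU UH kd; have := submx1 (col_mx U Q).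
  move=> /mxrank_leqif_eq/geq_leqif <-; rewrite mxrank1.
  have /eqP -> := col_mx_row_free fU (orth _ _ UH) QQ.
  rewrite rank_orthocompl (eqP (fw S)) kd subnKC//.
  by have := rank_leq_col H; rewrite (eqP (fw S)).
(* Translating along the rows of [Q] does not change [f], so the maximum over the
   span of [w] on [S] is the maximum over the whole space. *)
have f_max x : (f x <= f 0%R)%E.
  have /submxP[b xE] : (x <= col_mx H Q)%MS.
    by rewrite (submx_trans (submx1 x))//; case/andP: (full _ H (fw S) (submx_refl _) erefl).
  move: xE; rewrite -[b]hsubmxK mul_row_col => ->.
  rewrite /f iint_rows_shift; [|exact: ind_ge0|exact: borel_ind].
  by rewrite -/f -(fineK (f_fin 0)) -(fineK (f_fin (_ *m H))) lee_fin -!secH Kmax// submxMl.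
have wedgeE (A : {set 'I_n}) : wedge_norm (family_mx w A) = Num.sqrt (\det (family_mx w A *m (family_mx w A)^T)).
  exact: wedge_normE.
have wedge_gt0 (A : {set 'I_n}) : 0 < wedge_norm (family_mx w A).
  by rewrite wedgeE sqrtr_gt0 gram_det_gt0.
have [u uw uH] := biorthogonal_exists (fw S).
have fu (A : {set 'I_n}) : A \subset S -> row_free (family_mx u A).
  by move=> AS; exact: biorthogonal_row_free uw AS.
have uwedge (A : {set 'I_n}) : A \subset S -> Num.sqrt (\det (family_mx u A *m (family_mx u A)^T)) =
    wedge_norm (family_mx w (S :\: A)) * (wedge_norm H)^-1.
  move=> AS; rewrite !wedgeE -(biorthogonal_gram_det uw AS (fw S) uH).
  rewrite sqrtrM ?ltW ?gram_det_gt0 ?fu// -mulrA divff ?mulr1//.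
  by rewrite -wedgeE gt_eqF.
have pw_ge0 := partial_volume_ge0 w Q K.
have pu_ge0 := partial_volume_ge0 u Q K.
pose W (A : {set 'I_n}) := wedge_norm (family_mx w A).
have vol_w : volume K = W S * partial_volume w Q K S.
  rewrite volume_section// (section_volume_col_mx mK (fw S) (orth _ _ (submx_refl _)) QQ (full _ _ (fw S) (submx_refl _) erefl)).
  by rewrite -wedgeE rows_family_mx.
have vol_u : volume K = (W S)^-1 * partial_volume u Q K S.
  have fuS := fu S (fintype.subxx S).
  rewrite volume_section// (section_volume_col_mx mK fuS (orth _ _ uH) QQ (full _ _ fuS uH erefl)).
  rewrite uwedge ?fintype.subxx// rows_family_mx finset.setDv.
  suff -> : wedge_norm (family_mx w finset.set0) = 1 by rewrite mul1r.
  rewrite wedgeE; move: (family_mx w finset.set0); rewrite cards0 => U.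
  by rewrite det_mx00 sqrtr1.
have sec_w (A : {set 'I_n}) : A \subset S ->
    section_volume K 0 (family_mx w A + orthocompl H)%MS = W A * 1 * partial_volume w Q K A.
  move=> AS; rewrite mulr1 (@section_volume_col_mx _ _ _ _ _ (family_mx w A) Q)//.
  - by rewrite -wedgeE rows_family_mx.
  - by apply: orth; exact: family_mxS.
  - apply/eqmxP; apply: eqmx_trans (eqmx_sym (addsmxE _ _)) _.
    by apply: adds_eqmx => //; exact/eqmxP.
(* The orthogonal complement of the span of [w] on [S - A] is coordinatized by the
   dual basis on [A] and by [Q]. *)
have sec_u (A : {set 'I_n}) : A \subset S ->
    section_volume K 0 (orthocompl (family_mx w (S :\: A))) =
    W (S :\: A) * (W S)^-1 * partial_volume u Q K A.
  move=> AS; have uAH : (family_mx u A <= H)%MS by apply: submx_trans uH; exact: family_mxS.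
  rewrite (@section_volume_col_mx _ _ _ _ _ (family_mx u A) Q)//.
  - by rewrite uwedge// rows_family_mx.
  - exact: fu.
  - exact: orth.
  apply: (@col_mx_orthocompl _ _ _ _ _ _ H) => //.
  - exact: fu.
  - by apply: family_mxS; exact: finset.subsetDl.
  - exact: biorthogonal_gram0 uw AS.
  - by rewrite (eqP (fw S)) -(cardsID A S) (finset.setIidPr AS).
have [w3 w4] := uniform_cover_powers cK vK (fw S) (orth _ _ (submx_refl _)) QQ f_max cov.
have [u1 u2] := uniform_cover_powers cK vK (fu S (fintype.subxx S)) (orth _ _ uH) QQ f_max cov.
have W0 (A : {set 'I_n}) : 0 < W A := wedge_gt0 A.
have WS0 := W0 S.
have WSV : W S * (W S)^-1 = 1 by rewrite divff// gt_eqF.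
have Vge0 : 0 <= (W S)^-1 by rewrite invr_ge0 ltW.
have dtjE j : dtj j = #|S :\: C j|.
  by rewrite /dtj /d /dj -(cardsID (C j) S) (finset.setIidPr (CS j)) addKn.
have SD j : S :\: C j \subset S by exact: finset.subsetDl.
have SDD j : S :\: (S :\: C j) = C j.
  by rewrite finset.setDDr finset.setDv finset.set0U; exact/finset.setIidPr.
have ftE : \prod_(j < m) (dtj j)`!%:R `^ c = \prod_(j < m) (#|S :\: C j|)`!%:R `^ c :> R.
  by apply: eq_bigr => j _; rewrite dtjE.
have V0 : 0 < (W S)^-1 by rewrite invr_gt0.
have VpE : (W S)^-1 `^ p = (W S)^-1 `^ (p - 1) * (W S)^-1.
  by rewrite -[X in _ = _ * X](powRr1 Vge0) -powRD ?subrK// (gt_eqF V0) implybT.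
rewrite secH -/c ftE; split.
- rewrite (@cover_weights_factor _ _ _ _ (W S)^-1 _ _ (fun j => W (S :\: C j))
    (fun j => partial_volume u Q K (C j)))//; last by move=> j; exact: sec_u.
  rewrite mc VpE [X in X * _ <= _]mulrA -[wedge_norm H]/(W S) -powRM ?(ltW WS0)// WSV powR1 mul1r vol_u [leRHS]mulrCA.
  by rewrite ler_pM2l.
- rewrite (@cover_weights_factor _ _ _ _ (W S)^-1 _ _ (fun j => W (C j))
    (fun j => partial_volume u Q K (S :\: C j)))//; last first.
    by move=> j; have := sec_u _ (SD j); rewrite SDD.
  rewrite mc VpE -[wedge_norm H]/(W S) [X in X * _ <= _]mulrCA WSV mulr1 vol_u powRM// [leRHS]mulrCA.
  by rewrite ler_pM2l// powR_gt0.
- rewrite (@cover_weights_factor _ _ _ _ 1 _ _ (fun j => W (C j))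
    (fun j => partial_volume w Q K (C j)))//; last by move=> j; exact: sec_w.
  by rewrite powR1 mulr1 vol_w [leRHS]mulrCA ler_pM2l.
- rewrite (@cover_weights_factor _ _ _ _ 1 _ _ (fun j => W (S :\: C j))
    (fun j => partial_volume w Q K (S :\: C j)))//; last by move=> j; exact: sec_w.
  by rewrite powR1 mulr1 vol_w powRM ?(ltW WS0)// [leRHS]mulrCA ler_pM2l// powR_gt0.
Qed.
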